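(* Let $\mathcal{G}$ be a compact connected metric graph. Then $\mu_2(\mathcal{G})=\mathcal{L}^D_{2,\infty}(\mathcal{G})$, and any partition realising $\mathcal{L}^D_{2,\infty}(\mathcal{G})$ (i.e. any exhaustive rigid $2$-partition $\mathcal{P}$ of $\mathcal{G}$ with $\Lambda^D_\infty(\mathcal{P})=\mathcal{L}^D_{2,\infty}(\mathcal{G})$) is a generalised nodal partition.
   Context: Metric graphs: a metric graph $\mathcal{G}$ consists of finitely many edges (compact intervals of positive finite length) whose set of endpoints is divided into nonempty disjoint classes, the vertices, the endpoints in a class being identified. Loops, multiple edges and vertices of degree two are allowed; graphs differing only by relabelling or by insertion/removal of vertices of degree two are identified, so any point of an edge may be regarded as a vertex. $\mu_1(\mathcal{G})=0<\mu_2(\mathcal{G})\le\dots$ are the eigenvalues (with multiplicity) of the Laplacian $-\frac{d^2}{dx^2}$ on $\mathcal{G}$ with natural (continuity plus Kirchhoff) vertex conditions; eigenfunctions of $\mathcal{G}$ refer to this operator (real-valued). Partitions: a cut of $\mathcal{G}$ is a metric graph with the same edges (for a suitable representative of $\mathcal{G}$) such that each of its vertex classes is contained in a vertex class of $\mathcal{G}$; a vertex of $\mathcal{G}$ is cut nontrivially if its class is split into at least two classes. A $k$-partition $\mathcal{P}=\{\mathcal{G}_1,\dots,\mathcal{G}_k\}$ of $\mathcal{G}$ is a set of $k$ distinct connected components (clusters) of some cut of $\mathcal{G}$; it is exhaustive if these are all the components. The support $\Omega_i$ of $\mathcal{G}_i$ is the closed subset of $\mathcal{G}$ made of the edges of $\mathcal{G}_i$,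 with topological boundary $\partial\Omega_i$ in $\mathcal{G}$; the support of $\mathcal{P}$ is $\bigcup_i\Omega_i$. The cut set of $\mathcal{P}$ is the set of vertices of $\mathcal{G}$ in $\bigcup_i\Omega_i$ that are cut nontrivially; $\mathcal{V}_D(\mathcal{G}_i)\subset\mathcal{G}_i$ is the set of vertices of $\mathcal{G}_i$ obtained by nontrivially cutting vertices of $\mathcal{G}$. $\mathcal{P}$ is rigid if its cut set equals $\bigcup_i\partial\Omega_i$, and internally connected if it is rigid and $\Omega_i\setminus\partial\Omega_i$ is connected for all $i$. $\mathfrak{R}_k(\mathcal{G})$ is the set of exhaustive rigid $k$-partitions. Energies: $\lambda_1(\mathcal{G}_i)$ is the smallest eigenvalue of the Laplacian on $\mathcal{G}_i$ with Dirichlet conditions at $\mathcal{V}_D(\mathcal{G}_i)$ and natural conditions at all other vertices; $\Lambda^D_\infty(\mathcal{P})=\max_i\lambda_1(\mathcal{G}_i)$; $\mathcal{L}^D_{k,\infty}(\mathcal{G})=\inf_{\mathcal{P}\in\mathfrak{R}_k(\mathcal{G})}\Lambda^D_\infty(\mathcal{P})$. Nodal partitions: the nodal partition associated with an eigenfunction $\psi$ of $\mathcal{G}$ is the unique internally connected, possibly non-exhaustive partition whose support is the union of the edges of $\mathcal{G}$ on which $\psi$ does not vanish identically and whose cut set is the zero set of $\psi$ on that support; its cluster supports are the nodal domains of $\psi$. (The closures of the nodal domains of a function on a cluster are understood in the same way.) A $k$-partition $\mathcal{P}=\{\mathcal{G}_1,\dots,\mathcal{G}_k\}$ is a generalised nodal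 partition if there exist eigenfunctions $\psi_1,\dots,\psi_k$ for $\lambda_1(\mathcal{G}_1),\dots,\lambda_1(\mathcal{G}_k)$ such that (1) for each $i$ there is a cut $\widetilde{\mathcal{G}}_i$ of $\mathcal{G}_i$ such that on each connected component of $\widetilde{\mathcal{G}}_i$ either $\psi_i$ is identically zero or the component is the closure of a nodal domain of $\psi_i$ on $\mathcal{G}_i$; and (2) the $k_0$-partition of $\mathcal{G}$, $k_0\ge k$, consisting of all connected components of the $\widetilde{\mathcal{G}}_i$, $i=1,\dots,k$, on which $\psi_i$ is not identically zero, is the nodal partition associated with some eigenfunction of $\mathcal{G}$. *)

(* Defs.v *)
From HB Require Import structures.
From mathcomp Require Import all_boot all_order all_algebra.
From mathcomp Require Import all_classical all_reals all_analysis.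

Set Implicit Arguments.
Unset Strict Implicit.
Unset Printing Implicit Defensive.

Import Order.TTheory GRing.Theory Num.Theory.
Import numFieldNormedType.Exports.

Local Open Scope classical_set_scope.
Local Open Scope ring_scope.

(** * Metric graphs *)

(* Only the labels in [edges] are edges of the system; the spare labels let a
   cluster keep the edge labels of the graph it is cut from.  The edge [e] is
   the interval [0, len e]. *)
Record edge_system (R : realType) := EdgeSystem {
  label : finType;
  edges : {set label};
  len : label -> R;
  len_gt0 : {in edges, forall e, 0 < len e} }.

(* The endpoint [(e, false)] of [e] is at coordinate 0, [(e, true)] at
   coordinate [len e]. *)
Definition endpoints (R : realType) (E : edge_system R)
    : {set label E * bool} :=
  [set a | a.1 \in edges E]%SET.

Definition end_coord (R : realType) (E : edge_system R) (a : label E * bool)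
    : label E * R :=
  (a.1, if a.2 then len a.1 else 0).

(* A metric graph with edge system [E] is a partition of the endpoints into
   nonempty disjoint classes, its vertices. *)
Record mgraph (R : realType) (E : edge_system R) := MGraph {
  verts : {set {set label E * bool}};
  vertsP : finset.partition verts (endpoints E) }.

Definition same_vertex (R : realType) (E : edge_system R) (G : mgraph E)
    (a b : label E * bool) : Prop :=
  exists2 v, v \in verts G & a \in v /\ b \in v.

(** * The topological space of a metric graph *)

Definition on_edges (R : realType) (E : edge_system R) (p : label E * R)
    : bool :=
  (p.1 \in edges E) && (0 <= p.2 <= len p.1).

(* Equality of points of the quotient in which endpoints in a same vertex are
   identified. *)
Definition same_point (R : realType) (E : edge_system R) (G : mgraph E)
    (p q : label E * R) : Prop :=
  p = q \/
  exists a b, [/\ same_vertex G a b, p = end_coord a & q = end_coord b].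

(* The points of the graph are represented by the points of the disjoint union
   of its edges.  The quotient is not formed: its topology is pulled back to
   the disjoint union, so that the open sets are those of the disjoint union
   which are saturated for [same_point], and all sets of points considered
   below are saturated. *)
Record gpoint (R : realType) (E : edge_system R) (G : mgraph E) := GPoint {
  pt : label E * R;
  ptP : on_edges pt }.

HB.instance Definition _ (R : realType) (E : edge_system R) (G : mgraph E) :=
  [isSub for @pt R E G].
HB.instance Definition _ (R : realType) (E : edge_system R) (G : mgraph E) :=
  [Choice of gpoint G by <:].

Definition gopen (R : realType) (E : edge_system R) (G : mgraph E)
    (U : set (gpoint G)) : Prop :=
  (forall p q : gpoint G, same_point G (pt p) (pt q) -> U p -> U q) /\
  (forall p : gpoint G, U p -> exists2 eps : R, 0 < eps &
     forall q : gpoint G, (pt q).1 = (pt p).1 ->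
       `|(pt q).2 - (pt p).2| < eps -> U q).

Lemma gopenT (R : realType) (E : edge_system R) (G : mgraph E) :
  gopen [set: gpoint G].
Proof. by split=> // p _; exists 1. Qed.

Lemma gopenI (R : realType) (E : edge_system R) (G : mgraph E) :
  setI_closed (@gopen R E G).
Proof.
move=> U V [sU oU] [sV oV]; split=> [p q pq [Up Vp]|p [Up Vp]].
  by split; [exact: sU pq Up | exact: sV pq Vp].
have [d d0 dU] := oU p Up; have [e e0 eV] := oV p Vp.
exists (Num.min d e); first by rewrite lt_min d0 e0.
by move=> q qp; rewrite lt_min => /andP[qd qe]; split; [exact: dU | exact: eV].
Qed.

Lemma gopen_bigU (R : realType) (E : edge_system R) (G : mgraph E) (I : Type)
    (f : I -> set (gpoint G)) :
  (forall i, gopen (f i)) -> gopen (\bigcup_i f i).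
Proof.
move=> of_; split=> [p q pq [i _ fip]|p [i _ fip]].
  by exists i => //; exact: (of_ i).1 pq fip.
have [e e0 ef] := (of_ i).2 p fip.
by exists e => // q qp qe; exists i => //; exact: ef.
Qed.

HB.instance Definition _ (R : realType) (E : edge_system R) (G : mgraph E) :=
  isOpenTopological.Build (gpoint G) (@gopenT R E G) (@gopenI R E G)
    (@gopen_bigU R E G).

Definition boundary (T : topologicalType) (A : set T) : set T :=
  closure A `\` interior A.

Definition connected_graph (R : realType) (E : edge_system R) (G : mgraph E)
    : Prop :=
  [set: gpoint G] !=set0 /\ connected [set: gpoint G].

(* The closed subset of the graph made of the edges in [S]. *)
Definition edge_support (R : realType) (E : edge_system R) (G : mgraph E)
    (S : {set label E}) : set (gpoint G) :=
  [set p | exists2 q : gpoint G, (pt q).1 \in S & same_point G (pt p) (pt q)].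

Arguments edge_support {R E} G S _.

(** * Representatives of a metric graph *)

(* [E'] is obtained from [E] by cutting every edge into finitely many
   consecutive intervals: [e'] is the interval
   [offset e', offset e' + len e'] of [parent e'], traversed in the opposite
   direction when [reversed e']. *)
Record subdivision (R : realType) (E E' : edge_system R) := Subdivision {
  parent : label E' -> label E;
  offset : label E' -> R;
  reversed : label E' -> bool;
  parentP : forall e', e' \in edges E' -> parent e' \in edges E;
  offsetP : forall e', e' \in edges E' ->
    0 <= offset e' /\ offset e' + len e' <= len (parent e');
  subdivision_cover : forall p : label E * R, on_edges p ->
    exists2 e', e' \in edges E' &
      parent e' = p.1 /\ offset e' <= p.2 <= offset e' + len e';
  subdivision_disjoint : forall e1 e2, e1 \in edges E' -> e2 \in edges E' ->
    parent e1 = parent e2 -> e1 != e2 ->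
    offset e1 + len e1 <= offset e2 \/ offset e2 + len e2 <= offset e1 }.

Definition sub_coord (R : realType) (E E' : edge_system R)
    (s : subdivision E E') (p : label E' * R) : label E * R :=
  (parent s p.1,
   if reversed s p.1 then offset s p.1 + len p.1 - p.2 else offset s p.1 + p.2).

(* [H] is [G] with the interior division points of [s] inserted as vertices of
   degree two. *)
Definition subdivides (R : realType) (E E' : edge_system R)
    (s : subdivision E E') (G : mgraph E) (H : mgraph E') : Prop :=
  forall a b, a \in endpoints E' -> b \in endpoints E' ->
    same_vertex H a b <->
    same_point G (sub_coord s (end_coord a)) (sub_coord s (end_coord b)).

(* The graphs obtained from [G] by relabelling and by insertion and removal of
   vertices of degree two are those having a common subdivision with [G]. *)
Definition same_graph (R : realType) (E1 E2 : edge_system R)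
    (G : mgraph E1) (H : mgraph E2) : Prop :=
  exists (E3 : edge_system R) (K : mgraph E3)
    (s : subdivision E1 E3) (t : subdivision E2 E3),
    subdivides s G K /\ subdivides t H K.

(** * Cuts and clusters *)

Definition is_cut (R : realType) (E : edge_system R) (G C : mgraph E) : Prop :=
  forall w, w \in verts C -> exists2 v, v \in verts G & w \subset v.

Definition cut_nontrivially (R : realType) (E : edge_system R)
    (G C : mgraph E) (v : {set label E * bool}) : bool :=
  (v \in verts G) && (1 < #|[set w in verts C | w \subset v]%SET|)%N.

Definition is_cluster (R : realType) (E : edge_system R) (C : mgraph E)
    (S : {set label E}) : Prop :=
  S \subset edges E /\
  exists p : gpoint C, edge_support C S = connected_component [set: gpoint C] p.

Lemma sub_edges_subproof (R : realType) (E : edge_system R)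
    (S : {set label E}) : {in (edges E :&: S)%SET, forall e, 0 < len e}.
Proof. by move=> e /finset.setIP[/len_gt0]. Qed.

Definition sub_edges (R : realType) (E : edge_system R) (S : {set label E})
    : edge_system R :=
  EdgeSystem (@sub_edges_subproof R E S).

(* For a union [S] of components of [C], every vertex class of [C] either
   consists of endpoints of edges in [S] or contains none of them. *)
Definition cluster_verts (R : realType) (E : edge_system R) (C : mgraph E)
    (S : {set label E}) : {set {set label (sub_edges S) * bool}} :=
  [set (v :&: endpoints (sub_edges S))%SET | v in verts C]%SET :\ finset.set0.

Lemma cluster_vertsP (R : realType) (E : edge_system R) (C : mgraph E)
    (S : {set label E}) :
  finset.partition (cluster_verts C S) (endpoints (sub_edges S)).
Proof.
have /and3P[/eqP covC /finset.trivIsetP trC _] := vertsP C.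
apply/and3P; split.
- apply/eqP/finset.setP => a; apply/finset.bigcupP/idP => [[v]|aS].
    by case/finset.setD1P => _ /imsetP[w _ ->] /finset.setIP[].
  have : a \in finset.cover (verts C).
    by rewrite covC; move: aS; rewrite !finset.inE => /andP[-> _].
  case/finset.bigcupP => v vC av; exists (v :&: endpoints (sub_edges S))%SET.
    apply/finset.setD1P; split; last exact: imset_f.
    by apply/finset.set0Pn; exists a; apply/finset.setIP.
  exact/finset.setIP.
- apply/finset.trivIsetP => A B.
  move=> /finset.setD1P[_ /imsetP[v vC ->]] /finset.setD1P[_ /imsetP[w wC ->]].
  move=> vw; have {}vw : v != w by apply: contra_neq vw => ->.
  by apply: disjointW (trC v w vC wC vw); exact: finset.subsetIl.
- by rewrite finset.setD11.
Qed.

Definition cluster_graph (R : realType) (E : edge_system R) (C : mgraph E)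
    (S : {set label E}) : mgraph (sub_edges S) :=
  MGraph (cluster_vertsP C S).

(** * The Laplacian *)

(* A function on a graph is given edgewise; only its values at coordinates in
   [0, len e] for [e] in [edges E] are relevant. *)
Definition edge_fun (R : realType) (E : edge_system R) := label E -> R -> R.

Definition feval (R : realType) (E : edge_system R) (G : mgraph E)
    (f : edge_fun E) (p : gpoint G) : R :=
  f (pt p).1 (pt p).2.

(* Derivative along the closed interval [0, l], one-sided at its ends. *)
Definition has_deriv (R : realType) (l : R) (f : R -> R) (x d : R) : Prop :=
  (f y - f x) / (y - x) @[y --> within `[0, l] x^'] --> d.

(* [g] is the image of [f] under -d^2/dx^2 on [G], with Dirichlet conditions at
   the vertices in [D] and natural conditions at the others.  Only eigenvalue
   equations are considered, for which the derivatives are classical up to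
   the ends of the edges.  The derivative pointing into the edge at the
   endpoint [(e, b)] is the derivative along [e] times (-1)^b. *)
Definition laplacian (R : realType) (E : edge_system R) (G : mgraph E)
    (D : {set {set label E * bool}}) (f g : edge_fun E) : Prop :=
  exists f' : edge_fun E,
  [/\ forall e x, on_edges (e, x) ->
        has_deriv (len e) (f e) x (f' e x) /\
        has_deriv (len e) (f' e) x (- g e x),
      forall v a b, v \in verts G -> a \in v -> b \in v ->
        f a.1 (end_coord a).2 = f b.1 (end_coord b).2,
      forall v a, v \in D -> a \in v -> f a.1 (end_coord a).2 = 0 &
      forall v, v \in verts G -> v \notin D ->
        \sum_(a in v) (-1) ^+ a.2 * f' a.1 (end_coord a).2 = 0].

Definition eigenfunction (R : realType) (E : edge_system R) (G : mgraph E)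
    (D : {set {set label E * bool}}) (m : R) (f : edge_fun E) : Prop :=
  (exists p : gpoint G, feval f p != 0) /\
  laplacian G D f (fun e x => m * f e x).

Definition lambda1 (R : realType) (E : edge_system R) (G : mgraph E)
    (D : {set {set label E * bool}}) : R :=
  inf [set m | exists f, eigenfunction G D m f].

Definition lin_indep (R : realType) (E : edge_system R) (G : mgraph E)
    (k : nat) (f : 'I_k -> edge_fun E) : Prop :=
  forall c : 'I_k -> R,
    (forall p : gpoint G, \sum_(i < k) c i * feval (f i) p = 0) ->
    forall i, c i = 0.

(* The eigenvalues at most [m] have total multiplicity at least [k]. *)
Definition at_least_eigenvalues (R : realType) (E : edge_system R)
    (G : mgraph E) (k : nat) (m : R) : Prop :=
  exists (ms : 'I_k -> R) (f : 'I_k -> edge_fun E),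
    (forall i, ms i <= m /\ eigenfunction G finset.set0 (ms i) (f i)) /\
    lin_indep G f.

(* The [k]-th eigenvalue, [k] >= 1, in nondecreasing order with multiplicity *)
Definition mu (R : realType) (E : edge_system R) (G : mgraph E) (k : nat) : R :=
  inf [set m | at_least_eigenvalues G k m].

(** * Partitions *)

Record gpartition (R : realType) (E : edge_system R) := GPartition {
  base : mgraph E;
  pcut : mgraph E;
  clusters : {set {set label E}} }.

(* The clusters of [P] are components of a cut of [base P]; for a partition of
   a graph [G], [base P] is a representative of [G]. *)
Definition is_partition (R : realType) (E : edge_system R) (P : gpartition E)
    : Prop :=
  is_cut (base P) (pcut P) /\
  forall S, S \in clusters P -> is_cluster (pcut P) S.

Definition kpartition (R : realType) (E0 E : edge_system R) (G : mgraph E0)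
    (k : nat) (P : gpartition E) : Prop :=
  [/\ same_graph G (base P), is_partition P & #|clusters P| = k].

Definition exhaustive (R : realType) (E : edge_system R) (P : gpartition E)
    : Prop :=
  forall S, is_cluster (pcut P) S -> S \in clusters P.

Definition psupport (R : realType) (E : edge_system R) (P : gpartition E)
    : set (gpoint (base P)) :=
  \bigcup_(S in [set` clusters P]) edge_support (base P) S.

Arguments psupport {R E} P _.

Definition pboundary (R : realType) (E : edge_system R) (P : gpartition E)
    : set (gpoint (base P)) :=
  \bigcup_(S in [set` clusters P]) boundary (edge_support (base P) S).

Arguments pboundary {R E} P _.

Definition cut_set (R : realType) (E : edge_system R) (P : gpartition E)
    : set (gpoint (base P)) :=
  [set p | psupport P p /\
     exists2 v, cut_nontrivially (base P) (pcut P) v &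
       exists2 a, a \in v & pt p = end_coord a].

Arguments cut_set {R E} P _.

Definition rigid (R : realType) (E : edge_system R) (P : gpartition E)
    : Prop :=
  cut_set P = pboundary P.

Definition internally_connected (R : realType) (E : edge_system R)
    (P : gpartition E) : Prop :=
  rigid P /\
  forall S, S \in clusters P ->
    connected (edge_support (base P) S `\` boundary (edge_support (base P) S)).

(* The exhaustive rigid [k]-partitions of [G] *)
Definition exh_rigid (R : realType) (E0 E : edge_system R) (G : mgraph E0)
    (k : nat) (P : gpartition E) : Prop :=
  [/\ kpartition G k P, exhaustive P & rigid P].

(** * Energies *)

Definition dirichlet_verts (R : realType) (E : edge_system R)
    (P : gpartition E) (S : {set label E})
    : {set {set label (sub_edges S) * bool}} :=
  [set w in verts (cluster_graph (pcut P) S) |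
    [exists v, cut_nontrivially (base P) (pcut P) v && (w \subset v)]]%SET.

Definition cluster_energy (R : realType) (E : edge_system R)
    (P : gpartition E) (S : {set label E}) : R :=
  lambda1 (cluster_graph (pcut P) S) (dirichlet_verts P S).

(* The supremum of a finite set, hence a maximum *)
Definition energy (R : realType) (E : edge_system R) (P : gpartition E) : R :=
  sup [set l | exists2 S, S \in clusters P & l = cluster_energy P S].

Definition optimal_energy (R : realType) (E0 : edge_system R) (G : mgraph E0)
    (k : nat) : R :=
  inf [set l | exists (E : edge_system R) (P : gpartition E),
    exh_rigid G k P /\ l = energy P].

(** * Nodal partitions *)

Definition nodal_partition (R : realType) (E : edge_system R)
    (f : edge_fun E) (P : gpartition E) : Prop :=
  [/\ is_partition P, internally_connected P,
      psupport P = edge_support (base P) [set e in edges E |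
        `[< exists2 x, 0 <= x <= len e & f e x != 0 >]]%SET &
      cut_set P = psupport P `&` [set p | feval f p = 0]].

(* A nodal domain of [f] is a connected component of the set where [f] does
   not vanish. *)
Definition closure_of_nodal_domain (R : realType) (E : edge_system R)
    (G : mgraph E) (f : edge_fun E) (A : set (gpoint G)) : Prop :=
  exists2 p : gpoint G, feval f p != 0 &
    A = closure (connected_component [set q | feval f q != 0] p).

Definition vanishes_on (R : realType) (E : edge_system R)
    (f : edge_fun E) (T : {set label E}) : Prop :=
  forall e x, e \in T -> on_edges (e, x) -> f e x = 0.

Definition subdivided_edges (R : realType) (E E' : edge_system R)
    (s : subdivision E E') (S : {set label E}) : {set label E'} :=
  [set e in edges E' | parent s e \in S]%SET.

(* [Q] is the same partition as [P], over the finer representative given by a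
   subdivision. *)
Definition same_partition_finer (R : realType) (E E' : edge_system R)
    (P : gpartition E) (Q : gpartition E') : Prop :=
  exists s : subdivision E E',
  [/\ subdivides s (base P) (base Q), subdivides s (pcut P) (pcut Q) &
      clusters Q =
        [set subdivided_edges s S | S in clusters P]%SET].

(* The cuts of the individual clusters [cluster_graph (pcut P) S] are the
   restrictions [cluster_graph C S] of one cut [C] of [pcut P];
   as the [psi S] are nonzero, the nodal partition has at least as many
   clusters as [P]. *)
Definition generalised_nodal_here (R : realType) (E : edge_system R)
    (P : gpartition E) : Prop :=
  exists (psi : {set label E} -> edge_fun E) (C : mgraph E),
  [/\ forall S, S \in clusters P ->
        eigenfunction (cluster_graph (pcut P) S) (dirichlet_verts P S)
          (cluster_energy P S) (psi S),
      is_cut (pcut P) C,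
      forall S T, S \in clusters P -> is_cluster (cluster_graph C S) T ->
        vanishes_on (psi S) T \/
        @closure_of_nodal_domain R (sub_edges S)
          (cluster_graph (pcut P) S) (psi S)
          (edge_support (cluster_graph (pcut P) S) T) &
      exists (m : R) (f : edge_fun E),
        eigenfunction (base P) finset.set0 m f /\
        nodal_partition f (GPartition (base P) C
          [set T : {set label E} | `[< exists2 S, S \in clusters P &
             is_cluster (cluster_graph C S) T /\
             ~ vanishes_on (psi S) T >]]%SET)].

Definition generalised_nodal (R : realType) (E : edge_system R)
    (P : gpartition E) : Prop :=
  exists (E' : edge_system R) (Q : gpartition E'),
    same_partition_finer P Q /\ generalised_nodal_here Q.

(* Main.v *)
Require Import Defs.
From mathcomp Require Import all_boot all_order all_algebra.
From mathcomp Require Import all_classical all_reals all_analysis.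
From mathcomp Require Import ring lra.
Set Implicit Arguments.
Unset Strict Implicit.
Unset Printing Implicit Defensive.
Import Order.TTheory GRing.Theory Num.Theory.
Import numFieldNormedType.Exports.
Local Open Scope classical_set_scope.
Local Open Scope ring_scope.

(** The two quantities are compared through the quadratic form of f'^2 - w^2 f^2
    restricted to the functions that solve - f'' = w^2 f between the points of a
    fine regular division of the edges. Such a function is given by finitely many
    values, and the form becomes [dform], whose kernel on the functions continuous
    at the vertices (and zero at the Dirichlet vertices) consists of the values of
    the eigenfunctions for w^2 ([laplacian_kernel], [kernel_laplacian]). The form
    depends continuously on w, up to w = 0, and decreases with w ([dform_decr]).

    Existence. By compactness there is a least w at which the form is not positive
    ([first_frequency]); there it is semidefinite with a null vector, which is in
    its kernel. With Dirichlet vertices this gives the lowest eigenvalue, with a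
    nonnegative eigenfunction because absolute values lower the form
    ([ground_state]). On functions orthogonal to the constants it gives the least
    positive eigenvalue of a connected graph ([second_frequency]), which is its
    second one ([mu2_least_positive]).

    Lower bound. Let w^2 be the energy of a 2-partition. The two ground states,
    extended by zero, have a nonpositive form at w and disjoint supports, so the
    form is nonpositive on a combination of them that is orthogonal to the
    constants; hence the second eigenvalue is at most w^2. If it is equal to w^2,
    this combination is a null vector of a semidefinite form, so it is an
    eigenfunction. Both ground states being nonnegative, it is positive on a part
    of one cluster and negative on a part of the other, and the nodal domains of
    the ground states are those of this eigenfunction
    ([two_partition_energy], [nodal_generalised]).

    Upper bound. Let f be an eigenfunction for the second eigenvalue; it changes
    sign. Once its isolated zeros are vertices ([zero_subdivision]), the graph is
    cut at zeros of f into two connected sides, one containing a positive nodal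
    domain and the other a negative one ([connected_bipartition]). The restriction
    of f to either side is a Dirichlet eigenfunction, so the energy of this
    partition is at most the second eigenvalue ([nodal_bipartition]).

    A partition is a partition of a representative of the graph, so eigenfunctions
    and connectedness are carried along subdivisions in both directions
    ([eigenfunction_fine], [eigenfunction_coarse]); the topological conditions
    are turned into conditions on sets of edges by [component_of_edges]. *)

(** * Derivatives on a closed interval *)

(** In this form the point itself need not be excluded, and one-sided and two-
    sided derivatives are treated alike. *)
Lemma has_derivP (R : realType) (l : R) (f : R -> R) (x d : R) :
  has_deriv l f x d <->
  forall e, 0 < e -> exists2 r, 0 < r & forall y, 0 <= y <= l ->
    `|y - x| < r -> `|f y - f x - d * (y - x)| <= e * `|y - x|.
Proof.
rewrite /has_deriv; split.
  move=> /cvgrPdist_le H e e0; have := H e e0.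
  rewrite near_withinE => /nbhs_ballP[r /= r0 Hr].
  exists r => // y yl yx; have [->|nyx] := eqVneq y x.
    by rewrite !subrr mulr0 subr0 normr0 mulr0.
  have := Hr y; rewrite /ball /= distrC => /(_ yx nyx); rewrite in_itv /= => /(_ yl).
  have y0 : y - x != 0 by rewrite subr_eq0.
  have -> : f y - f x - d * (y - x) = - ((d - (f y - f x) / (y - x)) * (y - x)).
    by field.
  by move=> K; rewrite normrN normrM ler_wpM2r.
move=> H; apply/cvgrPdist_le => e e0; have [r r0 Hr] := H e e0.
rewrite near_withinE; apply/nbhs_ballP; exists r => //= y.
rewrite /ball /= distrC => yx nyx; rewrite in_itv /= => yl.
have y0 : y - x != 0 by rewrite subr_eq0.
have := Hr y yl yx.
have -> : f y - f x - d * (y - x) = - ((d - (f y - f x) / (y - x)) * (y - x)).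
  by field.
by rewrite normrN normrM ler_pM2r // normr_gt0.
Qed.

Lemma has_deriv_is_derive (R : realType) (l : R) (f : R -> R) (x d : R) :
  0 < x < l -> has_deriv l f x d -> is_derive x 1 f d.
Proof.
move=> /andP[x0 xl] /has_derivP H.
have lim : h^-1 *: ((f \o shift x) (h *: 1) - f x) @[h --> 0^'] --> d.
  apply/cvgrPdist_le => e e0; have [r r0 Hr] := H e e0.
  apply/nbhs_ballP; exists (Num.min r (Num.min x (l - x))) => /=.
    by rewrite !lt_min r0 x0 subr_gt0 xl.
  move=> h; rewrite /ball /= sub0r normrN !lt_min => /and3P[hr hx hlx] h0.
  have := Hr (h + x); rewrite addrK => /(_ _ hr).
  move: hx hlx; rewrite !ltr_norml => /andP[h1 h2] /andP[h3 h4].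
  have -> : 0 <= h + x <= l by lra.
  move=> /(_ isT) K; rewrite /GRing.scale /= mulr1.
  have -> : d - h^-1 * (f (h + x) - f x) = - (f (h + x) - f x - d * h) / h.
    by field.
  by rewrite normrM normfV normrN ler_pdivrMr // normr_gt0.
split; last by rewrite /derive; apply/cvg_lim.
by apply/cvg_ex; exists d.
Qed.

Lemma has_deriv_cvg (R : realType) (l : R) (f : R -> R) (x d : R) :
  has_deriv l f x d -> f y @[y --> within `[0, l] (nbhs x)] --> f x.
Proof.
move=> /has_derivP H; apply/cvgrPdist_le => e e0.
have [r r0 Hr] := H 1 ltr01.
rewrite near_withinE; apply/nbhs_ballP.
have k0 : 0 < 1 + `|d| by rewrite ltr_pwDl.
exists (Num.min r (e / (1 + `|d|))); first by rewrite /= lt_min r0 divr_gt0.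
move=> y; rewrite /ball /= distrC lt_min => /andP[yr ye] /=; rewrite in_itv /= => yl.
have := Hr y yl yr; rewrite mul1r => K.
rewrite distrC; have -> : f y - f x = (f y - f x - d * (y - x)) + d * (y - x) by ring.
apply: le_trans (ler_normD _ _) _; rewrite normrM.
move: ye; rewrite ltr_pdivlMr // => ye.
nra.
Qed.

Lemma has_deriv_continuous (R : realType) (l : R) (f f' : R -> R) :
  (forall x, 0 <= x <= l -> has_deriv l f x (f' x)) ->
  {within `[0, l], continuous f}.
Proof.
move=> H; apply/subspace_continuousP => x /=; rewrite in_itv /= => xl.
exact: has_deriv_cvg (H x xl).
Qed.

Lemma is_derive_has_deriv (R : realType) (l : R) (f : R -> R) (x d : R) :
  is_derive x 1 f d -> has_deriv l f x d.
Proof.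
move=> [df dfd]; apply/has_derivP => e e0.
have : h^-1 *: ((f \o shift x) (h *: 1) - f x) @[h --> 0^'] --> d.
  by rewrite -dfd; exact: df.
move=> /cvgrPdist_le /(_ e e0) /nbhs_ballP[r /= r0 Hr].
exists r => // y _ yx; have [->|nyx] := eqVneq y x.
  by rewrite !subrr mulr0 subr0 normr0 mulr0.
have y0 : y - x != 0 by rewrite subr_eq0.
have := Hr (y - x); rewrite /ball /= sub0r normrN => /(_ yx y0).
rewrite /GRing.scale /= mulr1 subrK.
have -> : f y - f x - d * (y - x) = - ((d - (y - x)^-1 * (f y - f x)) * (y - x)).
  by field.
by move=> K; rewrite normrN normrM ler_wpM2r.
Qed.

Lemma has_deriv_unique (R : realType) (l : R) (f : R -> R) (x d1 d2 : R) :
  0 < x < l -> has_deriv l f x d1 -> has_deriv l f x d2 -> d1 = d2.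
Proof.
move=> xl /(has_deriv_is_derive xl)[_ <-] /(has_deriv_is_derive xl)[_ <-] //.
Qed.

Lemma has_deriv_ext (R : realType) (l : R) (f g : R -> R) (x d : R) :
  (forall y, 0 <= y <= l -> f y = g y) -> 0 <= x <= l ->
  has_deriv l f x d -> has_deriv l g x d.
Proof.
move=> fg xl /has_derivP H; apply/has_derivP => e /H [r r0 Hr].
by exists r => // y yl yx; rewrite -!fg //; exact: Hr.
Qed.

Lemma has_deriv_scale (R : realType) (l k : R) (f : R -> R) (x d : R) :
  has_deriv l f x d -> has_deriv l (fun y => k * f y) x (k * d).
Proof.
by move=> H; rewrite /has_deriv; under eq_fun do rewrite -mulrBr -mulrA;
  exact: cvgMr.
Qed.

Lemma has_deriv_affine (R : realType) (l l' : R) (f : R -> R) (s c x d : R) :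
  s = 1 \/ s = -1 ->
  (forall y, 0 <= y <= l' -> 0 <= c + s * y <= l) ->
  has_deriv l f (c + s * x) d ->
  has_deriv l' (fun y => f (c + s * y)) x (s * d).
Proof.
move=> ss sub /has_derivP H; apply/has_derivP => e /H[r r0 Hr]; exists r => // y yl yx.
have E : c + s * y - (c + s * x) = s * (y - x) by ring.
have n1 : `|s * (y - x)| = `|y - x|.
  by rewrite normrM; case: ss => ->; rewrite ?normrN normr1 mul1r.
have := Hr _ (sub y yl); rewrite E n1 => /(_ yx).
by rewrite mulrA (mulrC d s).
Qed.

Lemma has_deriv_ge0 (R : realType) (l : R) (f f' : R -> R) :
  (forall x, 0 <= x <= l -> has_deriv l f x (f' x)) ->
  (forall x, 0 < x < l -> 0 <= f' x) ->
  forall x y, 0 <= x -> x <= y -> y <= l -> f x <= f y.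
Proof.
move=> H H0; have cf := has_deriv_continuous H.
apply: ger0_derive1_ndecr => // x; rewrite in_itv /= => xl.
  by have /andP[x0 x1] := xl; have [] := has_deriv_is_derive xl (H x _); rewrite ?ltW.
have /andP[x0 x1] := xl.
have [] := has_deriv_is_derive xl (H x _); first by rewrite !ltW.
by move=> _; rewrite derive1E => ->; exact: H0.
Qed.

Lemma has_derivN (R : realType) (l : R) (f : R -> R) (x d : R) :
  has_deriv l f x d -> has_deriv l (fun y => - f y) x (- d).
Proof.
move=> H; have -> : (fun y => - f y) = (fun y => -1 * f y).
  by apply/funext => y; rewrite mulN1r.
by rewrite -[- d]mulN1r; exact: has_deriv_scale.
Qed.

Lemma has_deriv_cst (R : realType) (l : R) (f f' : R -> R) :
  (forall x, 0 <= x <= l -> has_deriv l f x (f' x)) ->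
  (forall x, 0 < x < l -> f' x = 0) ->
  forall x, 0 <= x <= l -> f x = f 0.
Proof.
move=> H H0 x /andP[x0 xl]; apply/eqP; rewrite eq_le; apply/andP; split.
  rewrite -lerN2; apply: (@has_deriv_ge0 R l (fun y => - f y) (fun y => - f' y)) => //.
    by move=> y yl; apply: has_derivN; exact: H.
  by move=> y /H0 ->; rewrite oppr0.
apply: (@has_deriv_ge0 R l f f') => // y /H0 -> //.
Qed.

Lemma has_derivM (R : realType) (l : R) (f g : R -> R) (x d d' : R) :
  has_deriv l f x d -> has_deriv l g x d' -> 0 <= x <= l ->
  has_deriv l (fun y => f y * g y) x (d * g x + f x * d').
Proof.
move=> Hf Hg xl; rewrite /has_deriv.
have -> : (fun y => (f y * g y - f x * g x) / (y - x)) =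
          (fun y => ((f y - f x) / (y - x)) * g y + f x * ((g y - g x) / (y - x))).
  by apply/funext => y; ring.
apply: cvgD; last exact: cvgMr.
apply: cvgM => //.
apply: cvg_trans (has_deriv_cvg Hg) => A [r /= r0 Hr]; exists r => //= y yr yx yl.
exact: Hr.
Qed.

Lemma has_derivD (R : realType) (l : R) (f g : R -> R) (x d d' : R) :
  has_deriv l f x d -> has_deriv l g x d' ->
  has_deriv l (fun y => f y + g y) x (d + d').
Proof.
move=> Hf Hg; rewrite /has_deriv.
have -> : (fun y => (f y + g y - (f x + g x)) / (y - x)) =
          (fun y => ((f y - f x) / (y - x)) + ((g y - g x) / (y - x))).
  by apply/funext => y; ring.
exact: cvgD.
Qed.

(** * The equation - f'' = w^2 f *)

Definition trig (R : realType) (w a b x : R) : R :=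
  a * cos (w * x) + b * sin (w * x).

Lemma trig0 (R : realType) (w a b : R) : trig w a b 0 = a.
Proof. by rewrite /trig mulr0 cos0 sin0 mulr1 mulr0 addr0. Qed.

Lemma trigD (R : realType) (w a b x y : R) :
  trig w a b (x + y) = trig w a b x * cos (w * y) + trig w b (- a) x * sin (w * y).
Proof. by rewrite /trig mulrDr cosD sinD; ring. Qed.

Lemma is_derive_trig (R : realType) (w a b x : R) :
  is_derive x 1 (trig w a b) (w * trig w b (- a) x).
Proof.
have dw : is_derive x 1 (fun y : R => w * y) w.
  have := @is_deriveZ R _ _ id w x 1 1 _; rewrite /GRing.scale /= mulr1.
  by apply; exact: is_derive_id.
have dc := @is_derive1_comp R cos (fun y => w * y) x (- sin (w * x)) w _ dw.
have ds := @is_derive1_comp R sin (fun y => w * y) x (cos (w * x)) w _ dw.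
have := is_deriveD (is_deriveZ a (dc (is_derive_cos _)))
             (is_deriveZ b (ds (is_derive_sin _))).
rewrite [X in is_derive _ _ X _](_ : _ = trig w a b); last exact/funext.
move=> H; apply: (is_derive_eq H); rewrite /GRing.scale /= /trig; ring.
Qed.

Definition ode (R : realType) (l m : R) (f f' : R -> R) : Prop :=
  forall x, 0 <= x <= l ->
    has_deriv l f x (f' x) /\ has_deriv l f' x (- (m * f x)).

Lemma ode_trig (R : realType) (l w a b : R) :
  ode l (w ^+ 2) (trig w a b) (fun x => w * trig w b (- a) x).
Proof.
move=> x _; split; first by apply: is_derive_has_deriv; exact: is_derive_trig.
have -> : - (w ^+ 2 * trig w a b x) = w * (w * trig w (- a) (- b) x).
  by rewrite /trig; ring.
by apply: has_deriv_scale; apply: is_derive_has_deriv; exact: is_derive_trig.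
Qed.

(** The energy w^2 g^2 + g'^2 of the difference with the trigonometric solution
    having the same initial data is constant. *)
Lemma ode_trigP (R : realType) (l w : R) (f f' : R -> R) :
  0 < w -> ode l (w ^+ 2) f f' -> forall x, 0 <= x <= l ->
  f x = trig w (f 0) (f' 0 / w) x /\ f' x = w * trig w (f' 0 / w) (- f 0) x.
Proof.
move=> w0 H; set F := trig _ _ _; set F' := fun x => w * trig w (f' 0 / w) (- f 0) x.
have HF : ode l (w ^+ 2) F F' by exact: ode_trig.
pose g x := f x + - F x; pose g' x := f' x + - F' x.
have Hg x : 0 <= x <= l -> has_deriv l g x (g' x).
  by move=> xl; apply: has_derivD; [exact: (H x xl).1 | apply: has_derivN; exact: (HF x xl).1].
have Hg' x : 0 <= x <= l -> has_deriv l g' x (- (w ^+ 2 * g x)).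
  move=> xl; have -> : - (w ^+ 2 * g x) = - (w ^+ 2 * f x) + - - (w ^+ 2 * F x).
    by rewrite /g; ring.
  by apply: has_derivD; [exact: (H x xl).2 | apply: has_derivN; exact: (HF x xl).2].
pose E x := w ^+ 2 * (g x * g x) + g' x * g' x.
have E0 x : 0 <= x <= l -> E x = E 0.
  apply: (@has_deriv_cst R l E (fun=> 0)) => // y yl.
  have := has_derivD (@has_deriv_scale _ _ (w ^+ 2) _ _ _ (has_derivM (Hg y yl) (Hg y yl) yl))
             (has_derivM (Hg' y yl) (Hg' y yl) yl).
  by congr has_deriv; ring.
have EZ : E 0 = 0.
  by rewrite /E /g /g' /F /F' !trig0; field; rewrite gt_eqF.
move=> x xl; have := E0 x xl; rewrite EZ /E => Ex.
have w2 : 0 < w ^+ 2 by rewrite exprn_gt0.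
move/eqP: Ex; rewrite -!expr2 paddr_eq0; last 2 first.
- by rewrite mulr_ge0 ?sqr_ge0.
- exact: sqr_ge0.
rewrite mulf_eq0 !expf_eq0 /= (gt_eqF w0) /= => /andP[/eqP gx /eqP g'x].
by split; apply/eqP; rewrite -subr_eq0; apply/eqP.
Qed.

(** * The form of a piece of an edge *)

Lemma sin_le_id (R : realType) (x : R) : 0 <= x -> sin x <= x.
Proof.
move=> x0; have [c _] := @MVT_segment R sin cos 0 x x0 (fun y _ => is_derive_sin y)
  (continuous_subspaceT (@continuous_sin R)).
by rewrite sin0 !subr0 => ->; rewrite ler_piMl ?cos_le1.
Qed.

Lemma cos_le_sinc (R : realType) (x : R) : 0 <= x <= pi -> x * cos x <= sin x.
Proof.
move=> /andP[x0 xp]; have [c] := @MVT_segment R sin cos 0 x x0 (fun y _ => is_derive_sin y)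
  (continuous_subspaceT (@continuous_sin R)).
rewrite in_itv /= => /andP[c0 cx]; rewrite sin0 !subr0 => ->.
rewrite mulrC ler_wpM2r //; have [->//|ncx] := eqVneq c x.
rewrite ltW // ltr_cos ?in_itv /= ?x0 ?xp ?c0 ?(le_trans cx) //.
by rewrite lt_neqAle ncx.
Qed.

(** The weights below are written with this function because they have to be
    continuous up to frequency 0. *)
Definition sinc (R : realType) (x : R) : R := if x == 0 then 1 else sin x / x.

Lemma sincE (R : realType) (x : R) : x * sinc x = sin x.
Proof.
by rewrite /sinc; case: eqP => [->|/eqP x0]; rewrite ?sin0 ?mul0r // mulrC divfK.
Qed.

Lemma sinc_gt0 (R : realType) (x : R) : 0 <= x < pi -> 0 < sinc x.
Proof.
move=> /andP[x0 xp]; rewrite /sinc; case: eqP => [//|/eqP nx0].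
have x1 : 0 < x by rewrite lt_def nx0.
by rewrite divr_gt0 // sin_gt0_pi // x1.
Qed.

Lemma continuous_sinc (R : realType) : continuous (@sinc R).
Proof.
move=> x; have [->|x0] := eqVneq x 0.
  apply/continuous_withinNx; rewrite /sinc eqxx -/(sinc _).
  have [d1 d2] := is_derive_sin (0 : R).
  have : h^-1 *: ((sin \o shift 0) (h *: 1) - sin 0) @[h --> (0 : R)^'] --> (1 : R).
    by rewrite -[X in _ --> X](@cos0 R) -d2; exact: d1.
  apply: cvg_trans; apply: near_eq_cvg; apply/nbhs_ballP; exists 1 => //= y _ y0.
  by rewrite (negbTE y0) sin0 subr0 addr0 /GRing.scale /= mulr1 mulrC.
have : (fun y : R => sin y / y) y @[y --> x] --> sin x / x.
  by apply: cvgM; [exact: continuous_sin | exact: cvgV].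
rewrite /continuous_at {2}/sinc (negbTE x0); apply: cvg_trans; apply: near_eq_cvg.
near=> y; rewrite /sinc ifF //; apply/negbTE; near: y.
exact: cvgr_neq0 (@cvg_id _ (nbhs x)) x0.
Unshelve. all: by end_near.
Qed.

(** The minimum of the integral of f'^2 - w^2 f^2 over an interval of length h,
    among the functions with values a and b at the ends, is stiff (a - b)^2 -
    w^2 mass (a^2 + b^2) when w h < pi. For w > 0 the weights are stiff = w /
    sin (w h) and mass = tan (w h / 2) / w. *)
Definition stiff (R : realType) (w h : R) : R := (h * sinc (w * h))^-1.
Definition mass (R : realType) (w h : R) : R :=
  (h / 2) * sinc (w * h / 2) / cos (w * h / 2).

Definition pform (R : realType) (w h a b c d : R) : R :=
  stiff w h * ((a - b) * (c - d)) - w ^+ 2 * mass w h * (a * c + b * d).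

Section weights.
Variables (R : realType) (w h : R).
Hypotheses (w0 : 0 <= w) (h0 : 0 < h) (wh : w * h < pi).

Let y : R := w * h / 2.
Let y0 : 0 <= y. Proof. by rewrite /y !mulr_ge0 // ltW. Qed.
Let ypi : y < pi / 2. Proof. by rewrite /y ltr_pM2r ?invr_gt0. Qed.

Lemma cos_half_gt0 : 0 < cos (w * h / 2).
Proof.
by apply: cos_gt0_pihalf; rewrite ypi (lt_le_trans _ y0) // oppr_lt0 divr_gt0 // pi_gt0.
Qed.

Lemma stiff_gt0 : 0 < stiff w h.
Proof.
by rewrite invr_gt0 mulr_gt0 // sinc_gt0 // wh mulr_ge0 // ltW.
Qed.

Lemma mass_gt0 : 0 < mass w h.
Proof.
rewrite /mass divr_gt0 ?cos_half_gt0 // mulr_gt0 ?divr_gt0 //.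
rewrite sinc_gt0 // y0 (lt_le_trans ypi) // ler_pdivrMr // ler_peMr ?pi_ge0 //.
by rewrite ler1n.
Qed.

End weights.

Section positive_frequency.
Variables (R : realType) (w h : R).
Hypotheses (w1 : 0 < w) (h0 : 0 < h) (wh : w * h < pi).

Let w0 : 0 <= w. Proof. exact: ltW. Qed.

Lemma sin_wh_gt0 : 0 < sin (w * h).
Proof. by apply: sin_gt0_pi; rewrite wh mulr_gt0. Qed.

Lemma stiffE : stiff w h = w / sin (w * h).
Proof.
rewrite /stiff -sincE; have := sinc_gt0 (x := w * h).
rewrite wh mulr_ge0 ?(ltW h0) // => /(_ isT) s0.
by field; rewrite (gt_eqF h0) (gt_eqF w1) (gt_eqF s0).
Qed.

Lemma sin_half_gt0 : 0 < sin (w * h / 2).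
Proof. by apply: sin_gt0_pihalf; rewrite !mulr_gt0 //= ltr_pM2r ?invr_gt0. Qed.

Lemma sin_dbl : sin (w * h) = 2 * sin (w * h / 2) * cos (w * h / 2).
Proof.
have {1}-> : w * h = (w * h / 2) *+ 2 by rewrite -mulr_natr divfK.
by rewrite sin_mulr2n -mulr_natr; ring.
Qed.

Lemma cos_dbl : cos (w * h) = 1 - 2 * sin (w * h / 2) ^+ 2.
Proof.
have {1}-> : w * h = (w * h / 2) *+ 2 by rewrite -mulr_natr divfK.
by rewrite cos_mulr2n -mulr_natr cos2sin2; ring.
Qed.

Lemma massE : mass w h = sin (w * h / 2) / (w * cos (w * h / 2)).
Proof.
rewrite /mass -sincE; have := cos_half_gt0 w0 h0 wh => c0.
by field; rewrite (gt_eqF w1) (gt_eqF c0).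
Qed.

Lemma stiff_massE : stiff w h - w ^+ 2 * mass w h = w * cos (w * h) / sin (w * h).
Proof.
rewrite stiffE massE sin_dbl cos_dbl.
have := cos_half_gt0 w0 h0 wh; have := sin_half_gt0 => s0 c0.
by field; rewrite (gt_eqF w1) (gt_eqF c0) (gt_eqF s0).
Qed.

(** The partial derivatives of the form of a piece at the values of a solution are
    the derivatives of the solution at the ends of the piece, pointing outwards;
    [trig w b (-a)] is the derivative of [trig w a b] divided by [w]. *)
Lemma trig_flux a b x :
  stiff w h * (trig w a b x - trig w a b (x + h)) - w ^+ 2 * mass w h * trig w a b x
    = - (w * trig w b (- a) x) /\
  stiff w h * (trig w a b (x + h) - trig w a b x)
      - w ^+ 2 * mass w h * trig w a b (x + h)
    = w * trig w b (- a) (x + h).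
Proof.
set F := trig w a b; set F1 := trig w b (- a).
have -> : stiff w h * (F x - F (x + h)) - w ^+ 2 * mass w h * F x =
   (stiff w h - w ^+ 2 * mass w h) * F x - stiff w h * F (x + h) by ring.
have -> : stiff w h * (F (x + h) - F x) - w ^+ 2 * mass w h * F (x + h) =
   (stiff w h - w ^+ 2 * mass w h) * F (x + h) - stiff w h * F x by ring.
rewrite stiff_massE stiffE.
have s0 := sin_wh_gt0.
have E1 : F (x + h) = F x * cos (w * h) + F1 x * sin (w * h) by exact: trigD.
have E2 : F1 (x + h) = F1 x * cos (w * h) - F x * sin (w * h).
  rewrite /F1 trigD -/F1; have -> : trig w (- a) (- b) x = - F x.
    by rewrite /F /trig; ring.
  by ring.
rewrite E1 E2; have := cos2Dsin2 (w * h).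
move: (F x) (F1 x) (sin (w * h)) (cos (w * h)) s0 => f f1 s c s0 cs.
split; first by field; rewrite gt_eqF.
have -> : w * c / s * (f * c + f1 * s) - w / s * f = w * c * f1 + w * f * (c ^+ 2 - 1) / s.
  by field; rewrite gt_eqF.
have -> : c ^+ 2 - 1 = - s ^+ 2 by lra.
by field; rewrite gt_eqF.
Qed.

Lemma trig_interp a b x s :
  trig w a b (x + s) * sin (w * h) =
  trig w a b x * sin (w * (h - s)) + trig w a b (x + h) * sin (w * s).
Proof.
rewrite !trigD mulrBr sinB.
by move: (trig w a b x) (trig w b (- a) x) => f g; ring.
Qed.

Lemma trig_recurrence a b x :
  trig w a b (x + h + h) = 2 * cos (w * h) * trig w a b (x + h) - trig w a b x.
Proof.
rewrite (trigD _ _ _ (x + h)) !trigD.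
have := cos2Dsin2 (w * h); have -> : trig w (- a) (- b) x = - trig w a b x.
    by rewrite /trig; ring.
move: (trig w a b x) (trig w b (- a) x) (sin (w * h)) (cos (w * h)) => f g s c cs.
apply/eqP; rewrite -subr_eq0; apply/eqP.
transitivity (f * (1 - (c ^+ 2 + s ^+ 2))); first by ring.
by rewrite cs subrr mulr0.
Qed.

End positive_frequency.

Lemma pform_half (R : realType) (w h a b : R) :
  0 < w -> 0 < h -> w * h < pi ->
  pform w h a b a b =
  (w * cos (w * h / 2) / sin (w * h / 2) * (a - b) ^+ 2
   - w * sin (w * h / 2) / cos (w * h / 2) * (a + b) ^+ 2) / 2.
Proof.
move=> w0 h0 wh; have ww := ltW w0.
have c0 := cos_half_gt0 ww h0 wh; have s0 := sin_half_gt0 w0 h0 wh.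
rewrite /pform (stiffE w0 h0 wh) (massE w0 h0 wh) sin_dbl.
have := cos2Dsin2 (w * h / 2).
move: (sin _) (cos _) c0 s0 => s c c0 s0 cs.
have -> : w / (2 * s * c) = w * (c / s + s / c) / 2.
  rewrite -[w in LHS]mulr1 -cs; field.
  by rewrite cs oner_eq0 (gt_eqF c0) (gt_eqF s0).
by field; rewrite (gt_eqF w0) (gt_eqF c0) (gt_eqF s0).
Qed.

(** On a fixed piece the form decreases with the frequency: with y = w h / 2,
    y tan y increases and y cot y decreases. *)
Lemma pform_decr (R : realType) (w1 w2 h a b : R) :
  0 < w1 -> w1 < w2 -> 0 < h -> w2 * h < pi ->
  pform w2 h a b a b <= pform w1 h a b a b /\
  (a + b != 0 -> pform w2 h a b a b < pform w1 h a b a b).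
Proof.
move=> w10 w12 h0 w2h.
have w20 := lt_trans w10 w12.
have w1h : w1 * h < pi by apply: lt_trans w2h; rewrite ltr_pM2r.
rewrite !pform_half //.
have c1 := cos_half_gt0 (ltW w10) h0 w1h; have s1 := sin_half_gt0 w10 h0 w1h.
have c2 := cos_half_gt0 (ltW w20) h0 w2h; have s2 := sin_half_gt0 w20 h0 w2h.
set y1 := w1 * h / 2 in c1 s1 *; set y2 := w2 * h / 2 in c2 s2 *.
have y10 : 0 < y1 by rewrite /y1 !mulr_gt0.
have y12 : y1 < y2 by rewrite /y1 /y2 ltr_pM2r // ltr_pM2r.
have y2p : y2 < pi / 2 by rewrite /y2 ltr_pM2r.
have pp := @pi_gt0 R.
have p2 : pi / 2 < pi :> R by lra.
have c21 : cos y2 < cos y1.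
  by rewrite ltr_cos ?in_itv /=; [lra | lra | lra].
have s12 : sin y1 < sin y2.
  by rewrite ltr_sin ?in_itv /=; [lra | lra | lra].
have K : y2 * cos y2 * sin y1 <= y1 * cos y1 * sin y2.
  have d1 : (y2 - y1) * cos (y2 - y1) <= sin (y2 - y1) by apply: cos_le_sinc; lra.
  have d2 : cos y2 <= cos (y2 - y1).
    by rewrite ltW // ltr_cos ?in_itv /=; lra.
  have d3 : sin y1 <= y1 by apply: sin_le_id; lra.
  have E : y1 * cos y1 * sin y2 - y2 * cos y2 * sin y1 =
     y1 * sin (y2 - y1) - (y2 - y1) * cos y2 * sin y1 by rewrite sinB; ring.
  rewrite -subr_ge0 E subr_ge0.
  apply: (@le_trans _ _ ((y2 - y1) * cos y2 * y1)); first by apply: ler_wpM2l => //; apply: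
    mulr_ge0; [lra | exact: ltW].
  rewrite [leLHS]mulrC ler_pM2l //; apply: le_trans d1.
  by rewrite ler_wpM2l // subr_ge0 ltW.
have P1 : w2 * cos y2 / sin y2 <= w1 * cos y1 / sin y1.
  rewrite ler_pdivrMr // mulrAC ler_pdivlMr //.
  have h20 : 0 < h / 2 by rewrite divr_gt0.
  rewrite -(ler_pM2l h20); move: K; rewrite /y1 /y2.
  by congr (_ <= _); ring.
have P2 : w1 * sin y1 / cos y1 < w2 * sin y2 / cos y2.
  rewrite ltr_pdivrMr // mulrAC ltr_pdivlMr //.
  have : w1 * sin y1 < w2 * sin y2 by apply: ltr_pM => //; apply: ltW.
  by move=> H; apply: ltr_pM => //; [apply: mulr_ge0; exact: ltW | exact: ltW].
rewrite ler_pM2r ?ltr_pM2r ?invr_gt0 //.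
split => [|ab].
  by apply: lerB; rewrite ler_wpM2r ?sqr_ge0 // ltW.
apply: ler_ltB; first by rewrite ler_wpM2r ?sqr_ge0.
by rewrite ltr_pM2r // lt_def sqrf_eq0 ab sqr_ge0.
Qed.

(** * Vertices, cuts and components *)

Section vertices.
Variables (R : realType) (E : edge_system R).
Implicit Types (G C : mgraph E) (a b c : label E * bool) (p q : label E * R).

Lemma endpointsE a : (a \in endpoints E) = (a.1 \in edges E).
Proof. by rewrite finset.inE. Qed.

Lemma same_vertex_refl G a : a \in endpoints E -> same_vertex G a a.
Proof.
have /and3P[/eqP covG _ _] := vertsP G; rewrite -covG => /finset.bigcupP[v vG av].
by exists v.
Qed.

Lemma same_vertex_sym G a b : same_vertex G a b -> same_vertex G b a.
Proof. by move=> [v vG [av bv]]; exists v. Qed.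

Lemma vert_uniq G v w a : v \in verts G -> w \in verts G -> a \in v -> a \in w ->
  v = w.
Proof.
have /and3P[_ /finset.trivIsetP trG _] := vertsP G => vG wG av aw.
apply/eqP; apply: contraT => vw.
by have /disjointFr/(_ av) := trG v w vG wG vw; rewrite aw.
Qed.

Lemma same_vertex_trans G a b c :
  same_vertex G a b -> same_vertex G b c -> same_vertex G a c.
Proof.
move=> [v vG [av bv]] [w wG [bw cw]]; exists v => //.
by rewrite (vert_uniq vG wG bv bw) in av *.
Qed.

Lemma vert_endpoint G v a : v \in verts G -> a \in v -> a \in endpoints E.
Proof.
have /and3P[/eqP covG _ _] := vertsP G; rewrite -covG => vG av.
by apply/finset.bigcupP; exists v.
Qed.

Lemma same_vertex_endpoint G a b : same_vertex G a b -> a \in endpoints E.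
Proof. by move=> [v vG [av _]]; exact: vert_endpoint vG av. Qed.

Lemma vertE G v a b : v \in verts G -> a \in v -> (b \in v) <-> same_vertex G a b.
Proof.
move=> vG av; split=> [bv|[w wG [aw bw]]]; first by exists v.
by rewrite (vert_uniq vG wG av aw).
Qed.

Lemma vert_neq0 G v : v \in verts G -> exists a, a \in v.
Proof.
have /and3P[_ _ n0] := vertsP G => vG; apply/finset.set0Pn.
by apply: contra n0 => /eqP <-.
Qed.

Lemma end_coord_inj a b :
  a \in endpoints E -> end_coord a = end_coord b -> a = b.
Proof.
case: a b => [e x] [e' y]; rewrite endpointsE /end_coord /= => eE [<-].
have := len_gt0 eE; case: x; case: y => //= l0 l0'; last by rewrite l0' ltxx in l0.
by rewrite -l0' ltxx in l0.
Qed.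

Lemma on_edges_end a : a \in endpoints E -> on_edges (end_coord a).
Proof.
rewrite endpointsE /on_edges /end_coord /= => aE; rewrite aE /=.
by have l0 := ltW (len_gt0 aE); case: a.2; rewrite lexx l0.
Qed.

Lemma same_point_refl G p : same_point G p p. Proof. by left. Qed.

Lemma same_point_sym G p q : same_point G p q -> same_point G q p.
Proof.
case=> [->|[a [b [ab -> ->]]]]; first by left.
by right; exists b, a; split=> //; exact: same_vertex_sym.
Qed.

Lemma same_point_trans G p q (r : label E * R) :
  same_point G p q -> same_point G q r -> same_point G p r.
Proof.
case=> [->//|[a [b [ab -> ->]]]]; case=> [<-|[c [d [cd bc ->]]]].
  by right; exists a, b.
right; exists a, d; split=> //; apply: (same_vertex_trans ab).
rewrite (end_coord_inj _ bc) //.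
exact: same_vertex_endpoint (same_vertex_sym ab).
Qed.

Lemma same_point_end G a b : a \in endpoints E -> b \in endpoints E ->
  same_point G (end_coord a) (end_coord b) <-> same_vertex G a b.
Proof.
move=> aE bE; split=> [|ab]; last by right; exists a, b.
case=> [/(end_coord_inj aE) <-|]; first exact: same_vertex_refl.
by move=> [c [d [cd /(end_coord_inj aE) -> /(end_coord_inj bE) ->]]].
Qed.

Lemma same_point_interior G p q : 0 < p.2 < len p.1 -> same_point G p q -> q = p.
Proof.
move=> p0 [->//|[a [b [_ pa _]]]]; move: p0; rewrite pa /end_coord /=.
by case: a.2; rewrite ltxx ?andbF.
Qed.

Lemma on_edges_cases p : on_edges p ->
  0 < p.2 < len p.1 \/ exists2 a, a \in endpoints E & p = end_coord a.
Proof.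
case: p => e x; rewrite /on_edges /= => /andP[eE /andP[x0 xl]].
have [->|x1] := eqVneq x 0; first by right; exists (e, false); rewrite ?endpointsE.
have [->|x2] := eqVneq x (len e); first by right; exists (e, true); rewrite ?endpointsE.
by left; rewrite !lt_def x1 x0 eq_sym x2 xl.
Qed.

Lemma graph_of_subproof (r : rel (label E * bool)) :
  {in endpoints E & &, equivalence_rel r} ->
  finset.partition (equivalence_partition r (endpoints E)) (endpoints E).
Proof. exact: equivalence_partitionP. Qed.

Definition graph_of (r : rel (label E * bool))
    (req : {in endpoints E & &, equivalence_rel r}) : mgraph E :=
  MGraph (graph_of_subproof req).

Lemma same_vertex_graph_of (r : rel (label E * bool))
    (req : {in endpoints E & &, equivalence_rel r}) a b : a \in endpoints E -> b \in endpoints E ->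
  same_vertex (graph_of req) a b <-> r a b.
Proof.
move=> aE bE; rewrite -(pblock_equivalence_partition req aE bE).
have P := graph_of_subproof req; have /and3P[/eqP covP trP _] := P.
split=> [[v vG [av bv]]|ab].
  by rewrite (finset.def_pblock trP vG av).
exists (finset.pblock (equivalence_partition r (endpoints E)) a).
  by apply: pblock_mem; rewrite covP.
by split=> //; rewrite finset.mem_pblock covP.
Qed.

Lemma is_cutP G C : is_cut G C <-> forall a b, same_vertex C a b -> same_vertex G a b.
Proof.
split=> [H a b [w /H[v vG /fintype.subsetP wv] [aw bw]]|H w wC].
  by exists v => //; split; exact: wv.
have [a aw] := vert_neq0 wC; have [|v vG [av _]] := H a a; first by exists w.
exists v => //; apply/fintype.subsetP => b bw; apply/(vertE _ vG av)/H.
by apply/(vertE _ wC aw).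
Qed.

Lemma cut_nontriviallyP G C v : is_cut G C -> v \in verts G ->
  cut_nontrivially G C v <->
  exists a b, [/\ a \in v, b \in v & ~ same_vertex C a b].
Proof.
move=> /is_cutP cut vG; rewrite /cut_nontrivially vG /=; split.
  move=> /card_gt1P[w1 [w2 []]]; rewrite !finset.inE.
  move=> /andP[w1C /fintype.subsetP w1v] /andP[w2C /fintype.subsetP w2v] w12.
  have [a aw] := vert_neq0 w1C; have [b bw] := vert_neq0 w2C.
  exists a, b; split; [exact: w1v | exact: w2v |] => /(vertE _ w1C aw) bw1.
  by move: w12; rewrite (vert_uniq w1C w2C bw1 bw) eqxx.
move=> [a [b [av bv nab]]].
have [w1 w1C [aw1 _]] := same_vertex_refl C (vert_endpoint vG av).
have [w2 w2C [bw2 _]] := same_vertex_refl C (vert_endpoint vG bv).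
apply/card_gt1P; exists w1, w2; rewrite !finset.inE w1C w2C /=; split.
- apply/fintype.subsetP => c cw; apply/(vertE _ vG av)/cut; exact/(vertE _ w1C aw1).
- apply/fintype.subsetP => c cw; apply/(vertE _ vG bv)/cut; exact/(vertE _ w2C bw2).
by apply: contra_notN nab => /eqP w12; exists w1 => //; rewrite {2}w12.
Qed.

(** The combinatorial counterparts of unions of connected components, and of
    connected components as minimal ones *)
Definition eclosed G (T : {set label E}) : Prop :=
  forall a b, same_vertex G a b -> a.1 \in T -> b.1 \in T.

Definition ecomp G (S : {set label E}) : Prop :=
  [/\ S \subset edges E, exists e, e \in S, eclosed G S &
      forall T : {set label E}, eclosed G T -> (exists2 e, e \in S & e \in T) -> S \subset T].

Lemma eclosedC G T : eclosed G T -> eclosed G (~: T)%SET.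
Proof.
move=> H a b ab; rewrite !finset.inE; apply: contra; apply: H.
exact: same_vertex_sym.
Qed.

Lemma ecomp_exists G e : e \in edges E -> exists2 S, ecomp G S & e \in S.
Proof.
move=> eE.
pose S := [set e' in edges E |
  `[< forall T : {set label E}, eclosed G T -> e \in T -> e' \in T >]]%SET.
have eS : e \in S by rewrite finset.inE eE; apply/asboolP.
exists S => //; split.
- by apply/fintype.subsetP => e'; rewrite finset.inE => /andP[].
- by exists e.
- move=> a b ab; rewrite !finset.inE => /andP[_ /asboolP aS].
  have := same_vertex_endpoint (same_vertex_sym ab); rewrite endpointsE => ->.
  by apply/asboolP => T cT eT; apply: (cT _ _ ab); exact: aS.
- move=> T cT [e1]; rewrite finset.inE => /andP[_ /asboolP H] e1T.
  have eT : e \in T.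
    apply: contraT => neT; have := H (~: T)%SET (eclosedC cT).
    by rewrite !finset.in_setC neT e1T => /(_ isT).
  by apply/fintype.subsetP => e'; rewrite finset.inE => /andP[_ /asboolP]; exact.
Qed.

Lemma ecomp_eq G S T e : ecomp G S -> ecomp G T -> e \in S -> e \in T -> S = T.
Proof.
move=> [_ _ cS mS] [_ _ cT mT] eS eT; apply/eqP; rewrite finset.eqEsubset.
by rewrite mS ?mT //; exists e.
Qed.

Definition econn G : Prop := ecomp G (edges E).

End vertices.

(** * Topology of a metric graph *)

Section topology.
Variables (R : realType) (E : edge_system R) (G : mgraph E).
Implicit Types (p q r : gpoint G) (T S : {set label E}).

Lemma openG (U : set (gpoint G)) : open U = gopen U.
Proof. by []. Qed.

Lemma gpoint_eq p q : pt p = pt q -> p = q.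
Proof. exact: val_inj. Qed.

(** Near a point, only that point can be identified with points of other edges;
    this makes the saturated sets below open. *)
Lemma small_move p : exists2 eps : R, 0 < eps & forall q, (pt q).1 = (pt p).1 ->
  `|(pt q).2 - (pt p).2| < eps -> q = p \/ 0 < (pt q).2 < len (pt q).1.
Proof.
have /andP[eE /andP[x0 xl]] := ptP p.
have l0 := len_gt0 eE.
exists (if (pt p).2 == 0 then len (pt p).1 else
        if (pt p).2 == len (pt p).1 then len (pt p).1
        else Num.min (pt p).2 (len (pt p).1 - (pt p).2)).
  case: eqVneq => // nx0; case: eqVneq => // nxl.
  by rewrite lt_min subr_gt0 !lt_def nx0 x0 eq_sym nxl xl.
move=> q qe; have := ptP q; rewrite /on_edges qe => /andP[_ /andP[y0 yl]].
have [qp|nqp] := eqVneq (pt q).2 (pt p).2.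
  move=> _; left; apply: gpoint_eq; move: qp qe.
  by case: (pt q) (pt p) => [? ?] [? ?] /= -> ->.
move=> H; right; move: H nqp.
case: eqVneq => [->|nx0].
  by rewrite subr0 ltr_norml => /andP[_ ->] ny; rewrite lt_def ny y0.
case: eqVneq => [->|nxl].
  rewrite ltr_norml => /andP[H1 H2] ny; rewrite andbC lt_def eq_sym ny yl /=.
  by lra.
rewrite lt_min !ltr_norml => /andP[/andP[H1 H2] /andP[H3 H4]] ny.
by lra.
Qed.

(** The interior of [edge_support G T], in a form that is visibly open *)
Definition inside T : set (gpoint G) :=
  [set p | forall q, same_point G (pt p) (pt q) -> (pt q).1 \in T].

Lemma open_inside T : open (inside T).
Proof.
rewrite openG; split=> [p q pq Hp r qr|p Hp].
  by apply: Hp; exact: same_point_trans pq qr.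
have [eps e0 He] := small_move p; exists eps => // q qe qp.
have [->//|q_int] := He q qe qp.
move=> r /(same_point_interior q_int)->; rewrite qe; apply: Hp.
exact: same_point_refl.
Qed.

Lemma inside_sub T p : inside T p -> (pt p).1 \in T.
Proof. by apply; exact: same_point_refl. Qed.

Lemma edge_supportC T : ~` edge_support G T = inside (~: T)%SET.
Proof.
apply/seteqP; split=> [p /= H q pq|p H [q qT pq]].
  by rewrite finset.inE; apply/negP => qT; apply: H; exists q.
by have := H q pq; rewrite finset.inE qT.
Qed.

Lemma closed_edge_support T : closed (edge_support G T).
Proof. by rewrite -[edge_support G T]setCK edge_supportC; exact/open_closedC/open_inside. Qed.

(** Inner points of edges, which are their only representatives, are dense. *)
Lemma near_interior (U : set (gpoint G)) p : open U -> U p ->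
  exists q, [/\ U q, (pt q).1 = (pt p).1 & 0 < (pt q).2 < len (pt q).1].
Proof.
rewrite openG => -[_ oU] Up; have [eps e0 He] := oU p Up.
have [d d0 Hd] := small_move p.
have /andP[eE /andP[x0 xl]] := ptP p; have l0 := len_gt0 eE.
set l := len (pt p).1 in x0 xl l0 *; set x := (pt p).2 in x0 xl *.
pose s := Num.min (Num.min eps d) l / 2.
have s0 : 0 < s by rewrite divr_gt0 // !lt_min e0 d0 l0.
have [se sd sl] : [/\ s < eps, s < d & s <= l / 2].
  have sm :
    s < Num.min (Num.min eps d) l by rewrite /s ltr_pdivrMr // ltr_pMr ?ltr1n // !lt_min e0 d0 l0.
  by move: sm; rewrite !lt_min => /andP[/andP[-> ->] _];
    rewrite /s ler_pM2r ?invr_gt0 // ge_min lexx orbT.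
pose y := if x <= l / 2 then x + s else x - s.
have ye : `|y - x| = s.
  rewrite /y; case: ifP => _; first by rewrite addrC addKr gtr0_norm.
  by rewrite addrC addrA addNr sub0r normrN gtr0_norm.
have yE : on_edges ((pt p).1, y).
  rewrite /on_edges /= eE /= /y -/l; case: ifP => xh; first by lra.
  by move/negbT: xh; rewrite -ltNge => xh; lra.
exists (GPoint G yE) => /=; split=> //.
  by apply: He => //=; rewrite ye.
have [Hy|//] : GPoint G yE = p \/ 0 < y < l by apply: Hd => //=; rewrite ye.
move: ye; have -> : y = x by rewrite /x -Hy.
by rewrite subrr normr0 => s1; rewrite -s1 ltxx in s0.
Qed.

Lemma interior_edge_support T : interior (edge_support G T) = inside T.
Proof.
apply/seteqP; split=> [p /= pT q pq|].
  have oI := @open_interior _ (edge_support G T).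
  have Iq : interior (edge_support G T) q.
    by move: oI; rewrite openG => -[sat _]; exact: sat pq pT.
  have [r [/interior_subset [r' r'T rr'] rq r_int]] := near_interior oI Iq.
  by rewrite -rq; rewrite (same_point_interior r_int rr') in r'T.
rewrite -open_subsetE; last exact: open_inside.
by move=> p pT; exists p; [exact: inside_sub | exact: same_point_refl].
Qed.

Lemma boundary_edge_support T p : boundary (edge_support G T) p <->
  (exists2 q : gpoint G, same_point G (pt p) (pt q) & (pt q).1 \in T) /\
  (exists2 q : gpoint G, same_point G (pt p) (pt q) & (pt q).1 \notin T).
Proof.
rewrite /boundary interior_edge_support.
have -> : closure (edge_support G T) = edge_support G T.
  by apply/esym/closure_id; exact: closed_edge_support.
split=> [[[q qT pq] np]|[[q pq qT] [r pr rT]]].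
  split; first by exists q.
  apply: contrapT => H; apply: np => r pr; apply: contraT => rT.
  by exfalso; apply: H; exists r.
split; first by exists q.
by move=> H; rewrite (H r pr) in rT.
Qed.

Lemma edge_support_eclosed T p : eclosed G T ->
  edge_support G T p <-> (pt p).1 \in T.
Proof.
move=> cT; split=> [[q qT]|pT]; last by exists p => //; exact: same_point_refl.
case=> [->//|[a [b [ab pa qb]]]]; rewrite pa /=.
by apply: (cT _ _ (same_vertex_sym ab)); rewrite qb in qT.
Qed.

Definition clamp (u v t : R) : R := Num.max u (Num.min v t).

Lemma max_lip (u a b : R) : `|Num.max u a - Num.max u b| <= `|a - b|.
Proof.
have H1 := ler_norm (a - b); have := ler_norm (- (a - b)); rewrite normrN => H2.
rewrite ler_norml; move: H1 H2; move: `|_| => N H1 H2.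
by case: (leP u a) => ?; case: (leP u b) => ?; lra.
Qed.

Lemma min_lip (u a b : R) : `|Num.min u a - Num.min u b| <= `|a - b|.
Proof.
have H1 := ler_norm (a - b); have := ler_norm (- (a - b)); rewrite normrN => H2.
rewrite ler_norml; move: H1 H2; move: `|_| => N H1 H2.
by case: (leP u a) => ?; case: (leP u b) => ?; lra.
Qed.

Lemma clamp_lip (u v s t : R) : `|clamp u v s - clamp u v t| <= `|s - t|.
Proof. exact: le_trans (max_lip _ _ _) (min_lip _ _ _). Qed.

Lemma clamp_itv (u v t : R) : u <= v -> u <= clamp u v t <= v.
Proof. by move=> uv; rewrite /clamp le_max lexx ge_max uv ge_min lexx. Qed.

Lemma clamp_id (u v t : R) : u <= t <= v -> clamp u v t = t.
Proof. by move=> /andP[ut tv]; rewrite /clamp min_r // max_r. Qed.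

(** The segment is the image of the real line under a clamped coordinate, hence
    connected. *)
Lemma segment_clopen (A O C : set (gpoint G)) (e : label E) p q :
  (pt p).1 = e -> (pt q).1 = e -> (pt p).2 <= (pt q).2 ->
  (forall r, (pt r).1 = e -> (pt p).2 <= (pt r).2 <= (pt q).2 -> A r) ->
  open O -> closed C -> A `&` O = A `&` C -> O p <-> O q.
Proof.
move=> pe qe pq HA oO cC OC.
have eE t : on_edges (e, clamp (pt p).2 (pt q).2 t).
  have /andP[H1 /andP[H2 _]] := ptP p; have /andP[_ /andP[_ H3]] := ptP q.
  move: H1 H3; rewrite pe qe /on_edges /= => -> H3 /=.
  by have /andP[H4 H5] := clamp_itv t pq; rewrite (le_trans H2 H4) (le_trans H5 H3).
pose h t := GPoint G (eE t).
have Ah t : A (h t) by apply: HA => //=; exact: clamp_itv.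
have hO (U : set (gpoint G)) : open U -> open (h @^-1` U).
  rewrite openG => -[_ oU]; rewrite openE => t /= /oU [eps e0 He].
  apply/nbhs_ballP; exists eps => //= s; rewrite /ball /= distrC => st.
  by apply: He => //=; apply: le_lt_trans (clamp_lip _ _ _ _) st.
have OCh t : O (h t) <-> C (h t).
  have := congr1 (fun X => X (h t)) OC => /=; rewrite /setI /= => H.
  split=> K; last by have [] : A (h t) /\ O (h t) by rewrite H.
  by have [] : A (h t) /\ C (h t) by rewrite -H.
have cR : connected [set: R] by apply/connected_intervalP => x y _ _ z _.
have all t s : O (h t) -> O (h s).
  move=> Ot; suff : h @^-1` O = setT by move=> H; have : setT s by []; rewrite -H.
  apply: cR; first by exists t.
    by exists (h @^-1` O); [exact: hO | rewrite setTI].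
  exists (h @^-1` C); last by rewrite setTI; apply/funext => u; apply/propext/OCh.
  by rewrite -openC; apply: (hO (~` C)); rewrite openC.
have hp : h (pt p).2 = p.
  apply: gpoint_eq; rewrite /= -pe clamp_id ?lexx ?pq //.
  by case: (pt p).
have hq : h (pt q).2 = q.
  apply: gpoint_eq; rewrite /= -qe clamp_id ?lexx ?pq //.
  by case: (pt q).
by rewrite -hp -hq; split; exact: all.
Qed.
End topology.

Section components.
Variables (R : realType) (E : edge_system R) (G : mgraph E).
Implicit Types (p q r : gpoint G) (T S : {set label E}).

Lemma mid_on_edges e : e \in edges E -> on_edges (e, len e / 2).
Proof. by move=> eE; rewrite /on_edges /= eE /=; have := len_gt0 eE; lra. Qed.

(** Sets of edges whose points in [A] form a union of components of [A] *)
Definition closed_in (A : set (gpoint G)) (T : {set label E}) : Prop :=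
  forall p q, A p -> A q -> same_point G (pt p) (pt q) ->
    (pt p).1 \in T -> (pt q).1 \in T.

Lemma closed_inC A T : closed_in A T -> closed_in A (~: T)%SET.
Proof.
move=> H p q Ap Aq pq; rewrite !finset.inE; apply: contra.
by apply: H => //; exact: same_point_sym.
Qed.

(** A set that meets every edge in an interval has its connected components
    determined by the edges alone: a relatively clopen subset contains all or
    none of each such interval, and conversely the points on a union of edges
    closed under adjacency form a relatively clopen subset. *)
Lemma component_of_edges (A : set (gpoint G)) T p0 :
  (forall p q, same_point G (pt p) (pt q) -> A p -> A q) ->
  (forall p q r, (pt p).1 = (pt r).1 -> (pt q).1 = (pt r).1 ->
     (pt p).2 <= (pt r).2 <= (pt q).2 -> A p -> A q -> A r) ->
  closed_in A T ->
  (forall T', closed_in A T' ->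
     (exists p, [/\ A p, (pt p).1 \in T & (pt p).1 \in T']) ->
     forall q, A q -> (pt q).1 \in T -> (pt q).1 \in T') ->
  A p0 -> (pt p0).1 \in T ->
  connected_component A p0 = A `&` [set q | (pt q).1 \in T].
Proof.
move=> satA cvxA clT minT Ap0 p0T.
have inA T' q : closed_in A T' -> A q -> (pt q).1 \in T' <-> inside T' q.
  move=> cT' Aq; split=> [qT r qr|]; last exact: inside_sub.
  by apply: (cT' _ _ Aq (satA _ _ qr Aq) qr).
apply/seteqP; split=> [q Hq|].
  have Aq := connected_component_sub Hq; split=> //=.
  have KA := @connected_component_sub _ A p0.
  have eqK : connected_component A p0 `&` inside T = connected_component A p0.
    apply: (@component_connected _ A p0).
    - by exists p0; split; [exact: connected_component_refl | apply/inA].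
    - by exists (inside T) => //; exact: open_inside.
    exists (~` inside (~: T)%SET); first exact/open_closedC/open_inside.
    apply/seteqP; split=> r [Kr H]; split=> //.
      move=> /= /inside_sub; rewrite finset.inE.
      by rewrite (inside_sub H).
    apply/(inA _ _ clT (KA _ Kr)); apply: contraT => rT; exfalso; apply: H.
    by apply/(inA _ _ (closed_inC clT) (KA _ Kr)); rewrite finset.inE.
  have : (connected_component A p0 `&` inside T) q by rewrite eqK.
  by case=> _ /inside_sub.
set B := A `&` _; apply: connected_component_max; [by split | by move=> q []|].
move=> B' [q0 B'q0] [ O oO B'O] [C cC B'C].
have BOC : B `&` O = B `&` C by rewrite -B'O.
have edgeB p q : B p -> B q -> (pt p).1 = (pt q).1 -> (O p <-> O q).
  move=> [Ap pT] [Aq qT] pq.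
  have seg p1 q1 : B p1 -> B q1 -> (pt p1).1 = (pt q1).1 -> (pt p1).2 <= (pt q1).2 ->
      (O p1 <-> O q1).
    move=> [Ap1 p1T] [Aq1 q1T] pq1 le1.
    apply: (@segment_clopen _ _ _ B O C (pt q1).1) => // r rq rr.
    by split; rewrite /= ?rq //; apply: (cvxA p1 q1) => //; rewrite ?rq ?pq1.
  have [le1|/ltW le1] := leP (pt p).2 (pt q).2; first exact: seg.
  by apply: iff_sym; apply: seg.
pose T' := [set e | `[< exists2 p, B p /\ O p & (pt p).1 = e >]]%SET.
have T'P q : B q -> (pt q).1 \in T' <-> O q.
  move=> Bq; rewrite finset.inE; split=> [/asboolP[p [Bp Op] pq]|Oq].
    by apply/(edgeB p q Bp Bq pq).
  by apply/asboolP; exists q.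
rewrite B'O; apply/seteqP; split=> [q []//|q Bq]; split=> //; apply/(T'P q Bq).
have [Aq qT] := Bq; apply: minT => //.
  move=> p r Ap Ar pr; rewrite !finset.inE => /asboolP[s [Bs Os] sp].
  have Bp : B p by split=> //=; rewrite -sp; case: Bs.
  have Br : B r by split=> //=; apply: (clT p r) => //; case: Bp.
  apply/asboolP; exists r => //; split=> //.
  have : O p by apply/(edgeB s p Bs Bp sp).
  by move: oO; rewrite openG => -[sat _]; exact: sat.
move: B'q0; rewrite B'O => -[Bq0 Oq0]; have [Aq0 q0T] := Bq0.
by exists q0; split=> //; apply/T'P.
Qed.

Lemma closed_inTP T : closed_in setT T <-> eclosed G T.
Proof.
split=> [H a b ab aT|H p q _ _ [->//|[a [b [ab pa qb]]]]].
  have aE := same_vertex_endpoint ab.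
  have bE := same_vertex_endpoint (same_vertex_sym ab).
  apply: (H (GPoint G (on_edges_end aE)) (GPoint G (on_edges_end bE))) => //=.
  by right; exists a, b.
by rewrite pa qb /=; exact: H.
Qed.

Lemma component_ecomp S p : ecomp G S -> (pt p).1 \in S ->
  connected_component setT p = edge_support G S.
Proof.
move=> [SE _ clS minS] pS.
rewrite (@component_of_edges setT S p) //; last first.
- move=> T' /closed_inTP clT' [q [_ qS qT']] r _ rS.
  by move: rS; apply/fintype.subsetP; apply: minS => //; exists (pt q).1.
- exact/closed_inTP.
rewrite setTI; apply/seteqP; split=> q /=; rewrite edge_support_eclosed //.
Qed.

Lemma is_clusterP S : is_cluster G S <-> ecomp G S.
Proof.
split=> [[SE [p Sp]]|ecS].
  have /andP[pE _] := ptP p.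
  have [T ecT pT] := ecomp_exists G pE.
  rewrite (component_ecomp ecT pT) in Sp.
  have [TE _ clT _] := ecT.
  suff -> : S = T by [].
  apply/finset.setP => e; apply/idP/idP => eS.
    have eE := fintype.subsetP SE _ eS.
    have : edge_support G S (GPoint G (mid_on_edges eE)).
      by exists (GPoint G (mid_on_edges eE)) => //; exact: same_point_refl.
    by rewrite Sp edge_support_eclosed.
  have eE := fintype.subsetP TE _ eS.
  have : edge_support G T (GPoint G (mid_on_edges eE)).
    by exists (GPoint G (mid_on_edges eE)) => //; exact: same_point_refl.
  rewrite -Sp => -[q qS /same_point_interior qe]; rewrite qe //= in qS.
  by have := len_gt0 eE; rewrite /=; lra.
have [SE [e eS] _ _] := ecS; split=> //.
have eE := fintype.subsetP SE _ eS.
by exists (GPoint G (mid_on_edges eE)); rewrite (@component_ecomp S).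
Qed.

Lemma connected_econn : connected_graph G -> econn G.
Proof.
move=> [[p0 _] cG]; have /andP[pE _] := ptP p0.
have [T ecT pT] := ecomp_exists G pE.
have [TE _ clT _] := ecT.
suff eqT : T = edges E by rewrite /econn -eqT.
apply/eqP; rewrite finset.eqEsubset TE; apply/fintype.subsetP => e eE.
have := component_ecomp ecT pT.
have -> : connected_component setT p0 = setT.
  by apply/seteqP; split=> // q _; apply: (@connected_component_max _ setT setT p0).
move=> /(congr1 (fun X => X (GPoint G (mid_on_edges eE)))) /= H.
have : edge_support G T (GPoint G (mid_on_edges eE)) by rewrite -H.
by rewrite edge_support_eclosed.
Qed.

(** Every neighbourhood of a point of an edge meets the interior of that edge. *)
Lemma closure_edges (A : set (gpoint G)) T :
  (forall p, A p -> (pt p).1 \in T) ->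
  (forall p, (pt p).1 \in T -> 0 < (pt p).2 < len (pt p).1 -> A p) ->
  closure A = edge_support G T.
Proof.
move=> AT TA; apply/seteqP; split.
  rewrite [X in _ `<=` X](_ : _ = closure (edge_support G T)).
    by apply: closure_subset => p Ap; exists p; [exact: AT | exact: same_point_refl].
  exact/closure_id/closed_edge_support.
move=> p [q qT pq] B; rewrite nbhsE => -[U [oU Up] UB].
have Uq : U q by move: oU; rewrite openG => -[sat _]; exact: sat pq Up.
have [r [Ur rq ri]] := near_interior oU Uq.
by exists r; split; [apply: TA => //; rewrite rq | exact: UB].
Qed.

End components.

(** * Continuity and compactness *)

Lemma continuous_big_sum (R : realType) (T : topologicalType) (I : Type) (r : seq I)
    (P : pred I) (F : I -> T -> R) :
  (forall i, P i -> continuous (F i)) ->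
  continuous (fun x => \sum_(i <- r | P i) F i x).
Proof.
move=> cF; elim: r => [|i r IH].
  rewrite (_ : (fun x => _) = cst 0); first by move=> x; exact: cvg_cst.
  by apply/funext => x; rewrite big_nil.
rewrite (_ : (fun x => _) = fun x => (if P i then F i x else 0) +
    \sum_(j <- r | P j) F j x); last first.
  by apply/funext => x; rewrite big_cons; case: ifP => //; rewrite add0r.
move=> x; apply: cvgD; last exact: IH.
by case: ifP => [Pi|_]; [exact: cF | exact: cvg_cst].
Qed.

(** Clamping the frequency to [0, W], where the weights have no pole, makes them
    continuous on the whole line. *)
Section clamped_weights.
Variables (R : realType) (W h : R).
Hypotheses (W0 : 0 <= W) (h0 : 0 < h) (Wh : W * h < pi).

Lemma continuous_clamp : continuous (clamp 0 W).
Proof.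
move=> t; apply/cvgrPdist_lt => e e0; apply/nbhs_ballP; exists e => //= s.
exact: le_lt_trans (clamp_lip _ _ _ _).
Qed.

Lemma clamp_short t : clamp 0 W t * h < pi.
Proof.
have /andP[c0 cW] := clamp_itv t W0; apply: le_lt_trans Wh.
by rewrite ler_pM2r.
Qed.

Lemma continuous_stiff : continuous (fun t => stiff (clamp 0 W t) h).
Proof.
have /= cc := continuous_clamp; move=> t; have /andP[c0 _] := clamp_itv t W0.
apply: cvgV.
  by rewrite gt_eqF // mulr_gt0 // sinc_gt0 // clamp_short mulr_ge0 // ltW.
apply: cvgMr; apply: (@continuous_cvg _ _ _ _ _ (fun t => clamp 0 W t * h)).
  exact: continuous_sinc.
by apply: cvgMl; exact: cc.
Qed.

Lemma continuous_mass : continuous (fun t => mass (clamp 0 W t) h).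
Proof.
have /= cc := continuous_clamp; move=> t; have /andP[c0 _] := clamp_itv t W0.
have c2 : clamp 0 W s * h / 2 @[s --> t] --> clamp 0 W t * h / 2.
  by apply: cvgMl; apply: cvgMl; exact: cc.
apply: cvgM; last first.
  apply: cvgV; first by rewrite gt_eqF // cos_half_gt0 // clamp_short.
  by apply: (@continuous_cvg _ _ _ _ _ (fun t => clamp 0 W t * h / 2)) => //;
     exact: continuous_cos.
apply: cvgMr; apply: (@continuous_cvg _ _ _ _ _ (fun t => clamp 0 W t * h / 2)) => //.
exact: continuous_sinc.
Qed.
End clamped_weights.

(** The normalised vectors satisfying the constraints form a compact set
    together with their parameters. *)
Lemma first_parameter (R : realType) (m : nat) (W : R) (X : set 'rV[R]_m)
    (q b : R -> 'rV[R]_m -> R) :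
  closed X -> continuous (fun z : R * 'rV[R]_m => q z.1 z.2) ->
  continuous (fun z : R * 'rV[R]_m => b z.1 z.2) ->
  let K := [set z : R * 'rV[R]_m | [/\ 0 <= z.1 <= W, X z.2,
     \sum_(j < m) z.2 0 j ^+ 2 = 1, q z.1 z.2 <= 0 & b z.1 z.2 = 0]] in
  K !=set0 -> exists2 z, K z & forall z', K z' -> z.1 <= z'.1.
Proof.
move=> cX cq cb K K0.
have cco (j : 'I_m) : continuous (fun z : R * 'rV[R]_m => z.2 0 j).
  move=> z; apply: (@continuous_cvg _ _ _ _ _ snd (fun v : 'rV[R]_m => v 0 j) z.2).
    exact: coord_continuous.
  exact: cvg_snd.
have cs : continuous (fun z : R * 'rV[R]_m => \sum_(j < m) z.2 0 j ^+ 2).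
  apply: continuous_big_sum => j _.
  rewrite (_ : (fun _ => _) = (fun z : R * 'rV[R]_m => z.2 0 j * z.2 0 j)) //.
  by move=> z; apply: cvgM; exact: cco.
have clK : closed K.
  rewrite (_ : K = (fst @^-1` `[0, W]) `&` (snd @^-1` X) `&`
    ((fun z : R * 'rV[R]_m => \sum_(j < m) z.2 0 j ^+ 2) @^-1` [set x | x = 1]) `&`
    ((fun z : R * 'rV[R]_m => q z.1 z.2) @^-1` [set x | x <= 0]) `&`
    ((fun z : R * 'rV[R]_m => b z.1 z.2) @^-1` [set x | x = 0])).
    apply: closedI; last by apply: preimage_closed; [move=> z _; exact: cb | exact: closed_eq].
    apply: closedI; last by apply: preimage_closed; [move=> z _; exact: cq | exact: closed_le].
    apply: closedI; last by apply: preimage_closed; [move=> z _; exact: cs | exact: closed_eq].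
    apply: closedI; last by apply: preimage_closed; [move=> z _; exact: cvg_snd | exact: cX].
    by apply: preimage_closed; [move=> z _; exact: cvg_fst | exact: interval_closed].
  apply/seteqP; split=> z.
    by case=> z1 z2 z3 z4 z5; do !split => //=; rewrite in_itv.
  by move=> /= [[[[]]]]; rewrite /= in_itv.
have cK : compact K.
  apply: (@subclosed_compact _ _ (`[0, W] `*`
     [set v : 'rV[R]_m | forall i, `[-1, 1]%classic (v ord0 i)])) => //.
    apply: compact_setX; first exact: segment_compact.
    by have := @rV_compact R m (fun=> `[(-1 : R), 1]%classic) (fun i => @segment_compact _ _ _).
  move=> z [z1 _ z3 _ _]; split; first by rewrite /= in_itv.
  move=> i /=; rewrite in_itv /= -ler_norml -(@ler_pXn2r _ 2) ?nnegrE //.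
  rewrite expr1n -z3 -normrX ger0_norm ?sqr_ge0 //.
  by rewrite (bigD1 i) //= lerDl sumr_ge0 // => j _; exact: sqr_ge0.
have cf : {within K, continuous (fst : R * 'rV[R]_m -> R)}.
  by apply: continuous_subspaceT => z; exact: cvg_fst.
have [z zK Hz] := compact_EVT_min K0 cK cf.
exists z; first by rewrite inE in zK.
by move=> z' Kz'; apply: Hz; rewrite inE.
Qed.

(** * The discrete form *)

Section discrete_form.
Variables (R : realType) (E : edge_system R) (n : nat).
Implicit Types (g k : label E -> nat -> R) (a b : label E * bool) (G : mgraph E).

Definition mesh (e : label E) : R := len e / n.+1%:R.

Lemma mesh_gt0 e : e \in edges E -> 0 < mesh e.
Proof. by move=> eE; rewrite divr_gt0 ?ltr0n // len_gt0. Qed.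

Lemma meshN e : n.+1%:R * mesh e = len e.
Proof. by rewrite mulrC divfK // pnatr_eq0. Qed.

(** Pieces shorter than half a wavelength: a solution is then determined on a
    piece by its values at the ends. *)
Definition short (w : R) : Prop := forall e, e \in edges E -> w * mesh e < pi.

Definition dform (w : R) g k : R :=
  \sum_(e in edges E) \sum_(i < n.+1)
    pform w (mesh e) (g e i) (g e i.+1) (k e i) (k e i.+1).

(** Up to the factor - w^2 this is the form against the constant 1, so that a
    function of mass zero is one orthogonal to the constants; without this
    factor the condition still makes sense at frequency 0. *)
Definition dmass (w : R) g : R :=
  \sum_(e in edges E) \sum_(i < n.+1) mass w (mesh e) * (g e i + g e i.+1).

Lemma dform_sym w g k : dform w g k = dform w k g.
Proof. by apply: eq_bigr => e _; apply: eq_bigr => i _; rewrite /pform; ring. Qed.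

Lemma dform_lin w x y g1 g2 k :
  dform w (fun e i => x * g1 e i + y * g2 e i) k = x * dform w g1 k + y * dform w g2 k.
Proof.
rewrite /dform !mulr_sumr -big_split; apply: eq_bigr => e _ /=.
rewrite !mulr_sumr -big_split; apply: eq_bigr => i _ /=.
by rewrite /pform; ring.
Qed.

Lemma dform_quad w x y g k :
  dform w (fun e i => x * g e i + y * k e i) (fun e i => x * g e i + y * k e i) =
  x ^+ 2 * dform w g g + 2 * x * y * dform w g k + y ^+ 2 * dform w k k.
Proof.
rewrite dform_lin (dform_sym w g (fun _ _ => _)) (dform_sym w k (fun _ _ => _)).
rewrite !dform_lin (dform_sym w k g).
by ring.
Qed.

Lemma dmass_lin w x y g1 g2 :
  dmass w (fun e i => x * g1 e i + y * g2 e i) = x * dmass w g1 + y * dmass w g2.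
Proof.
rewrite /dmass !mulr_sumr -big_split; apply: eq_bigr => e _ /=.
by rewrite !mulr_sumr -big_split; apply: eq_bigr => i _ /=; ring.
Qed.

Lemma dform_1 w g : dform w g (fun _ _ => 1) = - (w ^+ 2 * dmass w g).
Proof.
rewrite /dform /dmass mulr_sumr -sumrN; apply: eq_bigr => e _.
rewrite mulr_sumr -sumrN; apply: eq_bigr => i _.
by rewrite /pform; ring.
Qed.

Lemma dform_ext w g g' k k' :
  (forall e i, e \in edges E -> (i <= n.+1)%N -> g e i = g' e i) ->
  (forall e i, e \in edges E -> (i <= n.+1)%N -> k e i = k' e i) ->
  dform w g k = dform w g' k'.
Proof.
move=> gg kk; apply: eq_bigr => e eE; apply: eq_bigr => i _.
by rewrite !gg ?kk // ltnW // ltnS.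
Qed.

Lemma dmass_ext w g g' :
  (forall e i, e \in edges E -> (i <= n.+1)%N -> g e i = g' e i) ->
  dmass w g = dmass w g'.
Proof.
move=> gg; apply: eq_bigr => e eE; apply: eq_bigr => i _.
by rewrite !gg // ltnW // ltnS.
Qed.

Definition dnz g : Prop :=
  exists e i, [/\ e \in edges E, (i <= n.+1)%N & g e i != 0].

(** The stiffness is positive, and taking absolute values shrinks differences. *)
Lemma dform_abs w g : 0 <= w -> short w ->
  dform w (fun e i => `|g e i|) (fun e i => `|g e i|) <= dform w g g.
Proof.
move=> w0 sw; apply: ler_sum => e eE; apply: ler_sum => i _.
have s0 := stiff_gt0 w0 (mesh_gt0 eE) (sw e eE).
rewrite /pform -!expr2 !real_normK ?num_real // lerD2r ler_pM2l //.
rewrite -[leLHS]real_normK ?num_real // -[leRHS]real_normK ?num_real //.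
by rewrite ler_sqr ?nnegrE // ler_dist_dist.
Qed.

Lemma dmass_gt0 w g : 0 <= w -> short w -> (forall e i, 0 <= g e i) -> dnz g ->
  0 < dmass w g.
Proof.
move=> w0 sw g0 [e [i [eE iN gi]]].
have term_ge0 e' (j : 'I_n.+1) : e' \in edges E ->
    0 <= mass w (mesh e') * (g e' j + g e' j.+1).
  by move=> e'E; rewrite mulr_ge0 ?addr_ge0 // ltW // mass_gt0 // ?mesh_gt0 // sw.
have gip : 0 < g e i by rewrite lt_def gi g0.
have [j ji] : exists j : 'I_n.+1, 0 < g e j + g e j.+1.
  case: (ltnP i n.+1) => iN'.
    by exists (Ordinal iN'); rewrite ltr_pwDl.
  have iE : i = n.+1 by apply/eqP; rewrite eqn_leq iN iN'.
  by exists ord_max; rewrite /= ltr_pwDr // -iE.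
rewrite /dmass (bigD1 e) //= ltr_pwDl //; last first.
  by apply: sumr_ge0 => e' /andP[e'E _]; apply: sumr_ge0 => j' _; exact: term_ge0.
rewrite (bigD1 j) //= ltr_pwDl //; last by apply: sumr_ge0 => j' _; exact: term_ge0.
by rewrite mulr_gt0 // mass_gt0 // ?mesh_gt0 // sw.
Qed.

Lemma dform_decr w1 w2 g : 0 < w1 -> w1 < w2 -> short w2 ->
  (forall e i, 0 <= g e i) -> dnz g -> dform w2 g g < dform w1 g g.
Proof.
move=> w10 w12 sw g0 [e [i [eE iN gi]]].
have le_term e' (j : 'I_n.+1) : e' \in edges E ->
    pform w2 (mesh e') (g e' j) (g e' j.+1) (g e' j) (g e' j.+1) <=
    pform w1 (mesh e') (g e' j) (g e' j.+1) (g e' j) (g e' j.+1).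
  by move=> e'E; have [] := pform_decr (g e' j) (g e' j.+1) w10 w12 (mesh_gt0 e'E) (sw e' e'E).
have gip : 0 < g e i by rewrite lt_def gi g0.
have [j ji] : exists j : 'I_n.+1, g e j + g e j.+1 != 0.
  case: (ltnP i n.+1) => iN'.
    by exists (Ordinal iN'); rewrite gt_eqF // ltr_pwDl.
  have iE : i = n.+1 by apply/eqP; rewrite eqn_leq iN iN'.
  by exists ord_max; rewrite /= gt_eqF // ltr_pwDr // -iE.
rewrite /dform (bigD1 e) //= [ltRHS](bigD1 e) //=; apply: ltr_leD; last first.
  by apply: ler_sum => e' /andP[e'E _]; apply: ler_sum => j' _; exact: le_term.
rewrite (bigD1 j) //= [ltRHS](bigD1 j) //=; apply: ltr_leD; last first.
  by apply: ler_sum => j' _; exact: le_term.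
by have [_] := pform_decr (g e j) (g e j.+1) w10 w12 (mesh_gt0 eE) (sw e eE); apply.
Qed.

Definition gend g a : R := g a.1 (if a.2 then n.+1 else 0%N).

Definition admissible G (D : {set {set label E * bool}}) g : Prop :=
  (forall a b, same_vertex G a b -> gend g a = gend g b) /\
  (forall v a, v \in D -> a \in v -> gend g a = 0).

Lemma admissible_lin G D x y g k : admissible G D g -> admissible G D k ->
  admissible G D (fun e i => x * g e i + y * k e i).
Proof.
move=> [g1 g2] [k1 k2]; split=> [a b ab|v a vD av].
  by have := g1 _ _ ab; have := k1 _ _ ab; rewrite /gend => -> ->.
by have := g2 _ _ vD av; have := k2 _ _ vD av; rewrite /gend => -> ->; rewrite !mulr0 addr0.
Qed.

Definition sample (f : edge_fun E) (e : label E) (i : nat) : R := f e (i%:R * mesh e).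

Lemma gend_sample (f : edge_fun E) a : gend (sample f) a = f a.1 (end_coord a).2.
Proof. by rewrite /gend /sample /end_coord; case: a.2; rewrite ?mul0r // meshN. Qed.

Lemma sample_pt e i : e \in edges E -> (i <= n.+1)%N -> 0 <= i%:R * mesh e <= len e.
Proof.
move=> eE iN; have s0 := ltW (mesh_gt0 eE); rewrite mulr_ge0 //=.
by rewrite -meshN ler_wpM2r // ler_nat.
Qed.

Definition outflow (f' : edge_fun E) a : R := (-1) ^+ a.2 * f' a.1 (end_coord a).2.

Lemma sum_endpoints (F : label E * bool -> R) :
  \sum_(a in endpoints E) F a = \sum_(e in edges E) (F (e, false) + F (e, true)).
Proof.
transitivity (\sum_(e in edges E) \sum_(x : bool) F (e, x)).
  rewrite pair_big_dep /=; apply: eq_big => [[e x]|[e x] _] //.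
  by rewrite endpointsE andbT.
by apply: eq_bigr => e _; rewrite big_bool /= addrC.
Qed.

Lemma sum_verts G (F : label E * bool -> R) :
  \sum_(a in endpoints E) F a = \sum_(v in verts G) \sum_(a in v) F a.
Proof.
have /and3P[/eqP <- tr _] := vertsP G.
exact: finset.big_trivIset.
Qed.

(** Summation by parts: on a trigonometric edge function the form only sees
    the derivatives at the ends. *)
Lemma dform_sample w (f f' : edge_fun E) k : 0 < w -> short w ->
  (forall e, e \in edges E -> ode (len e) (w ^+ 2) (f e) (f' e)) ->
  dform w (sample f) k = - \sum_(a in endpoints E) gend k a * outflow f' a.
Proof.
move=> w0 sw H; rewrite sum_endpoints -sumrN; apply: eq_bigr => e eE.
have h0 := mesh_gt0 eE; have wh := sw e eE.
have T := ode_trigP w0 (H e eE).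
set A := f e 0 in T; set B := f' e 0 / w in T.
have Ti i : (i <= n.+1)%N -> sample f e i = trig w A B (i%:R * mesh e) /\
    f' e (i%:R * mesh e) = w * trig w B (- A) (i%:R * mesh e).
  by move=> iN; apply: T; exact: sample_pt.
rewrite (eq_bigr (fun i : 'I_n.+1 => k e i.+1 * f' e (i.+1%:R * mesh e) -
                             k e i * f' e (i%:R * mesh e))); last first.
  move=> i _; have iN : (i <= n.+1)%N by rewrite ltnW // ltnS.
  have [-> ->] := Ti i iN; have [-> ->] := Ti i.+1 (ltn_ord i).
  have -> : i.+1%:R * mesh e = i%:R * mesh e + mesh e by rewrite -natr1 mulrDl mul1r.
  have [F1 F2] := trig_flux w0 h0 wh A B (i%:R * mesh e).
  set F := trig w A B in F1 F2 *; set x := i%:R * mesh e in F1 F2 *.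
  set y := x + mesh e in F1 F2 *.
  rewrite -F2 mulrC [_ * (w * _)]mulrC -[w * _]opprK -F1 /pform; ring.
rewrite -(big_mkord predT (fun i => k e i.+1 * f' e (i.+1%:R * mesh e) -
                             k e i * f' e (i%:R * mesh e))) telescope_sumr //.
rewrite /gend /outflow /end_coord /= mul0r meshN expr0 expr1; ring.
Qed.

End discrete_form.

(** * Solutions and the kernel of the form *)

Lemma trig_eq0 (R : realType) (w a b x h : R) : 0 < h -> w * h < pi -> 0 < w ->
  trig w a b x = 0 -> trig w a b (x + h) = 0 -> forall y, trig w a b y = 0.
Proof.
move=> h0 wh w0 F0; have s0 := sin_wh_gt0 w0 h0 wh.
rewrite trigD F0 mul0r add0r => /eqP; rewrite mulf_eq0 (gt_eqF s0) orbF => /eqP F1 y.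
by rewrite -[y](subrKC x) trigD F0 F1 !mul0r addr0.
Qed.

Lemma piece_exists (R : realType) (n : nat) (h x : R) : 0 <= x <= n.+1%:R * h ->
  exists2 i, (i <= n)%N & i%:R * h <= x <= i.+1%:R * h.
Proof.
elim: n => [|n IH] /andP[x0 xn]; first by exists 0%N; rewrite // mul0r x0 xn.
have [le1|/ltW le1] := leP x (n.+1%:R * h).
  have [|i iN H] := IH; first by rewrite x0.
  by exists i => //; rewrite (leq_trans iN).
by exists n.+1 => //; rewrite le1.
Qed.

Section kernel.
Variables (R : realType) (E : edge_system R) (G : mgraph E) (n : nat).
Variables (D : {set {set label E * bool}}) (w : R).
Hypotheses (w0 : 0 < w) (sw : short E n w) (DG : D \subset verts G).
Implicit Types (g k : label E -> nat -> R) (f : edge_fun E).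

Definition in_kernel g : Prop :=
  admissible n G D g /\ forall k, admissible n G D k -> dform n w g k = 0.

Lemma laplacian_ode f m : laplacian G D f (fun e x => m * f e x) ->
  exists2 f' : edge_fun E, forall e, e \in edges E -> ode (len e) m (f e) (f' e) &
   [/\ forall v a b, v \in verts G -> a \in v -> b \in v ->
        f a.1 (end_coord a).2 = f b.1 (end_coord b).2,
      forall v a, v \in D -> a \in v -> f a.1 (end_coord a).2 = 0 &
      forall v, v \in verts G -> v \notin D -> \sum_(a in v) outflow f' a = 0].
Proof.
case=> f' [H1 H2 H3 H4]; exists f' => // e eE x xl; apply: H1.
by rewrite /on_edges /= eE.
Qed.

Lemma dform_sample_outflow (f f' : edge_fun E) k :
  (forall e, e \in edges E -> ode (len e) (w ^+ 2) (f e) (f' e)) ->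
  admissible n G D k ->
  (forall v, v \in verts G -> v \notin D -> \sum_(a in v) outflow f' a = 0) ->
  dform n w (sample n f) k = 0.
Proof.
move=> H [k1 k2] kir; rewrite (dform_sample k w0 sw H) (sum_verts G).
rewrite big1 ?oppr0 // => v vG; have [vD|vD] := boolP (v \in D).
  by rewrite big1 // => a av; rewrite (k2 v a) // mul0r.
have [a av] := vert_neq0 vG.
rewrite (eq_bigr (fun b => gend n k a * outflow f' b)); last first.
  by move=> b bv; congr (_ * _); apply: k1; exists v.
by rewrite -mulr_sumr kir // mulr0.
Qed.

Lemma sample_admissible f :
  (forall a b, same_vertex G a b -> f a.1 (end_coord a).2 = f b.1 (end_coord b).2) ->
  (forall v a, v \in D -> a \in v -> f a.1 (end_coord a).2 = 0) ->
  admissible n G D (sample n f).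
Proof. by move=> H1 H2; split=> *; rewrite !gend_sample; eauto. Qed.

Lemma laplacian_kernel f : laplacian G D f (fun e x => w ^+ 2 * f e x) ->
  in_kernel (sample n f).
Proof.
move=> /laplacian_ode[f' H [H2 H3 H4]]; split=> [|k ak].
  apply: sample_admissible => [a b [v vG [av bv]]|v a vD av]; first exact: H2 vG av bv.
  exact: H3 vD av.
exact: dform_sample_outflow H ak H4.
Qed.

Lemma sample_nz f f' :
  (forall e, e \in edges E -> ode (len e) (w ^+ 2) (f e) (f' e)) ->
  (exists p : gpoint G, feval f p != 0) -> dnz n (sample n f).
Proof.
move=> H [p fp]; have /andP[eE xl] := ptP p.
set e := (pt p).1 in eE xl; have h0 := mesh_gt0 n eE.
have T := ode_trigP w0 (H e eE).
apply: contrapT => nz; have s0 i : (i <= n.+1)%N -> sample n f e i = 0.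
  by move=> iN; apply/eqP; apply: contrapT => /negP si; apply: nz; exists e, i.
have z0 := s0 0%N isT; have z1 := s0 1%N isT.
rewrite /sample mul0r in z0; rewrite /sample mul1r in z1.
have l1 : 0 <= mesh n e <= len e by have := sample_pt (n := n) eE (i := 1%N) isT; rewrite mul1r.
move: fp; rewrite /feval (T _ xl).1 (@trig_eq0 _ _ _ _ 0 (mesh n e)) ?eqxx ?sw //.
  by rewrite trig0.
by rewrite add0r -(T _ l1).1.
Qed.

Lemma sum_delta (F : nat -> R) (j : nat) : (j < n.+1)%N ->
  \sum_(i < n.+1) ((i == j :> nat)%:R * F i) = F j.
Proof.
move=> jN; rewrite (bigD1 (Ordinal jN)) //= eqxx mul1r big1 ?addr0 // => i.
by rewrite -val_eqE /= => /negbTE ->; rewrite mul0r.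
Qed.

(** This is the equation tested with the indicator of an inner node. *)
Lemma kernel_recurrence g e j : in_kernel g -> e \in edges E -> (j < n)%N ->
  g e j.+2 = 2 * cos (w * mesh n e) * g e j.+1 - g e j.
Proof.
move=> [_ kg] eE jN; have h0 := mesh_gt0 n eE; have wh := sw eE.
pose k (e' : label E) (i : nat) : R := ((e' == e) && (i == j.+1))%:R.
have kz (a : label E * bool) : gend n k a = 0.
  rewrite /gend /k; case: a.2; rewrite ?andbF //.
  by rewrite eqSS gtn_eqF ?andbF.
have := kg k; rewrite /dform (bigD1 e) //= [X in _ + X]big1 => [|e' /andP[_ ne]]; last first.
  by rewrite big1 // => i _; rewrite /k (negbTE ne) /pform /= subrr !mulr0 addr0 mulr0 subr0.
rewrite addr0 (eq_bigr (fun i : 'I_n.+1 =>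
  (i == j.+1 :> nat)%:R * (stiff w (mesh n e) * (g e i - g e i.+1)
            - w ^+ 2 * mass w (mesh n e) * g e i) +
  (i == j :> nat)%:R * (stiff w (mesh n e) * (g e i.+1 - g e i)
            - w ^+ 2 * mass w (mesh n e) * g e i.+1))); last first.
  by move=> i _; rewrite /pform /k eqxx /= eqSS; ring.
rewrite big_split /=.
rewrite (sum_delta (fun i => (stiff w (mesh n e) * (g e i - g e i.+1)
            - w ^+ 2 * mass w (mesh n e) * g e i))) //.
rewrite (sum_delta (fun i => (stiff w (mesh n e) * (g e i.+1 - g e i)
            - w ^+ 2 * mass w (mesh n e) * g e i.+1))); last by rewrite ltnW // ltnS.
have s0 := sin_wh_gt0 w0 h0 wh.
have -> x y z : stiff w (mesh n e) * (x - y) - w ^+ 2 * mass w (mesh n e) * x +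
   (stiff w (mesh n e) * (x - z) - w ^+ 2 * mass w (mesh n e) * x) =
   2 * (stiff w (mesh n e) - w ^+ 2 * mass w (mesh n e)) * x - stiff w (mesh n e) * (y + z).
  by ring.
rewrite stiff_massE // stiffE // => /(_ _) K.
have {}K := K (conj (fun a b _ => etrans (kz a) (esym (kz b))) (fun v a _ _ => kz a)).
move: (g e j) (g e j.+1) (g e j.+2) K s0 => x y z K s0.
have {}K : (w / sin (w * mesh n e)) * (2 * cos (w * mesh n e) * y - (z + x)) = 0.
  by rewrite -[RHS]K; field; rewrite gt_eqF.
have : 2 * cos (w * mesh n e) * y - (z + x) = 0.
  move/eqP: K; rewrite mulf_eq0 gt_eqF ?divr_gt0 //= => /eqP -> //.
by move=> K2; apply/eqP; rewrite -subr_eq0; apply/eqP; rewrite -[RHS]oppr0 -K2; ring.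
Qed.

(** Testing the form with the indicator of a vertex gives the Kirchhoff condition. *)
Lemma kirchhoff_of_kernel (f f' : edge_fun E) :
  (forall e, e \in edges E -> ode (len e) (w ^+ 2) (f e) (f' e)) ->
  (forall k, admissible n G D k -> dform n w (sample n f) k = 0) ->
  forall v, v \in verts G -> v \notin D -> \sum_(a in v) outflow f' a = 0.
Proof.
move=> Hode ker v vG vD.
pose k (e : label E) (i : nat) : R :=
  ((i == 0%N) && ((e, false) \in v))%:R + ((i == n.+1) && ((e, true) \in v))%:R.
have kE a : gend n k a = (a \in v)%:R.
  case: a => e b; rewrite /gend /k; case: b => /=; rewrite ?eqxx /=.
    by rewrite add0r.
  by rewrite addr0.
have ak : admissible n G D k.
  split=> [a b [u uG [au bu]]|u a uD au]; rewrite !kE.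
    congr ((_ : bool)%:R); apply/idP/idP => H.
      by rewrite (vert_uniq vG uG H au).
    by rewrite (vert_uniq vG uG H bu).
  case: (boolP (a \in v)) => // av.
  by move: vD; rewrite (vert_uniq vG (fintype.subsetP DG _ uD) av au) uD.
have := ker k ak.
rewrite (dform_sample k w0 sw Hode) (sum_verts G) (bigD1 v) //=.
rewrite [X in _ + X]big1 => [|u /andP[uG uv]]; last first.
  rewrite big1 // => a au; rewrite kE; case: (boolP (a \in v)) => [av|]; last by rewrite mul0r.
  by move: uv; rewrite (vert_uniq uG vG au av) eqxx.
rewrite addr0 (eq_bigr (outflow f')) => [/eqP|a av]; last by rewrite kE av mul1r.
by rewrite oppr_eq0 => /eqP.
Qed.

(** The kernel of the form consists of the samples of the solutions: the
    equations at the inner nodes are the recurrence of the cosine, so that the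
    values extend to a trigonometric function on the whole edge. *)
Lemma kernel_laplacian g : in_kernel g -> exists f,
  laplacian G D f (fun e x => w ^+ 2 * f e x) /\
  forall e i, e \in edges E -> (i <= n.+1)%N -> sample n f e i = g e i.
Proof.
move=> kg; have [[g1 g2] g3] := kg.
pose A e := g e 0%N.
pose B e := (g e 1%N - g e 0%N * cos (w * mesh n e)) / sin (w * mesh n e).
pose f : edge_fun E := fun e x => trig w (A e) (B e) x.
pose f' : edge_fun E := fun e x => w * trig w (B e) (- A e) x.
have Hode e : e \in edges E -> ode (len e) (w ^+ 2) (f e) (f' e) by move=> _; exact: ode_trig.
have fg e i : e \in edges E -> (i <= n.+1)%N -> sample n f e i = g e i.
  move=> eE; have h0 := mesh_gt0 n eE; have wh := sw eE.
  have s0 := sin_wh_gt0 w0 h0 wh.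
  suff H j : (j <= n)%N -> sample n f e j = g e j /\ sample n f e j.+1 = g e j.+1.
    by case: i => [|i] iN; [have [] := H 0%N isT | have [] := H i iN].
  elim: j => [|j IH] jN.
    rewrite /sample /f mul0r trig0 mul1r; split=> //.
    by rewrite /trig /B /A; field; rewrite gt_eqF.
  have [E1 E2] := IH (ltnW jN); split=> //.
  rewrite (kernel_recurrence kg eE jN) -E1 -E2 /sample /f.
  have -> : j.+2%:R * mesh n e = j%:R * mesh n e + mesh n e + mesh n e.
    by rewrite -!natr1; ring.
  have -> : j.+1%:R * mesh n e = j%:R * mesh n e + mesh n e by rewrite -natr1; ring.
  exact: trig_recurrence.
exists f; split=> //; exists f'.
have gf a : a \in endpoints E -> gend n g a = f a.1 (end_coord a).2.
  rewrite endpointsE -(gend_sample n) /gend => aE; rewrite fg //.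
  by case: a.2.
split.
- by move=> e x /andP[/= eE xl]; exact: Hode.
- move=> v a b vG av bv; rewrite -!gf; [|exact: vert_endpoint vG bv|exact: vert_endpoint vG av].
  by apply: g1; exists v.
- move=> v a vD av; rewrite -gf ?(g2 v) //.
  exact: vert_endpoint (fintype.subsetP DG _ vD) av.
- apply: kirchhoff_of_kernel Hode _ => k ak.
  by rewrite (dform_ext (g' := g) (k' := k) w fg) // g3.
Qed.

End kernel.

(** * Sign of the eigenvalues *)

Section spectrum_sign.
Variables (R : realType) (E : edge_system R) (G : mgraph E).
Variable (D : {set {set label E * bool}}).
Hypothesis (DG : D \subset verts G).

Lemma econn_const (h : label E -> R) : econn G ->
  (forall a b, same_vertex G a b -> h a.1 = h b.1) ->
  forall e e', e \in edges E -> e' \in edges E -> h e = h e'.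
Proof.
move=> [_ _ _ minE] H e e' eE e'E.
have /fintype.subsetP/(_ e' e'E) : edges E \subset [set x | h x == h e]%SET.
  apply: minE; last by exists e => //; rewrite finset.inE.
  by move=> a b ab; rewrite !finset.inE (H a b ab).
by rewrite finset.inE => /eqP.
Qed.

(** For m <= 0 the product of f and f' is nondecreasing on every edge, its
    derivative being f'^2 - m f^2, while by the vertex conditions its total
    increase over the edges is zero; hence it is constant on each of them. *)
Lemma laplacian_nonpos m (f : edge_fun E) : m <= 0 ->
  laplacian G D f (fun e x => m * f e x) ->
  forall e x, e \in edges E -> 0 <= x <= len e ->
    f e x = f e 0 /\ m * f e x = 0.
Proof.
move=> m0 /laplacian_ode[f' H [H2 H3 H4]].
pose h e x := f e x * f' e x.
have dh e x : e \in edges E -> 0 <= x <= len e ->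
    has_deriv (len e) (h e) x (f' e x ^+ 2 - m * f e x ^+ 2).
  move=> eE xl; have [d1 d2] := H e eE x xl.
  by have := has_derivM d1 d2 xl; congr has_deriv; ring.
have hmono e : e \in edges E -> forall x y, 0 <= x -> x <= y -> y <= len e -> h e x <= h e y.
  move=> eE; apply: has_deriv_ge0 => [x xl|x _]; first exact: dh.
  by rewrite addr_ge0 ?sqr_ge0 // -mulNr mulr_ge0 ?sqr_ge0 ?oppr_ge0.
have sum0 : \sum_(e in edges E) (h e (len e) - h e 0) = 0.
  transitivity (- \sum_(a in endpoints E) f a.1 (end_coord a).2 * outflow f' a).
    rewrite sum_endpoints -sumrN; apply: eq_bigr => e _.
    by rewrite /h /outflow /end_coord /= expr0 expr1; ring.
  rewrite (sum_verts G) big1 ?oppr0 // => v vG; have [vD|vD] := boolP (v \in D).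
    by rewrite big1 // => a av; rewrite (H3 v a) // mul0r.
  have [a av] := vert_neq0 vG.
  rewrite (eq_bigr (fun b => f a.1 (end_coord a).2 * outflow f' b)); last first.
    by move=> b bv; congr (_ * _); apply: (H2 v).
  by rewrite -mulr_sumr H4 // mulr0.
have eq0 e : e \in edges E -> h e (len e) = h e 0.
  move=> eE; apply/eqP; rewrite -subr_eq0; move/eqP: sum0.
  rewrite psumr_eq0 => [/allP/(_ e)|e' e'E].
    by rewrite mem_index_enum eE => /(_ isT).
  by rewrite subr_ge0 hmono // ltW // len_gt0.
move=> e x eE xl.
have inner0 y : 0 < y < len e -> f' e y = 0 /\ m * f e y = 0.
  move=> yl; have /andP[y0 y1] := yl.
  have yl' : 0 <= y <= len e by rewrite !ltW.
  have hc z : 0 <= z <= len e -> h e z = h e 0.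
    move=> /andP[z0 z1]; apply/eqP; rewrite eq_le; apply/andP; split.
      by rewrite -(eq0 e eE); exact: hmono.
    exact: hmono.
  have hd : has_deriv (len e) (h e) y 0.
    apply: (@has_deriv_ext _ _ (fun=> h e 0)) => // [z zl|].
      by rewrite hc.
    by apply: is_derive_has_deriv; exact: is_derive_cst.
  have := has_deriv_unique yl hd (dh e y eE yl') => /esym/eqP.
  have mf0 : 0 <= - m * f e y ^+ 2 by apply: mulr_ge0; rewrite ?oppr_ge0 ?sqr_ge0.
  rewrite -mulNr (paddr_eq0 (sqr_ge0 _) mf0).
  rewrite sqrf_eq0 mulNr oppr_eq0 expr2 mulrA mulf_eq0 => /andP[/eqP -> /orP[/eqP ->|/eqP ->]] //.
  by rewrite mulr0.
have f_cst := @has_deriv_cst _ (len e) (f e) (f' e)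
  (fun y yl => (H e eE y yl).1) (fun y yl => (inner0 y yl).1).
split; first exact: f_cst.
have l0 := len_gt0 eE; rewrite (f_cst x xl) -(f_cst (len e / 2)); last by lra.
by have [] := inner0 (len e / 2) _ => //; lra.
Qed.

Lemma eigenvalue_ge0 m f : eigenfunction G D m f -> 0 <= m.
Proof.
move=> [[p fp] L]; rewrite leNgt; apply/negP => m0.
have /andP[eE xl] := ptP p.
have [_ /eqP] := laplacian_nonpos (ltW m0) L eE xl.
by rewrite mulf_eq0 lt_eqF //= (negbTE fp).
Qed.

Lemma eigenvalue0_const f : econn G -> laplacian G D f (fun e x => 0 * f e x) ->
  forall e e' x x', on_edges (e, x) -> on_edges (e', x') -> f e x = f e' x'.
Proof.
move=> cG L; have H e x : on_edges (e, x) -> f e x = f e 0.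
  by move=> /andP[eE xl]; have [] := laplacian_nonpos (lexx 0) L eE xl.
move=> e e' x x' ex ex'; rewrite (H _ _ ex) (H _ _ ex').
case/andP: ex => eE _; case/andP: ex' => e'E _.
apply: (@econn_const (fun e => f e 0)) => // a b ab.
have aE := on_edges_end (same_vertex_endpoint ab).
have bE := on_edges_end (same_vertex_endpoint (same_vertex_sym ab)).
rewrite -(H _ _ aE) -(H _ _ bE); case: L => f' [_ H2 _ _].
by case: ab => v vG [av bv]; exact: H2 vG av bv.
Qed.

Lemma eigenvalue_gt0 m f : econn G -> (exists v, v \in D) -> eigenfunction G D m f -> 0 < m.
Proof.
move=> cG [v vD] ef; have m0 := eigenvalue_ge0 ef; rewrite lt_def m0 andbT.
apply/eqP => mz; rewrite mz in ef; case: ef => [[p fp] L].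
have vG := fintype.subsetP DG _ vD; have [a av] := vert_neq0 vG.
have aE := on_edges_end (vert_endpoint vG av).
move: fp; rewrite /feval.
have pE := ptP p; rewrite [pt p]surjective_pairing in pE.
rewrite [end_coord a]surjective_pairing in aE.
rewrite (eigenvalue0_const cG L pE aE); case: L => f' [_ _ H3 _].
by rewrite (H3 v a vD av) eqxx.
Qed.

End spectrum_sign.

Lemma min_inf (R : realType) (A : set R) (x : R) : A x -> lbound A x -> inf A = x.
Proof.
move=> Ax lb; apply/eqP; rewrite eq_le; apply/andP; split.
  by apply: ge_inf => //; exists x.
by apply: lb_le_inf => //; exists x.
Qed.

(** * The first critical frequency *)

Lemma short_le (R : realType) (E : edge_system R) n (w w' : R) :
  w' <= w -> short E n w -> short E n w'.
Proof.
move=> ww sw e eE; apply: le_lt_trans (sw e eE); rewrite ler_wpM2r //.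
exact/ltW/mesh_gt0.
Qed.

Lemma short_exists (R : realType) (E : edge_system R) (w : R) : exists n, short E n w.
Proof.
pose n := (\max_(e : label E) Num.bound (w * len e / pi))%N.
exists n => e eE; rewrite /mesh mulrA ltr_pdivrMr ?ltr0n // -ltr_pdivrMl ?pi_gt0 //.
rewrite mulrC; have [ge0|lt0] := lerP 0 (w * len e / pi); last first.
  by apply: lt_trans lt0 _; rewrite ltr0n.
apply: lt_trans (archi_boundP ge0) _; rewrite ltr_nat ltnS.
exact: (@leq_bigmax _ (fun e => Num.bound (w * len e / pi)) e).
Qed.

Section first_frequency.
Variables (R : realType) (E : edge_system R) (G : mgraph E) (n : nat).
Variables (D : {set {set label E * bool}}) (W : R).
Hypotheses (W0 : 0 <= W) (sW : short E n W).
Implicit Types (g k : label E -> nat -> R).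

Let node : Type := (label E * 'I_n.+2)%type.
Let vec := 'rV[R]_(#|{: label E * 'I_n.+2}|).
Let nd (j : 'I_#|{: label E * 'I_n.+2}|) : node := enum_val j.

Let ext (x : vec) (e : label E) (i : nat) : R := x 0 (enum_rank ((e, inord i) : label E * 'I_n.+2)).
Let tov g (c : R) : vec :=
  \row_j (if (nd j).1 \in edges E then c * g (nd j).1 (nd j).2 else 0).

Let extK g c e i : e \in edges E -> (i <= n.+1)%N -> ext (tov g c) e i = c * g e i.
Proof. by move=> eE iN; rewrite /ext mxE /nd enum_rankK /= eE inordK. Qed.

Let continuous_ext e i : continuous (fun x : vec => ext x e i).
Proof. by move=> x; exact: coord_continuous. Qed.

Let X : set vec := [set x | [/\
  forall ab : (label E * bool) * (label E * bool), same_vertex G ab.1 ab.2 ->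
     gend n (ext x) ab.1 - gend n (ext x) ab.2 = 0,
  forall a : label E * bool, (exists2 v, v \in D & a \in v) -> gend n (ext x) a = 0 &
  forall j, (nd j).1 \notin edges E -> x 0 j = 0]].

Let closed_forall (I : Type) (P : I -> Prop) (F : I -> vec -> R) :
  (forall i, continuous (F i)) -> closed [set x | forall i, P i -> F i x = 0].
Proof.
move=> cF; rewrite (_ : mkset _ = \bigcap_(i in P) (F i @^-1` [set y | y = 0])) //.
apply: closed_bigI => i _; apply: preimage_closed; last exact: closed_eq.
by move=> x _; exact: cF.
Qed.

Let closedX : closed X.
Proof.
have cg (a : label E * bool) : continuous (fun x : vec => gend n (ext x) a).
  by rewrite /gend; exact: continuous_ext.
rewrite (_ : X = [set x | forall ab : (label E * bool) * (label E * bool),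
     same_vertex G ab.1 ab.2 -> gend n (ext x) ab.1 - gend n (ext x) ab.2 = 0] `&`
  [set x | forall a : label E * bool, (exists2 v, v \in D & a \in v) ->
     gend n (ext x) a = 0] `&`
  [set x | forall j, (nd j).1 \notin edges E -> x 0 j = 0]); last first.
  by apply/seteqP; split=> x; [case=> H1 H2 H3; do !split|case=> [[H1 H2] H3]; split].
apply: closedI; last first.
  by apply: (@closed_forall _ (fun j => (nd j).1 \notin edges E)
    (fun j x => x 0 j)) => j x; exact: coord_continuous.
apply: closedI; last first.
  by apply: (@closed_forall _ (fun a : label E * bool => exists2 v, v \in D & a \in v)
     (fun a x => gend n (ext x) a)).
apply: (@closed_forall _ (fun ab : (label E * bool) * (label E * bool) =>
   same_vertex G ab.1 ab.2) (fun ab x => gend n (ext x) ab.1 - gend n (ext x) ab.2)).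
by move=> ab x; exact: (cvgB (cg ab.1 x) (cg ab.2 x)).
Qed.

Let XP x : X x -> admissible n G D (ext x).
Proof.
case=> H1 H2 _; split=> [a b ab|v a vD av].
  by apply/eqP; rewrite -subr_eq0; apply/eqP; exact: (H1 (a, b)).
by apply: H2; exists v.
Qed.

Hypothesis DG : D \subset verts G.

Let tov_gend g c a : a \in endpoints E -> gend n (ext (tov g c)) a = c * gend n g a.
Proof. by rewrite endpointsE => aE; rewrite /gend extK //; case: a.2. Qed.

Let XtoV g c : admissible n G D g -> X (tov g c).
Proof.
move=> [g1 g2]; split=> [[a b] /= ab|a [v vD av]|j /negbTE nj].
- rewrite !tov_gend ?(g1 a b) ?subrr //.
    exact: same_vertex_endpoint (same_vertex_sym ab).
  exact: same_vertex_endpoint ab.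
- rewrite tov_gend ?(g2 v a) ?mulr0 //.
  exact: vert_endpoint (fintype.subsetP DG _ vD) av.
- by rewrite mxE nj.
Qed.

Let comp2 (F : vec -> R) : continuous F -> continuous (fun z : R * vec => F z.2).
Proof.
move=> cF z; apply: (@continuous_cvg _ _ _ _ _ snd F z.2); first exact: cF.
exact: cvg_snd.
Qed.

Let comp1 (F : R -> R) : continuous F -> continuous (fun z : R * vec => F z.1).
Proof.
move=> cF z; apply: (@continuous_cvg _ _ _ _ _ fst F z.1); first exact: cF.
exact: cvg_fst.
Qed.

Let continuous_q :
  continuous (fun z : R * vec => dform n (clamp 0 W z.1) (ext z.2) (ext z.2)).
Proof.
apply: continuous_big_sum => e eE; apply: continuous_big_sum => i _ z.
have h0 := mesh_gt0 n eE.
have c1 : {for z, continuous (fun z : R * vec => ext z.2 e i)}.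
  exact: (@comp2 (fun x => ext x e i) (@continuous_ext e i) z).
have c2 : {for z, continuous (fun z : R * vec => ext z.2 e i.+1)}.
  exact: (@comp2 (fun x => ext x e i.+1) (@continuous_ext e i.+1) z).
have c3 : {for z, continuous (fun z : R * vec => stiff (clamp 0 W z.1) (mesh n e))}.
  exact: (@comp1 (fun t => stiff (clamp 0 W t) (mesh n e)) (continuous_stiff W0 h0 (sW eE)) z).
have c4 : {for z, continuous (fun z : R * vec => mass (clamp 0 W z.1) (mesh n e))}.
  exact: (@comp1 (fun t => mass (clamp 0 W t) (mesh n e)) (continuous_mass W0 h0 (sW eE)) z).
have c5 : {for z, continuous (fun z : R * vec => clamp 0 W z.1)}.
  exact: (@comp1 (clamp 0 W) (@continuous_clamp R W) z).
rewrite /continuous_at /pform /=; apply: cvgB.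
  by apply: cvgM => //; apply: cvgM; apply: cvgB.
apply: cvgM; last by apply: cvgD; apply: cvgM.
by apply: cvgM => //; apply: cvgM.
Qed.

Let continuous_b :
  continuous (fun z : R * vec => dmass n (clamp 0 W z.1) (ext z.2)).
Proof.
apply: continuous_big_sum => e eE; apply: continuous_big_sum => i _ z.
have h0 := mesh_gt0 n eE.
apply: cvgM.
  exact: (@comp1 (fun t => mass (clamp 0 W t) (mesh n e)) (continuous_mass W0 h0 (sW eE)) z).
exact: (cvgD (@comp2 (fun x => ext x e i) (@continuous_ext e i) z)
  (@comp2 (fun x => ext x e i.+1) (@continuous_ext e i.+1) z)).
Qed.

Let dform_scale w c g : dform n w (fun e i => c * g e i) (fun e i => c * g e i)
   = c ^+ 2 * dform n w g g.
Proof.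
have := dform_quad n w c 0 g g.
have -> : (fun e i => c * g e i + 0 * g e i) = (fun e i => c * g e i).
  by apply/funext => e; apply/funext => i; rewrite mul0r addr0.
by move=> ->; ring.
Qed.

(** By compactness there is a least frequency at which the form fails to be
    positive, on all admissible functions or on those of zero mass. *)
Lemma first_frequency (B : bool) :
  let bad w g := [/\ admissible n G D g, dnz n g, dform n w g g <= 0 &
                     B -> dmass n w g = 0] in
  (exists g, bad W g) ->
  exists w g, [/\ 0 <= w <= W, bad w g &
    forall w' g', 0 <= w' < w -> ~ bad w' g'].
Proof.
move=> bad badW.
pose q t x := dform n (clamp 0 W t) (ext x) (ext x).
pose b t x := if B then dmass n (clamp 0 W t) (ext x) else 0.
have cb : continuous (fun z : R * vec => b z.1 z.2).
  rewrite /b; case: (B); first exact: continuous_b.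
  by move=> z; exact: cvg_cst.
have norm w g : 0 <= w <= W -> bad w g -> exists x : vec,
    [/\ 0 <= w <= W, X x, \sum_j x 0 j ^+ 2 = 1, q w x <= 0 & b w x = 0].
  move=> wW [ag [e [i [eE iN gi]]] qg bg].
  pose s := \sum_j (tov g 1) 0 j ^+ 2.
  have s0 : 0 < s.
    rewrite /s (bigD1 (enum_rank ((e, inord i) : label E * 'I_n.+2))) //= ltr_pwDl //.
      have := extK g 1 eE iN; rewrite /ext mul1r => ->.
      by rewrite lt_def sqr_ge0 sqrf_eq0 gi.
    by apply: sumr_ge0 => j _; exact: sqr_ge0.
  pose c := (Num.sqrt s)^-1.
  have c2 : c ^+ 2 * s = 1.
    by rewrite /c exprVn sqr_sqrtr ?ltW // mulVf // gt_eqF.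
  exists (tov g c); split=> //.
  - exact: XtoV.
  - rewrite -[RHS]c2 /s mulr_sumr; apply: eq_bigr => j _; rewrite !mxE -exprMn.
    by case: ifP => _; rewrite ?mulr0 // mul1r.
  - rewrite /q clamp_id // (@dform_ext _ _ n w _ (fun e i => c * g e i) _
      (fun e i => c * g e i)); [|by move=> *; exact: extK|by move=> *; exact: extK].
    by rewrite dform_scale mulr_ge0_le0 ?sqr_ge0.
  - rewrite /b clamp_id //; case: ifP => // BT; have {}bg := bg BT.
    rewrite (@dmass_ext _ _ n w _ (fun e i => c * g e i + 0 * g e i)); last first.
      by move=> *; rewrite extK // mul0r addr0.
    by rewrite dmass_lin bg mulr0 mul0r addr0.
have [|[w x] /= [wW Xx x1 qx bx] Hz] := @first_parameter R _ W X q b closedX continuous_q cb.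
  case: badW => g badg; have WW : 0 <= W <= W by rewrite W0 lexx.
  have [x Hx] := norm W g WW badg.
  by exists (W, x).
exists w, (ext x); rewrite /q /b clamp_id // in qx bx; split=> //.
  split=> //; first exact: XP.
    apply: contrapT => nz.
    suff x0 j : x 0 j = 0.
      move: x1; rewrite big1 => [/esym/eqP|j _]; first by rewrite oner_eq0.
      by rewrite x0 expr0n.
    case: (Xx) => _ _ xj.
    have [eE|eE] := boolP ((nd j).1 \in edges E); last by rewrite xj.
    apply/eqP; apply: contrapT => /negP xnz; apply: nz.
    exists (nd j).1, (nd j).2; split=> //; first by rewrite -ltnS.
    by rewrite /ext inord_val -surjective_pairing /nd enum_valK.
  by move=> BT; rewrite BT in bx.
move=> w' g' /andP[w'0 w'w] bad'.
have w'W : 0 <= w' <= W by rewrite w'0 (le_trans (ltW w'w)) //; case/andP: wW.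
have [x' Hx'] := norm w' g' w'W bad'.
have := Hz (w', x') Hx'; rewrite /=.
by rewrite leNgt w'w.
Qed.

End first_frequency.

(** * The lowest and the second eigenvalue *)

Lemma limit_ge0 (R : realType) (F : R -> R) (w : R) : 0 < w -> continuous F ->
  (forall t, 0 < t < w -> 0 <= F t) -> 0 <= F w.
Proof.
move=> w0 cF H; rewrite leNgt; apply/negP => Fw.
have /cvgrPdist_lt/(_ (- F w)) := cF w; rewrite oppr_gt0 => /(_ Fw).
move=> /nbhs_ballP[r /= r0 Hr].
pose t := w - Num.min r w / 2.
have m0 : 0 < Num.min r w by rewrite lt_min r0 w0.
have mr : Num.min r w <= r by rewrite ge_min lexx.
have mw : Num.min r w <= w by rewrite ge_min lexx orbT.
have := Hr t; rewrite /ball /= /t opprD addrA subrr add0r opprK gtr0_norm ?divr_gt0 //.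
have -> : Num.min r w / 2 < r by lra.
move=> /(_ isT); rewrite ltr_norml => /andP[K _]; move: K.
have := H t; rewrite /t.
have -> : 0 < w - Num.min r w / 2 < w by lra.
by move=> /(_ isT); lra.
Qed.

Section frequencies.
Variables (R : realType) (E : edge_system R) (G : mgraph E) (n : nat).
Variables (D : {set {set label E * bool}}).
Hypotheses (cG : econn G) (DG : D \subset verts G).
Implicit Types (g k : label E -> nat -> R).

Lemma continuous_dform W g k : 0 <= W -> short E n W ->
  continuous (fun t => dform n (clamp 0 W t) g k).
Proof.
move=> W0 sW; apply: continuous_big_sum => e eE; apply: continuous_big_sum => i _ t.
have h0 := mesh_gt0 n eE.
have c3 := @continuous_stiff R W (mesh n e) W0 h0 (sW e eE) t.
have c4 := @continuous_mass R W (mesh n e) W0 h0 (sW e eE) t.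
have c5 := @continuous_clamp R W t.
rewrite /continuous_at /pform /=; apply: cvgB; apply: cvgMl => //.
by apply: cvgM => //; apply: cvgM.
Qed.

Lemma continuous_dmass W g : 0 <= W -> short E n W ->
  continuous (fun t => dmass n (clamp 0 W t) g).
Proof.
move=> W0 sW; apply: continuous_big_sum => e eE; apply: continuous_big_sum => i _ t.
have h0 := mesh_gt0 n eE.
by apply: cvgMl; exact: (@continuous_mass R W (mesh n e) W0 h0 (sW e eE) t).
Qed.

(** At frequency 0 the form is the sum of the squared slopes. *)
Lemma dform0_const g : admissible n G D g -> dform n 0 g g <= 0 ->
  forall e e' i i', e \in edges E -> e' \in edges E -> (i <= n.+1)%N -> (i' <= n.+1)%N ->
    g e i = g e' i'.
Proof.
move=> [g1 _] q0.
have s0 e : e \in edges E -> 0 < stiff 0 (mesh n e).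
  by move=> eE; rewrite stiff_gt0 ?mesh_gt0 // mul0r pi_gt0.
have term e i : pform 0 (mesh n e) (g e i) (g e i.+1) (g e i) (g e i.+1) =
    stiff 0 (mesh n e) * (g e i - g e i.+1) ^+ 2.
  by rewrite /pform expr0n /= mul0r mul0r subr0 expr2.
have tge e i : e \in edges E -> 0 <= stiff 0 (mesh n e) * (g e i - g e i.+1) ^+ 2.
  by move=> eE; rewrite mulr_ge0 ?sqr_ge0 // ltW // s0.
have Z : dform n 0 g g == 0.
  rewrite eq_le q0 /=; apply: sumr_ge0 => e eE; apply: sumr_ge0 => i _.
  by rewrite term tge.
have stp e i : e \in edges E -> (i < n.+1)%N -> g e i.+1 = g e i.
  move=> eE iN; move: Z; rewrite /dform psumr_eq0; last first.
    by move=> e' e'E; apply: sumr_ge0 => j _; rewrite term tge.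
  move=> /allP/(_ e); rewrite mem_index_enum eE => /(_ isT); rewrite psumr_eq0; last first.
    by move=> j _; rewrite term tge.
  move=> /allP/(_ (Ordinal iN)); rewrite mem_index_enum => /(_ isT) /=.
  by rewrite term mulf_eq0 gt_eqF ?s0 //= sqrf_eq0 subr_eq0 => /eqP.
have cst e i : e \in edges E -> (i <= n.+1)%N -> g e i = g e 0%N.
  by move=> eE; elim: i => // i IH iN; rewrite stp // IH // ltnW.
move=> e e' i i' eE e'E iN i'N; rewrite cst // [RHS]cst //.
apply: (@econn_const _ _ G (fun e => g e 0%N)) => // a b ab.
have aE := same_vertex_endpoint ab.
have bE := same_vertex_endpoint (same_vertex_sym ab).
rewrite !endpointsE in aE bE.
have := g1 a b ab; rewrite /gend.
by case: a.2; case: b.2; rewrite ?(cst a.1 n.+1) ?(cst b.1 n.+1).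
Qed.

(** Cauchy-Schwarz for a semidefinite form *)
Lemma form_null (w : R) (P : (label E -> nat -> R) -> Prop) g :
  (forall x k, P k -> P (fun e i => x * g e i + k e i)) ->
  (forall k, P k -> 0 <= dform n w k k) -> dform n w g g = 0 ->
  forall k, P k -> dform n w g k = 0.
Proof.
move=> clP psd g0 k Pk; apply/eqP; apply: contraT => b0; exfalso.
set b := dform n w g k in b0; set c := dform n w k k.
have H x : 0 <= 2 * x * b + c.
  have := psd _ (clP x k Pk).
  have -> : (fun e i => x * g e i + k e i) = (fun e i => x * g e i + 1 * k e i).
    by apply/funext => e; apply/funext => i; rewrite mul1r.
  by rewrite dform_quad g0; congr (_ <= _); rewrite /b /c; ring.
have := H (- (c + 1) / (2 * b)).
have -> : 2 * (- (c + 1) / (2 * b)) * b + c = -1 by field.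
by rewrite oppr_ge0 ler10.
Qed.

Lemma admissible_add x g k : admissible n G D g -> admissible n G D k ->
  admissible n G D (fun e i => x * g e i + k e i).
Proof.
move=> ag ak; have := admissible_lin x 1 ag ak.
by congr admissible; apply/funext => e; apply/funext => i; rewrite mul1r.
Qed.

Lemma dform_not_dnz w g : ~ dnz n g -> dform n w g g = 0.
Proof.
move=> nz; rewrite (@dform_ext _ _ n w g (fun _ _ => 0) g (fun _ _ => 0)).
- by rewrite /dform big1 // => e _; rewrite big1 // => i _; rewrite /pform; ring.
- by move=> e i eE iN; apply/eqP; apply: contrapT => /negP gi; apply: nz; exists e, i.
- by move=> e i eE iN; apply/eqP; apply: contrapT => /negP gi; apply: nz; exists e, i.
Qed.

(** Between two nodes a solution is a combination of two nonnegative sines whose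
    coefficients are its values at the nodes. *)
Lemma sample_ge0 (w : R) (f f' : edge_fun E) : 0 < w -> short E n w ->
  (forall e, e \in edges E -> ode (len e) (w ^+ 2) (f e) (f' e)) ->
  (forall e i, e \in edges E -> (i <= n.+1)%N -> 0 <= sample n f e i) ->
  forall e x, e \in edges E -> 0 <= x <= len e -> 0 <= f e x.
Proof.
move=> w0 sw H f0 e x eE xl.
have h0 := mesh_gt0 n eE; have wh := sw e eE; have s0 := sin_wh_gt0 w0 h0 wh.
have T := ode_trigP w0 (H e eE).
have [|i iN /andP[x1 x2]] := @piece_exists R n (mesh n e) x; first by rewrite meshN.
have [y yE] : exists y, x = i%:R * mesh n e + y by exists (x - i%:R * mesh n e); ring.
have i1 : (i <= n.+1)%N by exact: leqW.
have a0 := f0 e i eE i1; have b0 := f0 e i.+1 eE iN.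
rewrite /sample (T _ (sample_pt eE i1)).1 in a0.
rewrite /sample (T _ (sample_pt eE (iN : i.+1 <= n.+1)%N)).1 in b0.
have iS : i.+1%:R * mesh n e = i%:R * mesh n e + mesh n e by rewrite -natr1 mulrDl mul1r.
rewrite iS in b0; rewrite iS in x2.
rewrite (T x xl).1 yE -(pmulr_lge0 _ s0) (trig_interp w (mesh n e)).
have y0 : 0 <= y by lra.
have yh : y <= mesh n e by lra.
rewrite addr_ge0 // mulr_ge0 // sin_ge0_pi //; apply/andP; split.
- by rewrite mulr_ge0 ?subr_ge0 // ltW.
- by apply: le_trans (ltW wh); rewrite ler_wpM2l ?(ltW w0) // lerBlDr lerDl.
- by rewrite mulr_ge0 // ltW.
- by apply: le_trans (ltW wh); rewrite ler_wpM2l ?(ltW w0).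
Qed.

Lemma eigenfunction_kernel w f : 0 < w -> short E n w ->
  eigenfunction G D (w ^+ 2) f -> in_kernel G n D w (sample n f) /\ dnz n (sample n f).
Proof.
move=> w0 sw [nz L]; split; first exact: laplacian_kernel.
by have [f' H _] := laplacian_ode L; exact: sample_nz H nz.
Qed.

Lemma kernel_eigenfunction w g : 0 < w -> short E n w -> in_kernel G n D w g -> dnz n g ->
  exists f, eigenfunction G D (w ^+ 2) f /\
    forall e i, e \in edges E -> (i <= n.+1)%N -> sample n f e i = g e i.
Proof.
move=> w0 sw kg [e [i [eE iN gi]]]; have [f [L fg]] := kernel_laplacian w0 sw DG kg.
exists f; split=> //; split=> //.
have pE : on_edges (e, i%:R * mesh n e) by rewrite /on_edges /= eE sample_pt.
by exists (GPoint G pE); rewrite /feval /=; move: gi; rewrite -fg.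
Qed.

End frequencies.

Section existence.
Variables (R : realType) (E : edge_system R) (G : mgraph E).
Variables (D : {set {set label E * bool}}).
Hypotheses (cG : econn G) (DG : D \subset verts G).
Implicit Types (g k : label E -> nat -> R).

(** One period of the sine on a single edge has mass zero, and the form vanishes
    on it at the frequency of the sine. *)
Lemma test_function n e0 : e0 \in edges E -> short E n (2 * pi / len e0) ->
  exists g, [/\ admissible n G D g, dnz n g, dform n (2 * pi / len e0) g g <= 0 &
                dmass n (2 * pi / len e0) g = 0].
Proof.
move=> eE; set W := 2 * pi / len e0 => sW.
have l0 := len_gt0 eE; have p0 := @pi_gt0 R.
have W0 : 0 < W by rewrite divr_gt0 // mulr_gt0.
have Wl : W * len e0 = pi *+ 2 by rewrite divfK ?gt_eqF // mulr_natl.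
pose f : edge_fun E := fun e x => if e == e0 then trig W 0 1 x else 0.
pose f' : edge_fun E := fun e x => if e == e0 then W * trig W 1 (- 0) x else 0.
have H e : e \in edges E -> ode (len e) (W ^+ 2) (f e) (f' e).
  move=> _; rewrite /f /f'; case: eqP => [_|_]; first exact: ode_trig.
  by move=> x _; rewrite mulr0 oppr0; split; apply: is_derive_has_deriv; exact: is_derive_cst.
have f_end a : f a.1 (end_coord a).2 = 0.
  rewrite /f /end_coord; case: eqP => [->|//]; case: a.2 => /=; last by rewrite trig0.
  by rewrite /trig Wl sin2pi mul0r mulr0 addr0.
have ak : admissible n G D (sample n f).
  by apply: sample_admissible => *; rewrite !f_end.
exists (sample n f); split=> //.
- apply: sample_nz W0 sW _ _ H _.
  have pE : on_edges (e0, len e0 / 4) by rewrite /on_edges /= eE; lra.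
  exists (GPoint G pE); rewrite /feval /= /f eqxx /trig mul0r add0r mul1r.
  have -> : W * (len e0 / 4) = pi / 2 by rewrite mulrA Wl -mulr_natl; lra.
  by rewrite sin_pihalf oner_eq0.
- rewrite (dform_sample _ W0 sW H) big1 ?oppr0 // => a _.
  by rewrite gend_sample f_end mul0r.
have := dform_1 n W (sample n f); rewrite (dform_sample _ W0 sW H).
rewrite sum_endpoints (bigD1 e0) //= big1 => [|e /andP[_ ne]]; last first.
  by rewrite /gend /outflow /f' /= (negbTE ne) !mulr0 addr0.
rewrite /gend /outflow /f' /end_coord /= eqxx /trig Wl sin2pi cos2pi mulr0 cos0 sin0.
rewrite expr0 expr1 !mulr0 !addr0 !mul1r mulr1 mulN1r subrr oppr0 => /eqP.
by rewrite eq_sym oppr_eq0 mulf_eq0 expf_eq0 /= gt_eqF //= => /eqP.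
Qed.

Lemma sqr_sqrt_pos (m : R) : 0 < m -> exists2 w, 0 < w & m = w ^+ 2.
Proof.
by move=> m0; exists (Num.sqrt m); rewrite ?sqrtr_gt0 // sqr_sqrtr // ltW.
Qed.

Lemma lt_sqr_pos (w w' : R) : 0 < w -> 0 < w' -> (w' ^+ 2 < w ^+ 2) = (w' < w).
Proof. by move=> w0 w'0; rewrite ltr_sqr ?nnegrE ?ltW. Qed.

(** The lowest eigenvalue is attained, by a nonnegative eigenfunction: the
    absolute value of a null vector of the form is again a null vector. *)
Theorem ground_state : (exists v, v \in D) ->
  exists w f, [/\ 0 < w, lambda1 G D = w ^+ 2, eigenfunction G D (w ^+ 2) f &
    forall e x, e \in edges E -> 0 <= x <= len e -> 0 <= f e x].
Proof.
move=> D0; have [_ [e0 e0E] _ _] := cG.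
have [n sW] := short_exists E (2 * pi / len e0); set W := 2 * pi / len e0 in sW.
have W0 : 0 <= W by rewrite divr_ge0 ?mulr_ge0 ?pi_ge0 // ltW // len_gt0.
have [g0 [ag0 g0nz qg0 _]] := test_function e0E sW.
have [|w [g [/andP[w0 wW] [ag gnz qg _] minw]]] := first_frequency W0 sW DG (B := false).
  by exists g0.
have sw := short_le wW sW.
have wpos : 0 < w.
  rewrite lt_def w0 andbT; apply/eqP => wz; rewrite wz in qg.
  have cst := dform0_const cG ag qg.
  have [v vD] := D0; have vG := fintype.subsetP DG _ vD; have [a av] := vert_neq0 vG.
  have := vert_endpoint vG av; rewrite endpointsE => aE.
  have [e [i [eE iN]]] := gnz; rewrite (cst e a.1 i (if a.2 then n.+1 else 0%N)) //.
    by have [_ g2] := ag; have := g2 v a vD av; rewrite /gend => ->; rewrite eqxx.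
  by case: a.2.
have psd k : admissible n G D k -> 0 <= dform n w k k.
  move=> ak; rewrite -(@clamp_id R 0 w w); last by rewrite w0 lexx.
  apply: (limit_ge0 (F := fun t => dform n (clamp 0 w t) k k) wpos).
    exact: continuous_dform.
  move=> t /andP[t0 tw].
  rewrite clamp_id ?(ltW t0) ?(ltW tw) //.
  have [knz|knz] := pselect (dnz n k); last by rewrite dform_not_dnz.
  rewrite leNgt; apply/negP => neg; apply: (minw t k); first by rewrite (ltW t0) tw.
  by split=> //; exact: ltW.
pose h e i := `|g e i|.
have ah : admissible n G D h.
  case: ag => g1 g2; split=> [a b ab|v a vD av]; rewrite /gend /h.
    by have := g1 a b ab; rewrite /gend => ->.
  by have := g2 v a vD av; rewrite /gend => ->; rewrite normr0.
have qh : dform n w h h = 0.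
  apply/eqP; rewrite eq_le psd // andbT; apply: le_trans qg.
  exact: dform_abs.
have kh : in_kernel G n D w h.
  split=> // k ak; apply: (form_null (P := admissible n G D)) => // x k' ak'.
  exact: admissible_add.
have [|f [ef fh]] := kernel_eigenfunction DG wpos sw kh.
  by have [e [i [eE iN gi]]] := gnz; exists e, i; split=> //; rewrite /h normr_eq0.
exists w, f; split=> //.
- rewrite /lambda1; apply: min_inf; first by exists f.
  move=> m [f1 ef1]; have m0 := eigenvalue_gt0 DG cG D0 ef1.
  have [w' w'0 mE] := sqr_sqrt_pos m0; rewrite mE in ef1 *.
  rewrite leNgt lt_sqr_pos //; apply/negP => w'w.
  have sw' := short_le (ltW w'w) sw.
  have [[as1 k1] nz1] := eigenfunction_kernel w'0 sw' ef1.
  apply: (minw w' (sample n f1)); first by rewrite (ltW w'0) w'w.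
  by split=> //; rewrite k1.
have [f' H _] := laplacian_ode ef.2.
apply: sample_ge0 wpos sw H _ => e i eE iN.
by rewrite fh // /h.
Qed.

End existence.

Section second.
Variables (R : realType) (E : edge_system R) (G : mgraph E).
Hypothesis (cG : econn G).
Implicit Types (g k : label E -> nat -> R).

Let set0G : finset.set0 \subset verts G. Proof. exact: finset.sub0set. Qed.

Lemma admissible_1 n : admissible n G finset.set0 (fun _ _ => 1).
Proof. by split=> // v a; rewrite finset.inE. Qed.

Lemma dmass_1_gt0 n (w : R) : 0 <= w -> short E n w ->
  0 < dmass n w (fun (_ : label E) (_ : nat) => 1).
Proof.
move=> w0 sw; have [_ [e0 e0E] _ _] := cG.
by apply: dmass_gt0 => //; exists e0, 0%N; rewrite oner_eq0.
Qed.

(** The least frequency at which the form is not positive on the functions of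
    zero mass is the square root of the least positive eigenvalue. *)
Theorem second_frequency n W : 0 <= W -> short E n W ->
  (exists g, [/\ admissible n G finset.set0 g, dnz n g, dform n W g g <= 0 &
                 dmass n W g = 0]) ->
  exists w, [/\ 0 < w <= W,
    exists f, eigenfunction G finset.set0 (w ^+ 2) f,
    forall m f, 0 < m -> eigenfunction G finset.set0 m f -> w ^+ 2 <= m &
    forall g, admissible n G finset.set0 g -> dmass n w g = 0 -> dform n w g g <= 0 ->
      in_kernel G n finset.set0 w g].
Proof.
move=> W0 sW [g0 [ag0 g0nz qg0 bg0]].
have [|w [g [/andP[w0 wW] [ag gnz qg /(_ isT) bg] minw]]] :=
    first_frequency W0 sW set0G (B := true).
  by exists g0.
have sw := short_le wW sW.
have wpos : 0 < w.
  rewrite lt_def w0 andbT; apply/eqP => wz; rewrite wz in qg bg sw.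
  have cst := dform0_const cG ag qg.
  have [e [i [eE iN gi]]] := gnz.
  have := bg; rewrite (@dmass_ext _ _ _ _ _ (fun _ _ => g e i * 1 + 0 * 1)); last first.
    by move=> e' i' e'E i'N; rewrite mulr1 mul0r addr0; exact: cst.
  rewrite (dmass_lin _ _ _ _ (fun _ _ => 1) (fun _ _ => 1)) mul0r addr0 => /eqP.
  by rewrite mulf_eq0 (negbTE gi) /= gt_eqF // dmass_1_gt0.
have psd k : admissible n G finset.set0 k -> dmass n w k = 0 -> 0 <= dform n w k k.
  move=> ak bk.
  pose F t := dform n (clamp 0 w t) k k * dmass n (clamp 0 w t) (fun (_ : label E) (_ : nat) => 1) +
     clamp 0 w t ^+ 2 * dmass n (clamp 0 w t) k ^+ 2.
  suff : 0 <= F w.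
    rewrite /F clamp_id ?w0 ?lexx // bk expr0n /= mulr0 addr0 pmulr_lge0 //.
    exact: dmass_1_gt0.
  apply: limit_ge0 wpos _ _.
    move=> t; apply: cvgD; apply: cvgM.
    - exact: (@continuous_dform _ _ _ _ _ _ w0 sw t).
    - exact: (@continuous_dmass _ _ _ _ _ w0 sw t).
    - by rewrite expr2; apply: (cvgM (@continuous_clamp R w t) (@continuous_clamp R w t)).
    - have cd := @continuous_dmass _ _ _ _ k w0 sw t.
      by rewrite expr2; exact: (cvgM cd cd).
  move=> t /andP[t0 tw]; rewrite /F clamp_id ?(ltW t0) ?(ltW tw) //.
  have st := short_le (ltW tw) sw; have M0 := dmass_1_gt0 (ltW t0) st.
  set M := dmass n t (fun (_ : label E) (_ : nat) => 1) in M0 *.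
  pose c := - (dmass n t k / M).
  pose k' e i := 1 * k e i + c * 1.
  have ak' : admissible n G finset.set0 k'.
    exact: admissible_lin ak (admissible_1 n).
  have bk' : dmass n t k' = 0.
    by rewrite /k' (dmass_lin _ _ _ _ k (fun _ _ => 1)) -/M /c; field; rewrite gt_eqF.
  have : 0 <= dform n t k' k'.
    have [knz|knz] := pselect (dnz n k'); last by rewrite dform_not_dnz.
    rewrite leNgt; apply/negP => neg; apply: (minw t k'); first by rewrite (ltW t0) tw.
    by split=> //; exact: ltW.
  rewrite /k' (dform_quad _ _ _ _ k (fun _ _ => 1)) !dform_1 -/M.
  rewrite -(pmulr_lge0 _ M0); congr (_ <= _); rewrite /c.
  by field; rewrite gt_eqF.
have null h : admissible n G finset.set0 h -> dmass n w h = 0 -> dform n w h h <= 0 ->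
      in_kernel G n finset.set0 w h.
  move=> ah bh qh; split=> // k ak.
  have M0 := dmass_1_gt0 w0 sw; set M := dmass n w (fun (_ : label E) (_ : nat) => 1) in M0.
  pose c := dmass n w k / M.
  have q0 : dform n w h h = 0 by apply/eqP; rewrite eq_le qh psd.
  have := form_null (P := fun k => admissible n G finset.set0 k /\ dmass n w k = 0) _ _ q0.
  move=> /(_ _ _ (fun e i => 1 * k e i + (- c) * 1)) K.
  have : dform n w h (fun e i => 1 * k e i + (- c) * 1) = 0.
    apply: K => [x k1 [ak1 bk1]|k1 [ak1 bk1]|].
    - split; first exact: admissible_add.
      have -> : (fun e i => x * h e i + k1 e i) = (fun e i => x * h e i + 1 * k1 e i).
        by apply/funext => e; apply/funext => i; rewrite mul1r.
      by rewrite dmass_lin bh bk1 !mulr0 addr0.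
    - exact: psd.
    - split; first exact: admissible_lin ak (admissible_1 n).
      by rewrite (dmass_lin _ _ _ _ k (fun _ _ => 1)) -/M /c; field; rewrite gt_eqF.
  rewrite dform_sym (dform_lin _ _ _ _ k (fun _ _ => 1)).
  rewrite (dform_sym _ _ (fun _ _ => 1)) dform_1 bh !mulr0 oppr0 mulr0 addr0 mul1r.
  by rewrite dform_sym.
exists w; split=> //; first by rewrite wpos.
  have [f [ef _]] := kernel_eigenfunction set0G wpos sw (null g ag bg qg) gnz.
  by exists f.
move=> m f m0 ef; have [w' w'0 mE] := sqr_sqrt_pos m0; rewrite mE in ef *.
rewrite leNgt lt_sqr_pos //; apply/negP => w'w.
have sw' := short_le (ltW w'w) sw.
have [[as1 k1] nz1] := eigenfunction_kernel w'0 sw' ef.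
apply: (minw w' (sample n f)); first by rewrite (ltW w'0) w'w.
split=> //; first by rewrite k1.
move=> _; have := dform_1 n w' (sample n f); rewrite k1; last exact: admissible_1.
by move=> /esym/eqP; rewrite oppr_eq0 mulf_eq0 expf_eq0 /= gt_eqF //= => /eqP.
Qed.

End second.

Section mu2.
Variables (R : realType) (E : edge_system R) (G : mgraph E).
Hypothesis (cG : econn G).

Lemma eigenfunction_dmass n w f : 0 < w -> short E n w ->
  eigenfunction G finset.set0 (w ^+ 2) f -> dmass n w (sample n f) = 0.
Proof.
move=> w0 sw ef; have [[_ k1] _] := eigenfunction_kernel w0 sw ef.
have := dform_1 n w (sample n f); rewrite k1; last exact: admissible_1.
by move=> /esym/eqP; rewrite oppr_eq0 mulf_eq0 expf_eq0 /= gt_eqF //= => /eqP.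
Qed.

Lemma eigenfunction_not_const w f c : 0 < w ->
  eigenfunction G finset.set0 (w ^+ 2) f ->
  (forall p : gpoint G, feval f p = c) -> False.
Proof.
move=> w0 ef fc; have [n sw] := short_exists E w.
have [[p fp] _] := ef.
have := eigenfunction_dmass w0 sw ef.
rewrite (@dmass_ext _ _ _ _ _ (fun _ _ => c * 1 + 0 * 1)); last first.
  move=> e i eE iN; rewrite mulr1 mul0r addr0 /sample.
  have pE : on_edges (e, i%:R * mesh n e) by rewrite /on_edges /= eE sample_pt.
  by have := fc (GPoint G pE).
rewrite (dmass_lin _ _ _ _ (fun _ _ => 1) (fun _ _ => 1)) mul0r addr0 => /eqP.
rewrite mulf_eq0 [X in _ || X]gt_eqF; last exact: dmass_1_gt0 cG _ _ (ltW w0) sw.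
by rewrite orbF => /eqP c0; move: fp; rewrite fc c0 eqxx.
Qed.

Lemma eigenfunction_1 : eigenfunction G finset.set0 0 (fun _ _ => 1).
Proof.
have [_ [e eE] _ _] := cG; split.
  by exists (GPoint G (mid_on_edges eE)); rewrite /feval oner_eq0.
exists (fun _ _ => 0); split.
- by move=> e' x _; rewrite mul0r oppr0; split; apply: is_derive_has_deriv; exact: is_derive_cst.
- by [].
- by move=> v a; rewrite finset.inE.
- by move=> v _ _; rewrite big1 // => a _; rewrite mulr0.
Qed.

(** As the eigenfunctions for 0 are constant, the second eigenvalue is the least
    positive one. *)
Theorem mu2_least_positive : exists w, [/\ 0 < w, mu G 2 = w ^+ 2,
  exists f, eigenfunction G finset.set0 (w ^+ 2) f &
  forall m f, 0 < m -> eigenfunction G finset.set0 m f -> w ^+ 2 <= m].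
Proof.
have [_ [e0 e0E] _ _] := cG.
have [n sW] := short_exists E (2 * pi / len e0).
have W0 : 0 <= 2 * pi / len e0 by rewrite divr_ge0 ?mulr_ge0 ?pi_ge0 // ltW // len_gt0.
have [w [/andP[w0 _] [f ef] minw _]] :=
  second_frequency cG W0 sW (test_function G finset.set0 e0E sW).
exists w; split=> //; last by exists f.
apply: min_inf.
  exists (fun i => if i == ord0 then 0 else w ^+ 2).
  exists (fun i => if i == ord0 then (fun _ _ => 1) else f); split.
    move=> i; case: eqP => _; last by split.
    by split; [exact: sqr_ge0 | exact: eigenfunction_1].
  move=> c Hc.
  have {}Hc (p : gpoint G) : c ord0 + c ord_max * feval f p = 0.
    by have := Hc p; rewrite big_ord_recl big_ord1 /= /feval mulr1 => <-; congr (_ + c _ * _);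
      exact: val_inj.
  have c1 : c ord_max = 0.
    apply/eqP; apply: contraT => c1; exfalso.
    apply: (@eigenfunction_not_const w f (- c ord0 / c ord_max)) => // p.
    by have /eqP := Hc p; rewrite addrC addr_eq0 => /eqP <-; field.
  have c0 : c ord0 = 0.
    by have [[p _] _] := ef; have := Hc p; rewrite c1 mul0r addr0.
  case=> [[|[|//]] Hi]; first by rewrite -[RHS]c0; congr c; exact: val_inj.
  by rewrite -[RHS]c1; congr c; exact: val_inj.
move=> m [ms [fs [Hf indep]]]; rewrite leNgt; apply/negP => mw.
have cst i : exists2 c, c != 0 & forall p : gpoint G, feval (fs i) p = c.
  have [msm efi] := Hf i.
  have msi : ms i = 0.
    apply/eqP; rewrite eq_le (eigenvalue_ge0 efi) andbT leNgt; apply/negP => ms0.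
    by have := minw _ _ ms0 efi; rewrite leNgt (le_lt_trans msm mw).
  rewrite msi in efi; have [[p fp] L] := efi.
  exists (feval (fs i) p) => // q; rewrite /feval.
  have pE := ptP p; have qE := ptP q.
  rewrite [pt p]surjective_pairing in pE; rewrite [pt q]surjective_pairing in qE.
  exact: eigenvalue0_const cG L _ _ _ _ qE pE.
have [a a0 Ha] := cst ord0; have [b b0 Hb] := cst ord_max.
have := indep (fun i => if i == ord0 then b else - a) _ ord0.
rewrite eqxx => K; move/eqP: b0; apply; apply: K => p.
rewrite big_ord_recl big_ord1 /= Ha.
have -> : lift ord0 ord0 = ord_max :> 'I_2 by exact: val_inj.
by rewrite Hb; ring.
Qed.

End mu2.

(** * Subdivisions *)

Lemma finite_gap (R : realType) (T : finType) (P : pred T) (F : T -> R) :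
  (forall i, P i -> 0 < F i) -> exists2 eps, 0 < eps & forall i, P i -> eps <= F i.
Proof.
move=> F0; case: (pickP P) => [i0 Pi0|nP].
  exists (F [arg min_(i < i0 | P i) F i]%O); case: arg_minP => // i Pi Hi //.
  exact: F0.
by exists 1 => // i; rewrite nP.
Qed.

Section subdivision.
Variables (R : realType) (E E' : edge_system R) (s : subdivision E E').
Local Notation fine := (label E' * bool)%type.
Local Notation coarse := (label E * bool)%type.

(** An end of a piece is determined by its place on the coarse edge and the side
    of that place on which the piece lies; whether it is the start or the end of
    the piece also depends on the orientation. *)
Definition place (a' : fine) : label E * R := sub_coord s (end_coord a').
Definition right_end (a' : fine) : bool := a'.2 (+) reversed s a'.1.

Lemma placeE (a' : fine) : place a' =
  (parent s a'.1, if right_end a' then offset s a'.1 + len a'.1 else offset s a'.1).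
Proof.
rewrite /place /sub_coord /end_coord /right_end /=.
by case: a' => e' b /=; case: (reversed s e'); case: b => /=; congr pair; ring.
Qed.

Lemma on_edges_sub p : on_edges p -> on_edges (sub_coord s p).
Proof.
move=> /andP[eE /andP[x0 x1]]; have [q1 q2] := offsetP s eE.
by rewrite /on_edges /sub_coord /= parentP //=; case: reversed; lra.
Qed.

Lemma place_inj (a' b' : fine) : a' \in endpoints E' -> b' \in endpoints E' ->
  place a' = place b' -> right_end a' = right_end b' -> a' = b'.
Proof.
rewrite !endpointsE => aE bE; rewrite !placeE => -[pab xab] dab; rewrite dab in xab.
have [e|ne] := eqVneq a'.1 b'.1.
  move: dab; rewrite /right_end e => /addIb; move: e.
  by case: (a') => e1 x; case: (b') => e2 y /= -> ->.
exfalso; have := subdivision_disjoint aE bE pab ne; have := len_gt0 aE; have := len_gt0 bE.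
by move: xab; case: (right_end b') => ? ? ? [|]; lra.
Qed.

(** By finiteness, some piece covers all the points of the edge near [x] on a
    given side. *)
Lemma germ_right (e : label E) (x : R) : e \in edges E -> 0 <= x < len e ->
  exists e', [/\ e' \in edges E', parent s e' = e & offset s e' <= x < offset s e' + len e'].
Proof.
move=> eE /andP[x0 xl].
have [eps e0 He] := @finite_gap R (label E') (fun e' => x < offset s e')
  (fun e' => offset s e' - x) (fun e' H => etrans (subr_gt0 _ _) H).
pose y := x + Num.min eps (len e - x) / 2.
have m0 : 0 < Num.min eps (len e - x) by rewrite lt_min e0 subr_gt0.
have me : Num.min eps (len e - x) <= eps by rewrite ge_min lexx.
have ml : Num.min eps (len e - x) <= len e - x by rewrite ge_min lexx orbT.
have yE : on_edges (e, y) by rewrite /on_edges /= eE /= /y; lra.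
have [e' e'E [pe /andP[/= y1 y2]]] := subdivision_cover s yE.
exists e'; split=> //; apply/andP; split; last by move: y2; rewrite /y; lra.
by rewrite leNgt; apply/negP => /He; move: y1; rewrite /y; lra.
Qed.

Lemma germ_left (e : label E) (x : R) : e \in edges E -> 0 < x <= len e ->
  exists e', [/\ e' \in edges E', parent s e' = e & offset s e' < x <= offset s e' + len e'].
Proof.
move=> eE /andP[x0 xl].
have [eps e0 He] := @finite_gap R (label E') (fun e' => offset s e' + len e' < x)
  (fun e' => x - (offset s e' + len e')) (fun e' H => etrans (subr_gt0 _ _) H).
pose y := x - Num.min eps x / 2.
have m0 : 0 < Num.min eps x by rewrite lt_min e0.
have me : Num.min eps x <= eps by rewrite ge_min lexx.
have ml : Num.min eps x <= x by rewrite ge_min lexx orbT.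
have yE : on_edges (e, y) by rewrite /on_edges /= eE /= /y; lra.
have [e' e'E [pe /andP[/= y1 y2]]] := subdivision_cover s yE.
exists e'; split=> //; apply/andP; split; first by move: y1; rewrite /y; lra.
by rewrite leNgt; apply/negP => /He; move: y2; rewrite /y; lra.
Qed.

Lemma end_of_piece (e' : label E') (d : bool) : e' \in edges E' -> exists a',
  [/\ a' \in endpoints E', a'.1 = e', right_end a' = d &
      place a' = (parent s e', if d then offset s e' + len e' else offset s e')].
Proof.
move=> eE; exists (e', d (+) reversed s e'); rewrite endpointsE; split=> //.
  by rewrite /right_end /= addbK.
by rewrite placeE /right_end /= addbK.
Qed.

(** On the other side of an interior division point lies another piece, which
    has to end there since pieces do not overlap. *)
Lemma partner (a' : fine) : a' \in endpoints E' -> 0 < (place a').2 < len (place a').1 ->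
  exists b', [/\ b' \in endpoints E', place b' = place a' & right_end b' = ~~ right_end a'].
Proof.
rewrite endpointsE => aE; rewrite placeE /= => H.
have pE := parentP s aE; have la := len_gt0 aE.
case: (right_end a') H => /= /andP[x0 xl].
  have [|e'' [eE pe /andP[H1 H2]]] := @germ_right (parent s a'.1)
     (offset s a'.1 + len a'.1) pE; first by rewrite ltW.
  have [b' [bE b1 db pb]] := end_of_piece false eE; exists b'; split=> //.
  rewrite pb pe; congr pair; have [e|ne] := eqVneq e'' a'.1.
    by move: H2; rewrite e ltxx.
  by have := subdivision_disjoint eE aE pe ne => -[|]; lra.
have [|e'' [eE pe /andP[H1 H2]]] := @germ_left (parent s a'.1) (offset s a'.1) pE.
  by rewrite x0 ltW.
have [b' [bE b1 db pb]] := end_of_piece true eE; exists b'; split=> //.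
rewrite pb pe; congr pair; have [e|ne] := eqVneq e'' a'.1.
  by move: H1; rewrite e ltxx.
by have := subdivision_disjoint eE aE pe ne => -[|]; lra.
Qed.

Lemma lift_end (a : coarse) : a \in endpoints E ->
  exists a', [/\ a' \in endpoints E', place a' = end_coord a & right_end a' = a.2].
Proof.
rewrite endpointsE /end_coord; case: a => e [] /= eE; have l0 := len_gt0 eE.
  have [|e' [e'E pe /andP[H1 H2]]] := @germ_left e (len e) eE; first by rewrite l0 lexx.
  have [a' [aE a1 da pa]] := end_of_piece true e'E; exists a'; split=> //.
  rewrite pa pe; congr pair; have [_] := offsetP s e'E; rewrite pe; lra.
have [|e' [e'E pe /andP[H1 H2]]] := @germ_right e 0 eE; first by rewrite l0 lexx.
have [a' [aE a1 da pa]] := end_of_piece false e'E; exists a'; split=> //.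
rewrite pa pe; congr pair; have [] := offsetP s e'E; lra.
Qed.

(** Of interest for the ends of pieces that are not at a division point *)
Definition coarse_end (a' : fine) : label E * bool := (parent s a'.1, right_end a').

Lemma coarse_endE (a : coarse) (a' : fine) : a' \in endpoints E' -> place a' = end_coord a ->
  coarse_end a' = a.
Proof.
rewrite endpointsE placeE /end_coord /coarse_end => aE -[pe x].
have := len_gt0 aE; have [q1 q2] := offsetP s aE.
rewrite pe in q2; move: x; rewrite pe => x; move: x q2.
case: a {pe} => e b /=.
by case: (right_end a'); case: b => //= *; exfalso; lra.
Qed.

Lemma place_on_edges (a' : fine) : a' \in endpoints E' -> on_edges (place a').
Proof. by move=> aE; apply/on_edges_sub/on_edges_end. Qed.

Variables (G : mgraph E) (H : mgraph E').
Hypothesis (sGH : subdivides s G H).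

Lemma same_vertex_place (a' b' : fine) : a' \in endpoints E' -> b' \in endpoints E' ->
  same_vertex H a' b' <-> same_point G (place a') (place b').
Proof. exact: sGH. Qed.

Lemma vertex_image v (a0 : coarse) (a0' : fine) w : v \in verts H -> a0' \in v ->
    place a0' = end_coord a0 ->
  w \in verts G -> a0 \in w ->
  [/\ w = [set coarse_end a' | a' in v]%SET, {in v &, injective coarse_end} &
      {in v, forall a', place a' = end_coord (coarse_end a')}].
Proof.
move=> vH av pa wG aw; have a0'E := vert_endpoint vH av.
have inv a' : a' \in v -> exists2 a, a \in w & place a' = end_coord a.
  move=> a'v; have a'E := vert_endpoint vH a'v.
  have /(same_vertex_place a0'E a'E) := (vertE a' vH av).1 a'v.
  rewrite pa => -[<-|[b [c [bc pb ->]]]]; first by exists a0.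
  exists c => //; apply/(vertE _ wG aw).
  by rewrite (end_coord_inj (vert_endpoint wG aw) pb).
have pos_v a' : a' \in v -> place a' = end_coord (coarse_end a').
  move=> a'v; have [a _ pa'] := inv a' a'v.
  by rewrite (coarse_endE (vert_endpoint vH a'v) pa').
split=> //.
  apply/finset.setP => a; apply/idP/imsetP => [aw'|[a' a'v ->]].
    have [a' [a'E pa' da']] := lift_end (vert_endpoint wG aw').
    exists a'; last by rewrite (coarse_endE a'E pa').
    apply/(vertE _ vH av)/(same_vertex_place a0'E a'E); rewrite pa pa'.
    by right; exists a0, a; split=> //; exists w.
  have [b bw pb] := inv a' a'v.
  by rewrite (coarse_endE (vert_endpoint vH a'v) pb).
move=> a' b' a'v b'v ab; apply: place_inj; rewrite ?(vert_endpoint vH) //.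
  by rewrite !pos_v // ab.
by case: ab.
Qed.

Lemma vertex_interior v (a0' : fine) : v \in verts H -> a0' \in v ->
  0 < (place a0').2 < len (place a0').1 ->
  exists b', [/\ v = [set a0'; b']%SET, a0' != b', place b' = place a0' &
    right_end b' = ~~ right_end a0'].
Proof.
move=> vH av int; have aE := vert_endpoint vH av.
have [b' [bE pb db]] := partner aE int; exists b'; split=> //; last first.
  by apply: contra_eqN db => /eqP <-; case: (right_end a0').
apply/finset.setP => c'; rewrite !finset.inE; apply/idP/idP.
  move=> cv; have cE := vert_endpoint vH cv.
  have /(same_vertex_place aE cE)/(same_point_interior int) pc := (vertE c' vH av).1 cv.
  have [dc|dc] := eqVneq (right_end c') (right_end a0');
    first by rewrite (place_inj cE aE pc dc) eqxx.
  rewrite (@place_inj c' b') ?eqxx ?orbT ?pb // db.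
  by move: dc; case: (right_end c'); case: (right_end a0').
case/orP => /eqP -> //; apply/(vertE _ vH av)/(same_vertex_place aE bE).
by rewrite pb; exact: same_point_refl.
Qed.

(** At a division point the two opposite directions cancel; the other vertices
    correspond to those of the coarse graph, end by end. *)
Lemma sum_vertex v (F : label E * R -> bool -> R) : v \in verts H ->
  (forall p, F p (true) = - F p false) ->
  (forall w, w \in verts G -> \sum_(a in w) F (end_coord a) a.2 = 0) ->
  \sum_(a' in v) F (place a') (right_end a') = 0.
Proof.
move=> vH FN FG; have [a' av] := vert_neq0 vH; have a'E := vert_endpoint vH av.
have [int|[a aE pa]] := on_edges_cases (place_on_edges a'E).
  have [b' [-> ab pb db]] := vertex_interior vH av int.
  rewrite big_setU1 ?finset.inE //= big_set1 pb db.
  by case: (right_end a'); rewrite /= FN ?subrr ?addNr.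
have [w wG [aw _]] := same_vertex_refl G aE.
have [wE inj pv] := vertex_image vH av pa wG aw.
apply: etrans (FG w wG); rewrite wE big_imset //=; apply: eq_bigr => c' cv.
by rewrite pv.
Qed.

Lemma eigenfunction_fine m f : eigenfunction G finset.set0 m f ->
  eigenfunction H finset.set0 m (fun e' y => f (parent s e') (sub_coord s (e', y)).2).
Proof.
case=> -[p fp] [f' [H1 H2 _ H4]].
split.
  have [e' e'E [pe /andP[x0 x1]]] := subdivision_cover s (ptP p).
  pose y := if reversed s e' then offset s e' + len e' - (pt p).2 else (pt p).2 - offset s e'.
  have yE : on_edges (e', y) by rewrite /on_edges /= e'E /y /=; case: ifP => _; lra.
  exists (GPoint H yE); move: fp; rewrite /feval /sub_coord /= pe /y.
  case: (reversed s e'); last by rewrite subrKC.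
  by have -> : offset s e' + len e' - (offset s e' + len e' - (pt p).2) = (pt p).2 by ring.
pose sg e' : R := (-1) ^+ reversed s e'.
pose c e' : R := if reversed s e' then offset s e' + len e' else offset s e'.
have subE e' y : (sub_coord s (e', y)).2 = c e' + sg e' * y.
  by rewrite /sub_coord /c /sg /=; case: reversed; rewrite ?expr0 ?expr1; ring.
have sg1 e' : sg e' = 1 \/ sg e' = -1.
  by rewrite /sg; case: reversed; rewrite ?expr0 ?expr1; [right|left].
have fE e' : (fun y => f (parent s e') (sub_coord s (e', y)).2) =
             (fun y => f (parent s e') (c e' + sg e' * y)).
  by apply/funext => y; rewrite subE.
exists (fun e' y => sg e' * f' (parent s e') (c e' + sg e' * y)).
have into e' y : e' \in edges E' -> 0 <= y <= len e' ->
    on_edges (parent s e', c e' + sg e' * y).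
  move=> e'E yl; have : on_edges (e', y) by rewrite /on_edges /= e'E.
  by move=> /on_edges_sub; rewrite /on_edges /= -subE.
split.
- move=> e' y /andP[/= e'E yl]; have [d1 d2] := H1 _ _ (into e' y e'E yl).
  have sub z : 0 <= z <= len e' -> 0 <= c e' + sg e' * z <= len (parent s e').
    by move=> zl; have /andP[] := into e' z e'E zl.
  split; first by rewrite fE; exact: has_deriv_affine (sg1 e') sub d1.
  have := has_deriv_scale (k := sg e') (has_deriv_affine (sg1 e') sub d2).
  rewrite mulrA; have -> : sg e' * sg e' = 1 by case: (sg1 e') => ->; ring.
  by rewrite mul1r -(subE e' y).
- move=> v a b vH av bv.
  have : same_point G (place a) (place b).
    by apply/(same_vertex_place (vert_endpoint vH av) (vert_endpoint vH bv)); exists v.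
  have fpos (x : label E' * bool) : f (parent s x.1) (sub_coord s (x.1, (end_coord x).2)).2 =
     f (place x).1 (place x).2 by [].
  rewrite !fpos => -[->//|[a1 [b1 [[w wG [a1w b1w]] -> ->]]]].
  exact: H2 wG a1w b1w.
- by move=> v a; rewrite finset.inE.
move=> v vH _.
have FN (q : label E * R) : (-1) ^+ true * f' q.1 q.2 = - ((-1) ^+ false * f' q.1 q.2).
  by rewrite expr0 expr1; ring.
have FG w : w \in verts G ->
    \sum_(a in w) (-1) ^+ a.2 * f' (end_coord a).1 (end_coord a).2 = 0.
  by move=> wG; have := H4 w wG; rewrite finset.inE => /(_ isT).
apply: etrans (@sum_vertex v (fun q d => (-1) ^+ d * f' q.1 q.2) vH FN FG).
apply: eq_bigr => a av; rewrite -subE /right_end mulrA /sg signr_addb.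
by [].
Qed.

End subdivision.

Lemma trig_inj (R : realType) (w a b a1 b1 x : R) :
  trig w a b x = trig w a1 b1 x -> trig w b (- a) x = trig w b1 (- a1) x ->
  a = a1 /\ b = b1.
Proof.
rewrite /trig; have := cos2Dsin2 (w * x).
move: (cos _) (sin _) => c s cs H1 H2.
split; apply/eqP; rewrite -subr_eq0; apply/eqP.
  transitivity ((a - a1) * (c ^+ 2 + s ^+ 2)); first by rewrite cs mulr1.
  transitivity (((a * c + b * s) - (a1 * c + b1 * s)) * c -
     ((b * c + - a * s) - (b1 * c + - a1 * s)) * s); first by ring.
  by rewrite H1 H2 !subrr !mul0r subrr.
transitivity ((b - b1) * (c ^+ 2 + s ^+ 2)); first by rewrite cs mulr1.
transitivity (((a * c + b * s) - (a1 * c + b1 * s)) * s +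
     ((b * c + - a * s) - (b1 * c + - a1 * s)) * c); first by ring.
by rewrite H1 H2 !subrr !mul0r addr0.
Qed.

Lemma trig_affine (R : realType) (w a b c sg : R) : sg = 1 \/ sg = -1 ->
  exists AB : R * R, forall x, trig w a b (sg * (x - c)) = trig w AB.1 AB.2 x /\
    sg * trig w b (- a) (sg * (x - c)) = trig w AB.2 (- AB.1) x.
Proof.
move=> sg1.
exists (a * cos (w * c) - sg * b * sin (w * c), a * sin (w * c) + sg * b * cos (w * c)).
move=> x; have E : w * (sg * (x - c)) = sg * (w * x - w * c) by ring.
have Ec : cos (sg * (w * x - w * c)) = cos (w * x) * cos (w * c) + sin (w * x) * sin (w * c).
  by rewrite -cosB; case: sg1 => ->; rewrite ?mul1r ?mulN1r ?cosN.
have Es : sin (sg * (w * x - w * c)) = sg * (sin (w * x) * cos (w * c) - cos (w * x) * sin (w * c)).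
  by rewrite -sinB; case: sg1 => ->; rewrite ?mul1r ?mulN1r ?sinN.
rewrite /trig /= E Ec Es; split; first by ring.
have s2 : sg * sg = 1 by case: sg1 => ->; ring.
transitivity (sg * b * (cos (w * x) * cos (w * c) + sin (w * x) * sin (w * c)) -
   (sg * sg) * a * (sin (w * x) * cos (w * c) - cos (w * x) * sin (w * c))); first by ring.
by rewrite s2; ring.
Qed.

Section glue.
Variables (R : realType) (E E' : edge_system R) (s : subdivision E E').
Variables (G : mgraph E) (H : mgraph E').
Hypothesis (sGH : subdivides s G H).

(** Moving from a piece of an edge to the previous one, across a vertex of
    degree two, one reaches the first piece of the edge. *)
Lemma pieces_connected (T : eqType) (h : label E' -> T) :
  (forall v a b, v \in verts H -> v = [set a; b]%SET -> a != b -> place s b = place s a ->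
     right_end s b = ~~ right_end s a -> h a.1 = h b.1) ->
  forall e e', e \in edges E' -> e' \in edges E' -> parent s e = parent s e' -> h e = h e'.
Proof.
move=> h_next.
have first e0 e : e0 \in edges E' -> offset s e0 <= 0 -> e \in edges E' ->
    parent s e = parent s e0 -> h e = h e0.
  move=> e0E o0 eE pe; apply/eqP; apply: contraT => ne.
  pose bad e' := [&& e' \in edges E', parent s e' == parent s e0 & h e' != h e0].
  have bad_e : bad e by rewrite /bad eE pe eqxx.
  case: (@Order.TotalTheory.arg_minP _ _ _ e bad (offset s) bad_e).
  move=> e' /and3P[e'E /eqP pe' ne'] mine'.
  have [q1 q2] := offsetP s e'E; have l0 := len_gt0 e'E.
  have offset_gt0 : 0 < offset s e'.
    rewrite lt_def q1 andbT; apply/eqP => oe'.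
    have [ee|nee] := eqVneq e' e0; first by rewrite ee eqxx in ne'.
    have := len_gt0 e0E; have [q3 q4] := offsetP s e0E.
    by have := subdivision_disjoint e'E e0E pe' nee => -[|]; lra.
  have [a [aE a1 da pa]] := end_of_piece s false e'E.
  have int : 0 < (place s a).2 < len (place s a).1.
    by rewrite pa /= offset_gt0 /=; lra.
  have [v vH [av _]] := same_vertex_refl H aE.
  have [b [vE ab pb db]] := vertex_interior sGH vH av int.
  have bE : b.1 \in edges E'.
    by rewrite -endpointsE (vert_endpoint vH) // vE !finset.inE eqxx orbT.
  have hb := h_next v a b vH vE ab pb db; rewrite a1 in hb.
  have /mine' : bad b.1.
    rewrite /bad bE -hb ne' andbT /=; move: pb; rewrite placeE pa => -[-> _].
    by rewrite pe' eqxx.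
  move: pb; rewrite placeE pa db da /= => -[_ <-].
  by rewrite gerDl leNgt len_gt0.
move=> e e' eE e'E pe.
have [|e0 [e0E p0 /andP[q0 _]]] := @germ_right _ _ _ s (parent s e) 0 (parentP s eE).
  by rewrite lexx len_gt0 // parentP.
by rewrite (first e0 e) // (first e0 e') // -pe.
Qed.

(** Two consecutive pieces carry the same trigonometric function, because the
    Kirchhoff condition at their common vertex of degree two matches the
    derivatives; hence an eigenfunction on the pieces is smooth on the coarse
    edges. *)
Lemma eigenfunction_coarse (w : R) g : 0 < w -> eigenfunction H finset.set0 (w ^+ 2) g ->
  exists f, eigenfunction G finset.set0 (w ^+ 2) f.
Proof.
move=> w0 [[p gp] L]; have [g' Hg [H2 _ H4]] := laplacian_ode L.
pose sg e' : R := (-1) ^+ reversed s e'.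
have sg1 e' : sg e' = 1 \/ sg e' = -1.
  by rewrite /sg; case: reversed; rewrite ?expr0 ?expr1; [right|left].
have piece e' : exists AB : R * R, e' \in edges E' -> forall y, 0 <= y <= len e' ->
    g e' y = trig w AB.1 AB.2 (sub_coord s (e', y)).2 /\
    sg e' * g' e' y = w * trig w AB.2 (- AB.1) (sub_coord s (e', y)).2.
  have [eE|_] := boolP (e' \in edges E'); last by exists (0, 0).
  pose c := if reversed s e' then offset s e' + len e' else offset s e'.
  have [AB HAB] := trig_affine w (g e' 0) (g' e' 0 / w) c (sg1 e').
  exists AB => _ y yl; have [T1 T2] := ode_trigP w0 (Hg e' eE) yl.
  have yE : y = sg e' * ((sub_coord s (e', y)).2 - c).
    by rewrite /sub_coord /c /sg /=; case: reversed; rewrite ?expr0 ?expr1; ring.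
  have [K1 K2] := HAB (sub_coord s (e', y)).2; rewrite -yE in K1 K2.
  by rewrite T1 T2 K1 mulrCA K2.
have {piece}[AB piece] := choice piece.
have at_end (a : label E' * bool) : a \in endpoints E' ->
    g a.1 (end_coord a).2 = trig w (AB a.1).1 (AB a.1).2 (place s a).2 /\
    outflow g' a = (-1) ^+ right_end s a * (w * trig w (AB a.1).2 (- (AB a.1).1) (place s a).2).
  move=> aE; have /andP[a1 yl] := on_edges_end aE.
  have [K1 K2] := piece a.1 a1 _ yl; split=> //.
  rewrite -K2 /outflow /right_end signr_addb mulrA -mulrA -/(sg a.1).
  have s2 : sg a.1 * sg a.1 = 1 by case: (sg1 a.1) => ->; ring.
  transitivity ((-1) ^+ a.2 * (sg a.1 * sg a.1) * g' a.1 (end_coord a).2).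
    by rewrite s2 mulr1.
  by rewrite !mulrA.
have AB_next v (a b : label E' * bool) : v \in verts H -> v = [set a; b]%SET -> a != b ->
    place s b = place s a -> right_end s b = ~~ right_end s a -> AB a.1 = AB b.1.
  move=> vH vE ab pb db.
  have av : a \in v by rewrite vE !finset.inE eqxx.
  have bv : b \in v by rewrite vE !finset.inE eqxx orbT.
  have [ga oa] := at_end a (vert_endpoint vH av).
  have [gb ob] := at_end b (vert_endpoint vH bv).
  have := H2 v a b vH av bv; rewrite ga gb pb => E1.
  have := H4 v vH; rewrite finset.inE => /(_ isT).
  rewrite vE big_setU1 ?finset.inE //= big_set1 oa ob pb db signrN mulNr -mulrBr -mulrBr.
  move/eqP; rewrite !mulf_eq0 signr_eq0 gt_eqF //= subr_eq0 => /eqP E2.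
  have [A1 A2] := trig_inj E1 E2.
  by rewrite [AB a.1]surjective_pairing A1 A2 -surjective_pairing.
have same_trig e : exists ab : R * R, e \in edges E ->
    forall e', e' \in edges E' -> parent s e' = e -> AB e' = ab.
  have [eE|_] := boolP (e \in edges E); last by exists (0, 0).
  have [|e0 [e0E p0 _]] := @germ_right _ _ _ s e 0 eE; first by rewrite lexx len_gt0.
  exists (AB e0) => _ e' e'E pe.
  by apply: (pieces_connected AB_next) => //; rewrite pe.
have {same_trig}[ab same_trig] := choice same_trig.
pose f : edge_fun E := fun e x => trig w (ab e).1 (ab e).2 x.
pose f' : edge_fun E := fun e x => w * trig w (ab e).2 (- (ab e).1) x.
have abE e' : e' \in edges E' -> AB e' = ab (parent s e').
  by move=> e'E; rewrite (same_trig (parent s e') (parentP s e'E) e' e'E).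
have f_end (a : label E * bool) (a' : label E' * bool) : a' \in endpoints E' ->
     place s a' = end_coord a -> f a.1 (end_coord a).2 = g a'.1 (end_coord a').2.
  move=> aE pa; rewrite (at_end a' aE).1 abE -?endpointsE //.
  by rewrite -/(f _ _) -[(end_coord a).2]/(snd _) -pa placeE /= -[a.1]/((end_coord a).1) -pa placeE.
exists f; split.
  have pE := on_edges_sub s (ptP p); exists (GPoint G pE).
  have /andP[eE yl] := ptP p; move: gp; rewrite /feval /=.
  rewrite (piece _ eE _ yl).1 abE //.
exists f'; split.
- by move=> e x /andP[_ xl]; exact: (@ode_trig R (len e) w (ab e).1 (ab e).2 x xl).
- move=> v a b vG av bv.
  have [a' [a'E pa _]] := lift_end s (vert_endpoint vG av).
  have [b' [b'E pb _]] := lift_end s (vert_endpoint vG bv).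
  rewrite (f_end a a') // (f_end b b') //.
  have /(same_vertex_place sGH a'E b'E)[u uH [au bu]] : same_point G (place s a') (place s b').
    by rewrite pa pb; right; exists a, b; split=> //; exists v.
  exact: H2 uH au bu.
- by move=> v a; rewrite finset.inE.
move=> w1 w1G _; have [a aw] := vert_neq0 w1G.
have [a' [a'E pa _]] := lift_end s (vert_endpoint w1G aw).
have [v vH [av _]] := same_vertex_refl H a'E.
have [wE inj pv] := vertex_image sGH vH av pa w1G aw.
have H4v := H4 v vH; rewrite finset.inE in H4v; apply: etrans (H4v isT).
rewrite wE big_imset //=; apply: eq_bigr => c cv.
have cE := vert_endpoint vH cv.
by have [_ ->] := at_end c cE; rewrite (pv c cv) abE -?endpointsE.
Qed.

Lemma econn_fine : econn G -> econn H.
Proof.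
move=> [_ [e0 e0E] _ minG].
have [|e1 [e1E p1 _]] := @germ_right _ _ _ s e0 0 e0E; first by rewrite lexx len_gt0.
split=> //; first by exists e1.
  by move=> a b ab _; rewrite -endpointsE; exact: same_vertex_endpoint (same_vertex_sym ab).
move=> T clT [e2 e2E e2T].
have all e' e'' : e' \in edges E' -> e'' \in edges E' -> parent s e' = parent s e'' ->
    (e' \in T) = (e'' \in T).
  move=> e'E e''E; apply: (pieces_connected (h := fun e => e \in T)) => //.
  move=> v a b vH vE _ _ _.
  have ab : same_vertex H a b by exists v; rewrite // vE !finset.inE !eqxx orbT.
  by apply/idP/idP; [exact: clT | exact/clT/same_vertex_sym].
pose T' := [set e in edges E | [exists e', [&& e' \in edges E', parent s e' == e & e' \in T]]]%SET.
have clT' : eclosed G T'.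
  move=> a b ab; rewrite !finset.inE => /andP[aE /existsP[e' /and3P[e'E /eqP pe e'T]]].
  have aE' := same_vertex_endpoint ab; have bE' := same_vertex_endpoint (same_vertex_sym ab).
  rewrite -endpointsE bE' /=.
  have [a' [a'E pa _]] := lift_end s aE'; have [b' [b'E pb _]] := lift_end s bE'.
  have sab : same_vertex H a' b'.
    by apply/(same_vertex_place sGH a'E b'E); rewrite pa pb; right; exists a, b.
  have pa1 : parent s a'.1 = a.1 by move: pa; rewrite placeE => -[].
  have pb1 : parent s b'.1 = b.1 by move: pb; rewrite placeE => -[].
  have a'1 : a'.1 \in edges E' by rewrite -endpointsE.
  apply/existsP; exists b'.1; rewrite -endpointsE b'E pb1 eqxx /=.
  by apply: (clT a' b' sab); rewrite (all _ e') ?pa1.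
have sub : edges E \subset T'.
  apply: minG => //; exists (parent s e2); first exact: parentP.
  by rewrite finset.inE parentP //=; apply/existsP; exists e2; rewrite e2E eqxx.
apply/fintype.subsetP => e' e'E.
have := fintype.subsetP sub _ (parentP s e'E); rewrite finset.inE => /andP[_ /existsP].
move=> [e'' /and3P[e''E /eqP pe e''T]].
by rewrite (all _ e'').
Qed.

Lemma econn_coarse : econn H -> econn G.
Proof.
move=> [_ [e0 e0E] _ minH].
split=> //; first by exists (parent s e0); exact: parentP.
  by move=> a b ab _; rewrite -endpointsE; exact: same_vertex_endpoint (same_vertex_sym ab).
move=> T clT [e2 e2E e2T].
pose T' := [set e' in edges E' | parent s e' \in T]%SET.
have clT' : eclosed H T'.
  move=> a b ab; rewrite !finset.inE => /andP[aE aT].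
  have aE' := same_vertex_endpoint ab; have bE' := same_vertex_endpoint (same_vertex_sym ab).
  rewrite -endpointsE bE' /=; have /(same_vertex_place sGH aE' bE') := ab.
  case=> [|[a1 [b1 [ab1 pa pb]]]].
    by rewrite !placeE => -[<- _].
  have -> : parent s b.1 = b1.1 by move: pb; rewrite placeE => -[].
  apply: (clT _ _ ab1).
  by have <- : parent s a.1 = a1.1 by move: pa; rewrite placeE => -[].
have piece e : e \in edges E -> exists2 e', e' \in edges E' & parent s e' = e.
  move=> eE; have [|e' [e'E pe _]] := @germ_right _ _ _ s e 0 eE; first by rewrite lexx len_gt0.
  by exists e'.
have [e3 e3E p3] := piece e2 e2E.
have sub : edges E' \subset T'.
  by apply: minH => //; exists e3 => //; rewrite finset.inE e3E p3.
apply/fintype.subsetP => e eE; have [e' e'E pe] := piece e eE.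
by have := fintype.subsetP sub _ e'E; rewrite finset.inE pe => /andP[].
Qed.

End glue.

(** * Clusters, Dirichlet vertices and energies *)

Section cluster_graphs.
Variables (R : realType) (E : edge_system R) (C : mgraph E) (S : {set label E}).

Lemma cluster_endpoint (a : label E * bool) :
  (a \in endpoints (sub_edges S)) = (a \in endpoints E) && (a.1 \in S).
Proof. by rewrite !finset.inE. Qed.

Lemma cluster_same_vertex (a b : label E * bool) :
  same_vertex (cluster_graph C S) a b <-> [/\ same_vertex C a b, a.1 \in S & b.1 \in S].
Proof.
split.
  case=> w /finset.setD1P[_ /imsetP[v vC ->]] [] /finset.setIP[av aS] /finset.setIP[bv bS].
  move: aS bS; rewrite !cluster_endpoint => /andP[_ aS] /andP[_ bS].
  by split=> //; exists v.
case=> -[v vC [av bv]] aS bS; exists (v :&: endpoints (sub_edges S))%SET.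
  apply/finset.setD1P; split; last exact: imset_f.
  apply/finset.set0Pn; exists a; apply/finset.setIP; split=> //.
  by rewrite cluster_endpoint aS (vert_endpoint vC av).
by split; apply/finset.setIP; split=> //; rewrite cluster_endpoint ?aS ?bS (vert_endpoint vC).
Qed.

Hypothesis (SE : S \subset edges E).

Lemma cluster_edges : edges (sub_edges S) = S.
Proof. exact/finset.setIidPr. Qed.

Hypothesis (clS : eclosed C S).

Lemma cluster_vert (w : {set label E * bool}) :
  w \in verts (cluster_graph C S) -> w \in verts C.
Proof.
case/finset.setD1P => /finset.set0Pn[a aw] /imsetP[v vC wE].
suff -> : w = v by [].
rewrite wE; apply/finset.setIidPl/fintype.subsetP => b bv.
rewrite cluster_endpoint (vert_endpoint vC bv) /=.
move: aw; rewrite wE => /finset.setIP[av]; rewrite cluster_endpoint => /andP[_ aS].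
by apply: clS aS; exists v.
Qed.

Lemma econn_cluster : ecomp C S -> econn (cluster_graph C S).
Proof.
move=> [_ S0 _ minS]; rewrite /econn cluster_edges; split=> //.
- by rewrite cluster_edges.
- by move=> a b /cluster_same_vertex[].
move=> T clT [e eS eT].
have clT' : eclosed C (T :&: S)%SET.
  move=> a b ab /finset.setIP[aT aS]; apply/finset.setIP.
  have bS := clS ab aS; split=> //.
  by apply: (clT a b) => //; apply/cluster_same_vertex.
have /fintype.subsetP H : S \subset (T :&: S)%SET.
  by apply: minS => //; exists e => //; apply/finset.setIP.
by apply/fintype.subsetP => e' /H /finset.setIP[].
Qed.

End cluster_graphs.

Section partitions.
Variables (R : realType) (E : edge_system R) (P : gpartition E).
Hypothesis (cutP : is_cut (base P) (pcut P)).

Definition cut_end (a : label E * bool) : Prop :=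
  exists2 b, same_vertex (base P) a b & ~ same_vertex (pcut P) a b.

Lemma cut_end_nontrivial v a : v \in verts (base P) -> a \in v ->
  cut_nontrivially (base P) (pcut P) v <-> cut_end a.
Proof.
move=> vB av; rewrite (cut_nontriviallyP cutP vB); split; last first.
  by move=> [b ab nab]; exists a, b; split=> //; apply/(vertE _ vB av).
move=> [b [c [bv cv nbc]]].
have [ab|ab] := pselect (same_vertex (pcut P) a b); last by exists b => //; apply/(vertE _ vB av).
exists c; first by apply/(vertE _ vB av).
by move=> ac; apply: nbc; exact: same_vertex_trans (same_vertex_sym ab) ac.
Qed.

Lemma dirichlet_vertsP (S : {set label E}) (w : {set label E * bool}) a : S \subset edges E ->
    eclosed (pcut P) S ->
  w \in verts (cluster_graph (pcut P) S) -> a \in w ->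
  w \in dirichlet_verts P S <-> cut_end a.
Proof.
move=> SE clS wC aw; rewrite finset.inE wC /=.
have wC' := cluster_vert clS wC.
have [v vB /fintype.subsetP wv] := cutP wC'.
rewrite -(cut_end_nontrivial vB (wv a aw)); split.
  case/existsP => v' /andP[ct /fintype.subsetP wv'].
  have v'B : v' \in verts (base P) by case/andP: ct.
  by rewrite (vert_uniq vB v'B (wv a aw) (wv' a aw)).
by move=> ct; apply/existsP; exists v; rewrite ct; apply/fintype.subsetP.
Qed.

Lemma dirichlet_verts_sub S : dirichlet_verts P S \subset verts (cluster_graph (pcut P) S).
Proof. by apply/fintype.subsetP => w; rewrite finset.inE => /andP[]. Qed.

Lemma uncut_vert w a : w \in verts (pcut P) -> a \in w -> ~ cut_end a -> w \in verts (base P).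
Proof.
move=> wC aw nc; have [v vB /fintype.subsetP wv] := cutP wC.
suff -> : w = v by [].
apply/finset.setP => b; apply/idP/idP => [/wv //|bv].
apply/(vertE _ wC aw); apply: contrapT => nab; apply: nc; exists b => //.
by apply/(vertE _ vB (wv a aw)).
Qed.

Lemma cluster_energy_le_energy S : S \in clusters P -> cluster_energy P S <= energy P.
Proof.
move=> SP; apply: ub_le_sup; last by exists S.
exists (\sum_(T in clusters P) `|cluster_energy P T|) => _ [T TP ->].
rewrite (bigD1 T) //=; apply: le_trans (ler_norm _) _.
by rewrite lerDl sumr_ge0.
Qed.

Lemma energy_attained : (exists S, S \in clusters P) ->
  exists2 S, S \in clusters P & energy P = cluster_energy P S.
Proof.
move=> [S0 S0P]; case: (@Order.TotalTheory.arg_maxP _ _ _ S0 (fun S =>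
    S \in clusters P) (cluster_energy P) S0P).
move=> S SP maxS; exists S => //; apply/eqP; rewrite eq_le cluster_energy_le_energy // andbT.
apply: ge_sup; first by exists (cluster_energy P S), S.
by move=> _ [T TP ->]; exact: maxS.
Qed.

End partitions.

(** * The second eigenvalue bounds the energy *)

Lemma ode_scale (R : realType) (l m c : R) (f f' : R -> R) :
  ode l m f f' -> ode l m (fun x => c * f x) (fun x => c * f' x).
Proof.
move=> H x xl; have [d1 d2] := H x xl; split; first exact: has_deriv_scale.
by have := has_deriv_scale (k := c) d2; congr has_deriv; ring.
Qed.

Section clusters.
Variables (R : realType) (E : edge_system R) (P : gpartition E).
Hypotheses (cutP : is_cut (base P) (pcut P)) (cB : econn (base P)).
Local Notation B := (base P).
Local Notation C := (pcut P).

(** Otherwise no edge outside the cluster would meet it, and the graph would not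
    be connected. *)
Lemma dirichlet_verts_nonempty S : ecomp C S -> (exists2 e, e \in edges E & e \notin S) ->
  exists v, v \in dirichlet_verts P S.
Proof.
move=> [SE [e eS] clS _] [e' e'E e'S]; apply: contrapT => nov.
have [_ _ _ minE] := cB.
suff /minE H : eclosed B S.
  have /fintype.subsetP K : edges E \subset S.
    by apply: H; exists e => //; exact: fintype.subsetP SE _ eS.
  by rewrite K in e'S.
move=> a b ab aS; apply: contraT => bS; exfalso; apply: nov.
have aE := same_vertex_endpoint ab.
have [w wC [aw _]] : same_vertex (cluster_graph C S) a a.
  by apply/cluster_same_vertex; split=> //; exact: same_vertex_refl.
exists w; apply/(dirichlet_vertsP cutP SE clS wC aw); exists b => //.
by move=> abC; move: bS; rewrite (clS a b abC aS).
Qed.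

Section extension.
Variables (S : {set label E}) (n : nat) (w w1 : R) (psi : edge_fun E).
Hypotheses (ecS : ecomp C S) (w10 : 0 < w1) (w1w : w1 <= w) (sw : short E n w).
Hypothesis psi_eig : eigenfunction (cluster_graph C S) (dirichlet_verts P S) (w1 ^+ 2) psi.
Hypothesis psi_ge0 : forall e x, e \in S -> 0 <= x <= len e -> 0 <= psi e x.

(** A function on the whole graph, as [psi] vanishes at the vertices where the
    cluster was cut off; beyond the last node the value is set to zero to keep
    the function nonnegative. *)
Definition extension (e : label E) (i : nat) : R :=
  if (e \in S) && (i <= n.+1)%N then sample n psi e i else 0.

Let SE : S \subset edges E. Proof. by case: ecS. Qed.
Let clS : eclosed C S. Proof. by case: ecS. Qed.

Lemma extension_ge0 e i : 0 <= extension e i.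
Proof.
rewrite /extension; case: ifP => // /andP[eS iN]; apply: psi_ge0 => //.
exact: sample_pt (fintype.subsetP SE _ eS) iN.
Qed.

Lemma psi_cut_end (a : label E * bool) : a.1 \in S -> a \in endpoints E -> cut_end P a ->
  psi a.1 (end_coord a).2 = 0.
Proof.
move=> aS aE ca.
have [v vC [av _]] : same_vertex (cluster_graph C S) a a.
  by apply/cluster_same_vertex; split=> //; exact: same_vertex_refl.
have vD := (dirichlet_vertsP cutP SE clS vC av).2 ca.
by have [_ [f' [_ _ H3 _]]] := psi_eig; exact: H3 vD av.
Qed.

Lemma psi_same_vertex (a b : label E * bool) : a.1 \in S -> same_vertex C a b ->
  psi a.1 (end_coord a).2 = psi b.1 (end_coord b).2.
Proof.
move=> aS ab; have [_ [f' [_ H2 _ _]]] := psi_eig.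
have [v vC [av bv]] : same_vertex (cluster_graph C S) a b.
  by apply/cluster_same_vertex; split=> //; exact: clS ab aS.
exact: H2 vC av bv.
Qed.

Lemma gend_extension (a : label E * bool) :
  gend n extension a = if a.1 \in S then psi a.1 (end_coord a).2 else 0.
Proof.
rewrite /gend /extension; case: ifP => [/andP[-> _]|].
  exact: gend_sample.
by case: (a.1 \in S) => //; case: a.2; rewrite ?leqnn.
Qed.

Lemma extension_admissible : admissible n B finset.set0 extension.
Proof.
split=> [a b ab|v a]; last by rewrite finset.inE.
rewrite !gend_extension.
have aE := same_vertex_endpoint ab.
have bE := same_vertex_endpoint (same_vertex_sym ab).
have [abC|nab] := pselect (same_vertex C a b).
  case: (boolP (a.1 \in S)) => aS; first by rewrite (clS abC aS) (psi_same_vertex aS abC).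
  case: (boolP (b.1 \in S)) => // bS.
  by rewrite (clS (same_vertex_sym abC) bS) in aS.
have ca : cut_end P a by exists b.
have cb : cut_end P b.
  by exists a; [exact: same_vertex_sym | move=> /same_vertex_sym].
case: (boolP (a.1 \in S)) => aS; case: (boolP (b.1 \in S)) => bS //;
  by rewrite ?(psi_cut_end aS aE ca) ?(psi_cut_end bS bE cb).
Qed.

Let short_cluster w' : w' <= w -> short (sub_edges S) n w'.
Proof.
move=> w'w e; rewrite /= finset.inE => /andP[eE _].
exact: (short_le w'w sw eE).
Qed.

Lemma extension_form_w1 : dform n w1 extension extension = 0.
Proof.
have s1 := short_cluster w1w.
have [[ak k0] _] := eigenfunction_kernel w10 s1 psi_eig.
apply: etrans (k0 _ ak).
rewrite /dform (bigID (fun e => e \in S)) /= [X in _ + X]big1 ?addr0 => [|e /andP[_ eS]].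
  apply: eq_big => [e|e /andP[_ eS]]; first by rewrite finset.inE.
  apply: eq_bigr => i _; have iN : (i <= n.+1)%N by rewrite ltnW // ltnS.
  by rewrite /extension eS iN (ltn_ord i).
by rewrite big1 // => i _; rewrite /extension (negbTE eS) /pform /=; ring.
Qed.

Lemma extension_dnz : dnz n extension.
Proof.
have s1 := short_cluster w1w.
have [_ [e [i [eE iN gi]]]] := eigenfunction_kernel w10 s1 psi_eig.
move: eE; rewrite /= finset.inE => /andP[eE eS].
by exists e, i; split=> //; rewrite /extension eS iN.
Qed.

(** The form vanishes at the frequency of the ground state and decreases
    strictly from there. *)
Lemma extension_form_le0 : dform n w extension extension <= 0 /\
  (dform n w extension extension = 0 -> w1 = w).
Proof.
have [e|ne] := eqVneq w1 w; last first.
  have w1w' : w1 < w by rewrite lt_neqAle ne.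
  have := dform_decr w10 w1w' sw extension_ge0 extension_dnz.
  by rewrite extension_form_w1 => neg; split; [exact: ltW | move=> z; rewrite z ltxx in neg].
by have := extension_form_w1; rewrite e => ->.
Qed.

End extension.

Hypotheses (exP : exhaustive P) (clP : forall S, S \in clusters P -> is_cluster C S)
  (cardP : #|clusters P| = 2).

Lemma two_clusters : exists S1 S2, [/\ clusters P = [set S1; S2]%SET, S1 != S2,
  ecomp C S1, ecomp C S2 & forall e, e \in edges E -> (e \in S2) = (e \notin S1)].
Proof.
have /eqP/cards2P [S1 [S2 [S12 PE]]] := cardP.
have ec1 : ecomp C S1 by apply/is_clusterP/clP; rewrite PE !finset.inE eqxx.
have ec2 : ecomp C S2 by apply/is_clusterP/clP; rewrite PE !finset.inE eqxx orbT.
exists S1, S2; split=> // e eE.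
have [T ecT eT] := ecomp_exists C eE.
have : T \in clusters P by apply/exP/is_clusterP.
rewrite PE !finset.inE => /orP[] /eqP TE; rewrite TE in eT; rewrite eT ?orbT //.
  by apply/negP => e2; move: S12; rewrite (ecomp_eq ec1 ec2 eT e2) eqxx.
by apply/esym/negP => e1; move: S12; rewrite (ecomp_eq ec1 ec2 e1 eT) eqxx.
Qed.

(** The combination of zero mass of the two ground states has a nonpositive
    form at the larger of the two frequencies, which bounds the second
    eigenvalue; when the bound is attained, the combination is in the kernel of
    the form, so that both energies are equal and it is an eigenfunction. *)
Theorem two_partition_energy : mu B 2 <= energy P /\
  (energy P = mu B 2 -> exists (S1 S2 : {set label E}) (psi : {set label E} -> edge_fun E)
     (F : edge_fun E) (c : {set label E} -> R) (w : R),
   [/\ [/\ clusters P = [set S1; S2]%SET, S1 != S2, 0 < c S1, c S2 < 0 & 0 < w],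
       forall S, S \in clusters P ->
         eigenfunction (cluster_graph C S) (dirichlet_verts P S) (w ^+ 2) (psi S) /\
         cluster_energy P S = w ^+ 2,
       forall S e x, S \in clusters P -> e \in S -> 0 <= x <= len e -> 0 <= psi S e x,
       forall S e x, S \in clusters P -> e \in S -> F e x = c S * psi S e x &
       eigenfunction B finset.set0 (w ^+ 2) F]).
Proof.
have [S1 [S2 [PE S12 ec1 ec2 S2E]]] := two_clusters.
have [SE1 [e1 e1S] cl1 _] := ec1; have [SE2 [e2 e2S] cl2 _] := ec2.
have e1E := fintype.subsetP SE1 _ e1S; have e2E := fintype.subsetP SE2 _ e2S.
have ground S : ecomp C S -> (exists2 e, e \in edges E & e \notin S) ->
    exists w psi, [/\ 0 < w, cluster_energy P S = w ^+ 2,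
      eigenfunction (cluster_graph C S) (dirichlet_verts P S) (w ^+ 2) psi &
      forall e x, e \in S -> 0 <= x <= len e -> 0 <= psi e x].
  move=> ecS co; have [SE _ clS _] := ecS.
  have := ground_state (econn_cluster SE clS ecS) (dirichlet_verts_sub P S)
     (dirichlet_verts_nonempty ecS co).
  by move=> [w [psi [w0 wE ef psi0]]]; exists w, psi; split=> // e x eS;
    apply: psi0; rewrite cluster_edges.
have co1 : exists2 e, e \in edges E & e \notin S1 by exists e2; rewrite // -S2E.
have co2 : exists2 e, e \in edges E & e \notin S2.
  by exists e1 => //; rewrite S2E // negbK.
have [w1 [psi1 [w10 E1 ef1 ge1]]] := ground S1 ec1 co1.
have [w2 [psi2 [w20 E2 ef2 ge2]]] := ground S2 ec2 co2.
have [w [w0 EP w1w w2w]] : exists w, [/\ 0 < w, energy P = w ^+ 2, w1 <= w & w2 <= w].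
  have S1P : S1 \in clusters P by rewrite PE !finset.inE eqxx.
  have S2P : S2 \in clusters P by rewrite PE !finset.inE eqxx orbT.
  have le1 := cluster_energy_le_energy S1P; have le2 := cluster_energy_le_energy S2P.
  have [|S SP ES] := @energy_attained _ _ P; first by exists S1.
  exists (Num.sqrt (energy P)).
  have ep : 0 < energy P by apply: lt_le_trans le1; rewrite E1 exprn_gt0.
  rewrite sqrtr_gt0 ep sqr_sqrtr ?(ltW ep) //; split=> //.
    by rewrite -(@ler_pXn2r _ 2) ?nnegrE ?sqrtr_ge0 ?(ltW w10) // sqr_sqrtr ?(ltW ep) // -E1.
  by rewrite -(@ler_pXn2r _ 2) ?nnegrE ?sqrtr_ge0 ?(ltW w20) // sqr_sqrtr ?(ltW ep) // -E2.
have [n sw] := short_exists E w.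
set g1 := extension S1 n psi1; set g2 := extension S2 n psi2.
have nz1 : dnz n g1 := extension_dnz w10 w1w sw ef1.
have nz2 : dnz n g2 := extension_dnz w20 w2w sw ef2.
have b1 : 0 < dmass n w g1.
  by apply: dmass_gt0 nz1 => //; [exact: ltW | exact: (extension_ge0 n ec1 ge1)].
have b2 : 0 < dmass n w g2.
  by apply: dmass_gt0 nz2 => //; [exact: ltW | exact: (extension_ge0 n ec2 ge2)].
have [q1 q1w] := extension_form_le0 ec1 w10 w1w sw ef1 ge1.
have [q2 q2w] := extension_form_le0 ec2 w20 w2w sw ef2 ge2.
have a1 := extension_admissible n ec1 ef1; have a2 := extension_admissible n ec2 ef2.
rewrite -/g1 -/g2 in q1 q2 q1w q2w a1 a2.
set x := dmass n w g2 in b2; set y := dmass n w g1 in b1.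
pose g e i := x * g1 e i + (- y) * g2 e i.
have ag : admissible n B finset.set0 g by exact: admissible_lin.
have bg : dmass n w g = 0 by rewrite /g dmass_lin -/x -/y; ring.
have q12 : dform n w g1 g2 = 0.
  rewrite /dform big1 // => e eE; rewrite big1 // => i _.
  rewrite /pform /g1 /g2 /extension S2E //.
  by case: (e \in S1) => /=; ring.
have qgE : dform n w g g = x ^+ 2 * dform n w g1 g1 + y ^+ 2 * dform n w g2 g2.
  by rewrite dform_quad q12; ring.
have x2 : 0 < x ^+ 2 by rewrite exprn_gt0.
have y2 : 0 < y ^+ 2 by rewrite exprn_gt0.
have qg : dform n w g g <= 0 by rewrite qgE; nra.
have gnz : dnz n g.
  have [e [i [eE iN gi]]] := nz1; exists e, i; split=> //.
  move: gi; rewrite /g /g1 /g2 /extension S2E //.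
  case: (e \in S1) => /=; last by rewrite eqxx.
  by rewrite mulr0 addr0 => gi; rewrite mulf_neq0 // gt_eqF.
have [|ws [/andP[ws0 wsw] [fs efs] _ kers]] := second_frequency cB (ltW w0) sw.
  by exists g.
have [wm [wm0 muE [fm efm] minm]] := mu2_least_positive cB.
have wms : wm ^+ 2 <= ws ^+ 2 by apply: minm efs; rewrite exprn_gt0.
have wsw2 : ws ^+ 2 <= w ^+ 2 by rewrite ler_sqr ?nnegrE ?(ltW ws0) ?(ltW w0).
rewrite muE EP; split; first exact: le_trans wms wsw2.
move=> wwm.
have wsE : ws = w.
  apply/eqP; rewrite eq_le wsw /=; rewrite -(@ler_pXn2r _ 2) ?nnegrE ?(ltW ws0) ?(ltW w0) //.
  by rewrite wwm.
rewrite {}wsE in kers; have [_ ker] := kers g ag bg qg.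
have qg0 := ker g ag; rewrite qgE in qg0.
have w1E : w1 = w by apply: q1w; nra.
have w2E : w2 = w by apply: q2w; nra.
rewrite {}w1E in E1 ef1 w10 w1w nz1; rewrite {}w2E in E2 ef2 w20 w2w nz2.
pose psi S := if S == S1 then psi1 else psi2.
pose c S := if S == S1 then x else - y.
have S21 : (S2 == S1) = false by rewrite eq_sym (negbTE S12).
pose F : edge_fun E := fun e t => if e \in S1 then x * psi1 e t else - y * psi2 e t.
exists S1, S2, psi, F, c, w.
have [f1' H1 _] := laplacian_ode ef1.2; have [f2' H2 _] := laplacian_ode ef2.2.
rewrite cluster_edges // in H1; rewrite cluster_edges // in H2.
pose F' : edge_fun E := fun e t => if e \in S1 then x * f1' e t else - y * f2' e t.
have HF e : e \in edges E -> ode (len e) (w ^+ 2) (F e) (F' e).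
  move=> eE; rewrite /F /F'; have [eS|eS] := boolP (e \in S1).
    by apply: ode_scale; exact: H1.
  by apply: ode_scale; apply: H2; rewrite S2E.
have Fg e i : e \in edges E -> (i <= n.+1)%N -> sample n F e i = g e i.
  move=> eE iN; rewrite /g /g1 /g2 /extension /sample /F S2E // iN !andbT.
  by case: (e \in S1) => /=; rewrite mulr0 ?addr0 ?add0r.
have kerF k : admissible n B finset.set0 k -> dform n w (sample n F) k = 0.
  by move=> ak; rewrite (@dform_ext _ _ n w _ g _ k) // ker.
have Fend (a : label E * bool) : a \in endpoints E -> F a.1 (end_coord a).2 = gend n g a.
  rewrite endpointsE => aE; rewrite -(gend_sample n) /gend Fg //.
  by case: a.2.
split=> //.
- split=> //; first by rewrite /c eqxx.
  by rewrite /c S21 oppr_lt0.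
- move=> S; rewrite PE !finset.inE /psi => /orP[] /eqP ->; rewrite ?eqxx ?S21; split=> //.
- move=> S e t; rewrite PE !finset.inE /psi => /orP[] /eqP ->; rewrite ?eqxx ?S21.
    exact: ge1.
  exact: ge2.
- move=> S e t; rewrite PE !finset.inE /psi /c /F => /orP[] /eqP ->; rewrite ?eqxx ?S21.
    by move=> ->.
  move=> eS; have eE := fintype.subsetP SE2 _ eS.
  by move: eS; rewrite S2E // => /negbTE ->.
split.
  have [e [i [eE iN gi]]] := gnz.
  have pE : on_edges (e, i%:R * mesh n e) by rewrite /on_edges /= eE sample_pt.
  by exists (GPoint B pE); rewrite /feval /=; move: gi; rewrite -Fg.
exists F'; split.
- by move=> e t /andP[/= eE tl]; exact: HF.
- move=> v a b vB av bv; rewrite !Fend ?(vert_endpoint vB) //.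
  by case: ag => H _; apply: H; exists v.
- by move=> v a; rewrite finset.inE.
move=> v vB _; apply: kirchhoff_of_kernel w0 sw _ _ _ HF kerF _ vB _.
  exact: finset.sub0set.
by rewrite finset.inE.
Qed.

End clusters.

(** * Signs of solutions and nodal domains *)

Section signed_solutions.
Variables (R : realType) (l w : R) (f f' : R -> R).
Hypotheses (l0 : 0 < l) (w0 : 0 < w) (H : ode l (w ^+ 2) f f').
Hypothesis f_ge0 : forall x, 0 <= x <= l -> 0 <= f x.

Let ex_delta (m : R) : 0 < m -> exists d, [/\ 0 < d, d <= m & 0 < sin (w * d)].
Proof.
move=> m0; pose d := Num.min m (1 / w).
have w1 : 0 < 1 / w by rewrite divr_gt0.
exists d; split; [by rewrite lt_min m0 w1 | by rewrite ge_min lexx|].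
have d0 : 0 < d by rewrite lt_min m0 w1.
apply: sin_gt0_pi; rewrite mulr_gt0 //=.
apply: (@le_lt_trans _ _ 1); last by apply: lt_le_trans (@pi_ge2 R); rewrite ltr1n.
have : d <= 1 / w by rewrite ge_min lexx orbT.
by rewrite ler_pdivlMr // mulrC.
Qed.

Let expand x y : 0 <= x <= l -> 0 <= y <= l ->
  f y = f x * cos (w * (y - x)) + f' x / w * sin (w * (y - x)).
Proof.
move=> xl yl; have [-> _] := ode_trigP w0 H yl; have [-> ->] := ode_trigP w0 H xl.
rewrite -{1}(subrKC x y) trigD; congr (_ + _); congr (_ * _).
by field; rewrite gt_eqF.
Qed.

Lemma sol_zero x : 0 <= x <= l -> f x = 0 -> f' x = 0 -> forall y, 0 <= y <= l -> f y = 0.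
Proof. by move=> xl fx f'x y yl; rewrite (expand xl yl) fx f'x !mul0r addr0. Qed.

(** An interior zero of a nonnegative solution is a minimum, so that the
    derivative vanishes there too. *)
Lemma sol_interior_zero x : 0 < x < l -> f x = 0 -> forall y, 0 <= y <= l -> f y = 0.
Proof.
move=> /andP[x0 xl] fx; have xl' : 0 <= x <= l by rewrite !ltW.
apply: (sol_zero xl' fx).
have [|d [d0 dm sd]] := @ex_delta (Num.min x (l - x)); first by rewrite lt_min x0 subr_gt0.
move: dm; rewrite le_min => /andP[dx dl].
have y1 : 0 <= x + d <= l by lra.
have y2 : 0 <= x - d <= l by lra.
have := f_ge0 y1; have := f_ge0 y2; rewrite (expand xl' y1) (expand xl' y2) fx !mul0r !add0r.
have -> : x - d - x = - d by ring.
have -> : x + d - x = d by ring.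
rewrite mulrN sinN mulrN oppr_ge0 => A1 A2.
have : f' x / w * sin (w * d) = 0 by apply/eqP; rewrite eq_le A1 A2.
move/eqP; rewrite mulf_eq0 (gt_eqF sd) orbF mulf_eq0 invr_eq0 (gt_eqF w0) orbF.
by move/eqP.
Qed.

Lemma sol_left_slope : f 0 = 0 -> 0 <= f' 0.
Proof.
move=> f0; have [d [d0 dm sd]] := ex_delta l0.
have x0 : 0 <= (0 : R) <= l by lra.
have yl : 0 <= d <= l by lra.
have := f_ge0 yl; rewrite (expand x0 yl) f0 mul0r add0r subr0 (pmulr_lge0 _ sd).
by rewrite pmulr_lge0 // invr_gt0.
Qed.

Lemma sol_right_slope : f l = 0 -> f' l <= 0.
Proof.
move=> f0; have [d [d0 dm sd]] := ex_delta l0.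
have xl : 0 <= l <= l by lra.
have yl : 0 <= l - d <= l by lra.
have := f_ge0 yl; rewrite (expand xl yl) f0 mul0r add0r.
have -> : l - d - l = - d by ring.
rewrite mulrN sinN mulrN oppr_ge0 (pmulr_lle0 _ sd).
by rewrite pmulr_lle0 // invr_gt0.
Qed.

Lemma sol_zero_slope : (forall y, 0 <= y <= l -> f y = 0) ->
  forall x, 0 <= x <= l -> f' x = 0.
Proof.
move=> z; have [d [d0 dm sd]] := ex_delta l0.
have x0 : 0 <= (0 : R) <= l by lra.
have yl : 0 <= d <= l by lra.
have := expand x0 yl; rewrite !z // mul0r add0r subr0 => /esym/eqP.
rewrite mulf_eq0 (gt_eqF sd) orbF => /eqP b0 x xl.
have [_ ->] := ode_trigP w0 H xl.
by rewrite b0 z // /trig; ring.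
Qed.

End signed_solutions.

Section nodal_components.
Variables (R : realType) (E : edge_system R) (G : mgraph E) (f : edge_fun E).
Variable (T : {set label E}).

(** Unions of nodal domains, as sets of edges: an edge of such a set takes along
    the edges it meets where the function does not vanish. *)
Definition nodal_closed (U : {set label E}) : Prop := forall a b, same_vertex G a b ->
  f a.1 (end_coord a).2 != 0 -> a.1 \in U -> b.1 \in U.

Hypothesis f_cont : forall a b, same_vertex G a b ->
  f a.1 (end_coord a).2 = f b.1 (end_coord b).2.
Hypothesis f_edge : forall e x y, e \in edges E -> 0 <= x <= len e -> f e x != 0 ->
  0 < y < len e -> f e y != 0.
Hypotheses (TE : T \subset edges E) (clT : nodal_closed T).
Hypothesis T_nz : forall e x, e \in T -> 0 < x < len e -> f e x != 0.
Hypothesis minT : forall U, nodal_closed U -> (exists2 e, e \in T & e \in U) -> T \subset U.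

Let A : set (gpoint G) := [set q | feval f q != 0].

Lemma feval_same_point (p q : gpoint G) :
  same_point G (pt p) (pt q) -> feval f p = feval f q.
Proof.
rewrite /feval => -[->//|[a [b [ab -> ->]]]].
exact: f_cont ab.
Qed.

Lemma nodal_component (p0 : gpoint G) : (pt p0).1 \in T -> A p0 ->
  connected_component A p0 = A `&` [set q | (pt q).1 \in T].
Proof.
have closedP U : closed_in A U <-> nodal_closed U.
  split=> [H a b ab fa aU|H p q Ap Aq [->//|[a [b [ab pa qb]]]]].
    have aE := same_vertex_endpoint ab.
    have bE := same_vertex_endpoint (same_vertex_sym ab).
    apply: (H (GPoint G (on_edges_end aE)) (GPoint G (on_edges_end bE))) => //=.
      by rewrite /A /= /feval /= -(f_cont ab).
    by right; exists a, b.
  by rewrite pa qb /=; apply: H => //; move: Ap; rewrite /A /= /feval pa.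
move=> p0T Ap0; apply: component_of_edges => //.
- by move=> p q pq; rewrite /A /= (feval_same_point pq).
- move=> p q r pr qr /andP[H1 H2] Ap Aq.
  have /andP[rE rl] := ptP r; have /andP[pE pl] := ptP p; have /andP[qE ql] := ptP q.
  case: (on_edges_cases (ptP r)) => [int|[a aE ra]].
    by rewrite /A /= /feval; apply: (@f_edge _ (pt p).2) => //; rewrite -pr.
  case: (boolP a.2) => a2.
    suff -> : r = q by [].
    apply: gpoint_eq; rewrite [pt r]surjective_pairing [pt q]surjective_pairing qr.
    congr pair; apply/eqP; rewrite eq_le H2 /=.
    have -> : (pt r).2 = len (pt q).1 by rewrite qr ra /end_coord /= a2.
    by case/andP: ql.
  suff -> : r = p by [].
  apply: gpoint_eq; rewrite [pt r]surjective_pairing [pt p]surjective_pairing pr.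
  congr pair; apply/eqP; rewrite eq_le H1 andbT.
  have -> : (pt r).2 = 0 by rewrite ra /end_coord /= (negbTE a2).
  by case/andP: pl.
- exact/closedP.
move=> U /closedP cU [p [Ap pT pU]] q _.
by apply/fintype.subsetP/minT => //; exists (pt p).1.
Qed.

Lemma closure_nodal_component : closure (A `&` [set q | (pt q).1 \in T]) = edge_support G T.
Proof.
apply: closure_edges => [p []//|p pT int].
by split=> //; rewrite /A /= /feval; exact: T_nz.
Qed.

End nodal_components.

Section split_graph.
Variables (R : realType) (E : edge_system R) (G : mgraph E) (k : rel (label E * bool)).
Hypotheses (k_refl : forall a, k a a)
  (k_sym : forall a b, same_vertex G a b -> k a b -> k b a)
  (k_trans : forall a b c, same_vertex G a b -> same_vertex G b c ->
     k a b -> k b c -> k a c).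

Definition split_rel : rel (label E * bool) := fun a b => `[< same_vertex G a b >] && k a b.

Lemma split_rel_equiv : {in endpoints E & &, equivalence_rel split_rel}.
Proof.
move=> a b c aE bE cE; rewrite /split_rel; split.
  by rewrite k_refl andbT; apply/asboolP; exact: same_vertex_refl.
move=> /andP[/asboolP ab kab]; apply/idP/idP => /andP[/asboolP sv kk].
  have bc := same_vertex_trans (same_vertex_sym ab) sv.
  rewrite (asboolT bc) /=; apply: k_trans kk => //; first exact: same_vertex_sym.
  exact: k_sym.
have ac := same_vertex_trans ab sv.
by rewrite (asboolT ac) /=; apply: k_trans kk.
Qed.

Definition split_graph : mgraph E := graph_of split_rel_equiv.

Lemma same_vertex_split a b :
  same_vertex split_graph a b <-> same_vertex G a b /\ k a b.
Proof.
split=> [ab|[ab kab]].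
  have aE := same_vertex_endpoint ab; have bE := same_vertex_endpoint (same_vertex_sym ab).
  by move: ab => /(same_vertex_graph_of _ aE bE)/andP[/asboolP].
have aE := same_vertex_endpoint ab; have bE := same_vertex_endpoint (same_vertex_sym ab).
by apply/(same_vertex_graph_of _ aE bE)/andP; split=> //; apply/asboolP.
Qed.

End split_graph.

(** * The nodal partition of an optimal partition *)

Lemma cluster_ecomp (R : realType) (E : edge_system R) (C : mgraph E) (S T : {set label E}) :
  S \subset edges E -> eclosed C S ->
  ecomp (cluster_graph C S) T <-> ecomp C T /\ T \subset S.
Proof.
move=> SE clS; split.
  move=> [TE T0 clT minT]; have /fintype.subsetP TS : T \subset S.
    by move: TE; rewrite cluster_edges.
  have clT' : eclosed C T.
    move=> a b ab aT; apply: (clT a b _ aT); apply/cluster_same_vertex.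
    by split=> //; [exact: TS | exact: clS ab (TS _ aT)].
  split; last exact/fintype.subsetP.
  split=> //; first by apply: fintype.subset_trans SE; exact/fintype.subsetP.
  move=> U clU meet; apply: minT => // a b /cluster_same_vertex[ab _ _].
  exact: clU.
move=> [[TE T0 clT minT] TS]; split=> //.
- by rewrite cluster_edges.
- by move=> a b /cluster_same_vertex[ab _ _]; exact: clT.
move=> U clU [e eT eU].
have clU' : eclosed C (U :&: T)%SET.
  move=> a b ab /finset.setIP[aU aT]; have bT := clT _ _ ab aT; apply/finset.setIP; split=> //.
  apply: (clU a b _ aU); apply/cluster_same_vertex.
  by split=> //; exact: (fintype.subsetP TS).
have /fintype.subsetP sub : T \subset (U :&: T)%SET.
  by apply: minT => //; exists e => //; apply/finset.setIP.
by apply/fintype.subsetP => e' /sub /finset.setIP[].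
Qed.

Section nodal.
Variables (R : realType) (E : edge_system R) (P : gpartition E).
Hypotheses (cutP : is_cut (base P) (pcut P)) (exP : exhaustive P)
  (clP : forall S, S \in clusters P -> is_cluster (pcut P) S).
Local Notation B := (base P).
Local Notation C := (pcut P).
Variables (S1 S2 : {set label E}) (psi : {set label E} -> edge_fun E)
  (F : edge_fun E) (c : {set label E} -> R) (w : R).
Hypotheses (PE : clusters P = [set S1; S2]%SET) (S12 : S1 != S2)
  (c1 : 0 < c S1) (c2 : c S2 < 0) (w0 : 0 < w).
Hypothesis psi_eig : forall S, S \in clusters P ->
  eigenfunction (cluster_graph C S) (dirichlet_verts P S) (w ^+ 2) (psi S) /\
  cluster_energy P S = w ^+ 2.
Hypothesis psi_ge0 : forall S e x, S \in clusters P -> e \in S -> 0 <= x <= len e ->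
  0 <= psi S e x.
Hypothesis F_psi : forall S e x, S \in clusters P -> e \in S -> F e x = c S * psi S e x.
Hypothesis F_eig : eigenfunction B finset.set0 (w ^+ 2) F.

Let ecS S : S \in clusters P -> ecomp C S.
Proof. by move=> SP; apply/is_clusterP/clP. Qed.

Let c_neq0 S : S \in clusters P -> c S != 0.
Proof.
rewrite PE !finset.inE => /orP[] /eqP ->; first by rewrite gt_eqF.
by rewrite lt_eqF.
Qed.

Let in_cluster e : e \in edges E -> exists2 S, S \in clusters P & e \in S.
Proof.
move=> eE; have [T ecT eT] := ecomp_exists C eE; exists T => //.
by apply/exP/is_clusterP.
Qed.

Let cluster_uniq S S' e : S \in clusters P -> S' \in clusters P -> e \in S -> e \in S' -> S = S'.
Proof. by move=> SP S'P; apply: ecomp_eq; exact: ecS. Qed.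

Let Fv (a : label E * bool) : R := F a.1 (end_coord a).2.

Let F_cont a b : same_vertex B a b -> Fv a = Fv b.
Proof.
by case=> v vB [av bv]; have [_ [f' [_ H2 _ _]]] := F_eig; exact: H2 vB av bv.
Qed.

Let nz e : Prop := exists2 x, 0 <= x <= len e & F e x != 0.

(* The eigenfunction is nonnegative on the first cluster, nonpositive on the
   second one. *)
Let sg (e : label E) : R := if e \in S1 then 1 else -1.

Let sg_cases e : sg e = 1 \/ sg e = -1.
Proof. by rewrite /sg; case: ifP; [left|right]. Qed.

Let S1P : S1 \in clusters P. Proof. by rewrite PE !finset.inE eqxx. Qed.
Let S2P : S2 \in clusters P. Proof. by rewrite PE !finset.inE eqxx orbT. Qed.

Let sgF_ge0 e x : e \in edges E -> 0 <= x <= len e -> 0 <= sg e * F e x.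
Proof.
move=> eE xl; have [S SP eS] := in_cluster eE.
rewrite (F_psi x SP eS) /sg; have := psi_ge0 SP eS xl => p0.
move: SP; rewrite PE !finset.inE => /orP[] /eqP SE; rewrite SE in eS p0 *.
  by rewrite eS mul1r mulr_ge0 // ltW.
have -> : e \in S1 = false.
  by apply/negP => e1; move: S12; rewrite (cluster_uniq S1P S2P e1 eS) eqxx.
by rewrite mulN1r oppr_ge0 mulr_le0_ge0 // ltW.
Qed.

Let ode_of_F : exists2 F' : edge_fun E, forall e, e \in edges E ->
    ode (len e) (w ^+ 2) (F e) (F' e) &
  forall v, v \in verts B -> \sum_(a in v) outflow F' a = 0.
Proof.
have [F' H [_ _ H4]] := laplacian_ode F_eig.2; exists F' => // v vB.
by apply: H4 => //; rewrite finset.inE.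
Qed.

Let sg_ode e (F' : edge_fun E) : ode (len e) (w ^+ 2) (F e) (F' e) ->
  ode (len e) (w ^+ 2) (fun x => sg e * F e x) (fun x => sg e * F' e x).
Proof. exact: ode_scale. Qed.

Let sg0 e : sg e != 0.
Proof. by case: (sg_cases e) => ->; rewrite ?oppr_eq0 oner_eq0. Qed.

Let nz_interior e y : e \in edges E -> nz e -> 0 < y < len e -> F e y != 0.
Proof.
move=> eE [x xl fx] yl; apply: contra fx => /eqP fy.
have [F' H _] := ode_of_F.
have l0 := len_gt0 eE.
have := @sol_interior_zero _ _ _ _ _ w0 (sg_ode (H e eE)) (fun x => @sgF_ge0 e x eE) y yl.
rewrite fy mulr0 => /(_ erefl x xl)/eqP.
by rewrite mulf_eq0 (negbTE (sg0 e)).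
Qed.

Let not_nz e x : ~ nz e -> 0 <= x <= len e -> F e x = 0.
Proof. by move=> H xl; apply/eqP; apply: contrapT => /negP fx; apply: H; exists x. Qed.

Let outflow_sign (F' : edge_fun E) (a : label E * bool) :
  (forall e, e \in edges E -> ode (len e) (w ^+ 2) (F e) (F' e)) ->
  a \in endpoints E -> Fv a = 0 ->
  0 <= sg a.1 * outflow F' a /\ (nz a.1 <-> outflow F' a != 0).
Proof.
move=> H aE fa; have aE' : a.1 \in edges E by rewrite -endpointsE.
have l0 := len_gt0 aE'; have O := sg_ode (H _ aE').
have G0 x := @sgF_ge0 a.1 x aE'.
have xl : 0 <= (end_coord a).2 <= len a.1 by have /andP[] := on_edges_end aE.
split.
  rewrite /outflow /end_coord /=; move: fa; rewrite /Fv /end_coord; case: (a.2) => /= fa.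
    have := sol_right_slope l0 w0 O G0; rewrite fa mulr0 => /(_ erefl).
    by rewrite expr1 mulN1r mulrN oppr_ge0.
  have := sol_left_slope l0 w0 O G0; rewrite fa mulr0 => /(_ erefl).
  by rewrite expr0 mul1r.
split=> [na|oa].
  apply/negP => /eqP; rewrite /outflow => /eqP; rewrite mulf_eq0 signr_eq0 /= => /eqP f'0.
  have [x xl' fx] := na; move/eqP: fx; apply.
  exact: (sol_zero w0 (H _ aE') xl fa f'0).
apply: contrapT => na; move/eqP: oa; apply.
rewrite /outflow (@sol_zero_slope _ _ _ _ _ l0 w0 (H _ aE') _ _ xl) ?mulr0 //.
by move=> y yl; exact: not_nz.
Qed.

(** At a zero of the eigenfunction on an edge where it does not vanish, the
    Kirchhoff condition forces an edge of the opposite sign, hence of the other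
    cluster. *)
Let zero_vertex (a : label E * bool) : a \in endpoints E -> Fv a = 0 -> nz a.1 ->
  exists b, [/\ same_vertex B a b, sg b.1 = - sg a.1 & nz b.1].
Proof.
move=> aE fa na; have [F' H kir] := ode_of_F.
have [v vB [av _]] := same_vertex_refl B aE.
apply: contrapT => none.
have term b : b \in v -> 0 <= sg a.1 * outflow F' b.
  move=> bv; have ab : same_vertex B a b by exists v.
  have bE := vert_endpoint vB bv.
  have fb : Fv b = 0 by rewrite -(F_cont ab).
  have [out0 o2] := outflow_sign H bE fb.
  have [nb|nb] := pselect (nz b.1); last first.
    suff -> : outflow F' b = 0 by rewrite mulr0.
    by apply/eqP; apply: contraT => ob; exfalso; apply: nb; apply/o2.
  have [eqs|nes] := eqVneq (sg b.1) (sg a.1); first by rewrite -eqs.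
  exfalso; apply: none; exists b; split=> //.
  move: nes; case: (sg_cases b.1) => ->; case: (sg_cases a.1) => ->; rewrite ?eqxx ?opprK //.
have : \sum_(b in v) sg a.1 * outflow F' b = 0 by rewrite -mulr_sumr kir // mulr0.
move/eqP; rewrite psumr_eq0 // => /allP/(_ a); rewrite mem_index_enum av => /(_ isT) /=.
have [_ o2] := outflow_sign H aE fa.
by rewrite mulf_eq0 (negbTE (sg0 _)) /= => /eqP; apply/eqP; apply/o2.
Qed.

Let cut_end_zero (a : label E * bool) : a \in endpoints E -> cut_end P a -> Fv a = 0.
Proof.
move=> aE ca; have aE' : a.1 \in edges E by rewrite -endpointsE.
have [S SP aS] := in_cluster aE'.
rewrite /Fv (F_psi _ SP aS).
by rewrite (psi_cut_end cutP (ecS SP) (psi_eig SP).1 aS aE ca) mulr0.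
Qed.

(* The cut of [B] whose components are the nodal domains and the single edges
   on which the eigenfunction vanishes *)
Let k0 : rel (label E * bool) := fun a b => (a == b) || (Fv a != 0).

Let k0_refl a : k0 a a. Proof. by rewrite /k0 eqxx. Qed.
Let k0_sym a b : same_vertex B a b -> k0 a b -> k0 b a.
Proof. by move=> ab; rewrite /k0 (F_cont ab) eq_sym. Qed.
Let k0_trans a b d : same_vertex B a b -> same_vertex B b d -> k0 a b -> k0 b d -> k0 a d.
Proof.
move=> ab bd; rewrite /k0 (F_cont ab) => /orP[/eqP -> //|-> _]; by rewrite orbT.
Qed.

Let C0 : mgraph E := split_graph k0_refl k0_sym k0_trans.

Let C0P a b : same_vertex C0 a b <-> same_vertex B a b /\ (a = b \/ Fv a != 0).
Proof.
rewrite same_vertex_split /k0; split=> -[ab H]; split=> //.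
  by case/orP: H => [/eqP|]; [left|right].
by apply/orP; case: H => [->|->]; [left; rewrite eqxx | right].
Qed.

Let C0_C a b : same_vertex C0 a b -> same_vertex C a b.
Proof.
move=> /C0P[ab [<-|fa]]; first exact/same_vertex_refl/(same_vertex_endpoint ab).
apply: contrapT => nab; move/eqP: fa; apply.
by apply: cut_end_zero; [exact: same_vertex_endpoint ab | exists b].
Qed.

Let clS0 S : S \in clusters P -> eclosed C0 S.
Proof. by move=> SP a b /C0_C; have [_ _ cl _] := ecS SP; exact: cl. Qed.

Let SE S : S \in clusters P -> S \subset edges E.
Proof. by move=> /ecS[]. Qed.

(* A component of the cut containing an edge where the eigenfunction vanishes
   identically is that single edge, as both its ends are separated from the others. *)
Let comp_nz T e : ecomp C0 T -> e \in T -> nz e -> forall e', e' \in T -> nz e'.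
Proof.
move=> [TE _ _ minT] eT ne e' e'T; apply: contrapT => n'.
have cl1 : eclosed C0 [set e']%SET.
  move=> a b /C0P[ab]; rewrite !finset.inE => H /eqP ae.
  case: H => [<-|]; first by rewrite ae.
  rewrite /Fv ae not_nz ?eqxx //.
  by have /andP[_] := on_edges_end (same_vertex_endpoint ab); rewrite /= ae.
have /fintype.subsetP/(_ e eT) : T \subset [set e']%SET.
  by apply: minT => //; exists e'; rewrite ?finset.inE.
by rewrite finset.inE => /eqP ee; rewrite ee in ne.
Qed.

Let comp_sub_cluster T e S : ecomp C0 T -> e \in T -> S \in clusters P -> e \in S -> T \subset S.
Proof. by move=> [_ _ _ minT] eT SP eS; apply: minT; [exact: clS0 | exists e]. Qed.

Let min_nodal_closed T (G : mgraph E) : ecomp C0 T ->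
  (forall a b, same_vertex C0 a b -> a.1 \in T -> same_vertex G a b) ->
  forall U, nodal_closed G F U -> (exists2 e, e \in T & e \in U) -> T \subset U.
Proof.
move=> [_ _ clT minT] sub U clU [e eT eU].
have cl : eclosed C0 (U :&: T)%SET.
  move=> a b ab /finset.setIP[aU aT]; apply/finset.setIP.
  split; last exact: clT ab aT.
  have [_ [<- //|fa]] := (C0P a b).1 ab.
  by apply: (clU a b) => //; exact: sub.
have /fintype.subsetP H : T \subset (U :&: T)%SET.
  by apply: minT => //; exists e => //; apply/finset.setIP.
by apply/fintype.subsetP => e' /H /finset.setIP[].
Qed.

Let cluster_nodal_closure S T e : S \in clusters P -> ecomp C0 T -> T \subset S ->
  e \in T -> nz e ->
  @closure_of_nodal_domain R (sub_edges S) (cluster_graph C S) (psi S)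
    (edge_support (cluster_graph C S) T).
Proof.
move=> SP ecT TS eT ne; have [TE _ clT minT] := ecT.
have eS := fintype.subsetP TS _ eT; have eE := fintype.subsetP TE _ eT.
have psi0 e' x : e' \in S -> (psi S e' x == 0) = (F e' x == 0).
  by move=> e'S; rewrite (F_psi x SP e'S) mulf_eq0 (negbTE (c_neq0 SP)).
have Tnz e' : e' \in T -> nz e' by exact: comp_nz ecT eT ne e'.
have pE : @on_edges R (sub_edges S) (e, len e / 2).
  by apply: (@mid_on_edges R (sub_edges S)); rewrite /= finset.inE eE eS.
pose p0 : gpoint (cluster_graph C S) := GPoint (cluster_graph C S) pE.
have Ap0 : @feval R (sub_edges S) (cluster_graph C S) (psi S) p0 != 0.
  rewrite /feval /= psi0 //; apply: nz_interior => //; have := len_gt0 eE.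
  by lra.
exists p0 => //.
have cont a b : same_vertex (cluster_graph C S) a b ->
    psi S a.1 (end_coord a).2 = psi S b.1 (end_coord b).2.
  move=> [v vC [av bv]]; have [_ [f' [_ H2 _ _]]] := (psi_eig SP).1.
  exact: H2 vC av bv.
have svF a b : same_vertex (cluster_graph C S) a b -> psi S a.1 (end_coord a).2 != 0 ->
    same_vertex C0 a b.
  move=> /cluster_same_vertex[ab aS bS]; rewrite psi0 // => fa.
  by apply/C0P; split; [exact: (is_cutP _ _).1 cutP _ _ ab | right].
rewrite (@nodal_component R (sub_edges S) (cluster_graph C S) (psi S) T) //.
- rewrite (@closure_nodal_component R (sub_edges S) (cluster_graph C S) (psi S) T) //.
  move=> e' x e'T xl; rewrite psi0 ?(fintype.subsetP TS _ e'T) //.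
  apply: nz_interior => //; first exact: (fintype.subsetP TE).
  exact: Tnz.
- move=> e' x y; rewrite /= finset.inE => /andP[e'E e'S] xl; rewrite !psi0 // => fx yl.
  by apply: nz_interior => //; exists x.
- by move=> a b ab fa aT; apply: clT aT; exact: svF.
move=> U clU meet; have [e1 e1T e1U] := meet.
have cl : eclosed C0 (U :&: T)%SET.
  move=> a b ab /finset.setIP[aU aT]; have bT := clT _ _ ab aT; apply/finset.setIP.
  split=> //; have [_ [<- //|fa]] := (C0P a b).1 ab.
  apply: (clU a b) => //; last by rewrite psi0 // (fintype.subsetP TS).
  by apply/cluster_same_vertex; split; [exact: C0_C | exact: (fintype.subsetP TS)..].
have /fintype.subsetP H : T \subset (U :&: T)%SET.
  by apply: minT => //; exists e1 => //; apply/finset.setIP.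
by apply/fintype.subsetP => e' /H /finset.setIP[].
Qed.

Let Ts : {set {set label E}} := [set T : {set label E} | `[< exists2 S, S \in clusters P &
             is_cluster (cluster_graph C0 S) T /\ ~ vanishes_on (psi S) T >]]%SET.

Let vanishP (S T : {set label E}) : S \in clusters P -> T \subset S ->
  ~ vanishes_on (psi S) T <-> exists2 e, e \in T & nz e.
Proof.
move=> SP TS; have TE := fintype.subset_trans TS (SE SP); split.
  move=> nv; apply: contrapT => none; apply: nv => e x eT /andP[_ xl].
  apply/eqP; rewrite -(mulrI_eq0 _ (mulfI (c_neq0 SP))).
  rewrite -(F_psi x SP) ?(fintype.subsetP TS) //; apply/eqP; apply: not_nz => // ne.
  by apply: none; exists e.
move=> [e eT [x xl fx]] van; move/eqP: fx; apply.
have eE := fintype.subsetP TE _ eT.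
by rewrite (F_psi x SP) ?(fintype.subsetP TS) // van ?mulr0 // /on_edges /= eE.
Qed.

Let TsP T : T \in Ts <-> ecomp C0 T /\ (exists2 e, e \in T & nz e).
Proof.
rewrite finset.inE; split.
  move=> /asboolP[S SP [/is_clusterP/(cluster_ecomp _ (SE SP) (clS0 SP))[ecT TS] nv]].
  by split=> //; apply/(vanishP SP TS).
move=> [ecT [e eT ne]]; have [TE _ _ _] := ecT.
have [S SP eS] := in_cluster (fintype.subsetP TE _ eT).
have TS := comp_sub_cluster ecT eT SP eS.
apply/asboolP; exists S => //; split; last by apply/(vanishP SP TS); exists e.
by apply/is_clusterP/(cluster_ecomp _ (SE SP) (clS0 SP)).
Qed.

Let P0 : gpartition E := GPartition B C0 Ts.

Let psupportP (p : gpoint B) : psupport P0 p <->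
  exists q : gpoint B, [/\ same_point B (pt p) (pt q) & nz (pt q).1].
Proof.
split=> [[T /= /TsP[ecT [e eT ne]] [q qT pq]]|[q [pq nq]]].
  by exists q; split=> //; exact: comp_nz ecT eT ne _ qT.
have /andP[qE _] := ptP q; have [T ecT qT] := ecomp_exists C0 qE.
exists T; first by apply/TsP; split=> //; exists (pt q).1.
by exists q.
Qed.

Let cutC0 : is_cut B C0.
Proof. by apply/is_cutP => a b /C0P[]. Qed.

(* A zero on the support is a vertex, and has edges of both signs around it. *)
Let zero_on_support (p : gpoint B) : psupport P0 p -> feval F p = 0 ->
  exists a b d, [/\ pt p = end_coord a, same_vertex B a b, same_vertex B b d,
    nz b.1 & [/\ nz d.1, sg d.1 = - sg b.1 & Fv b = 0]].
Proof.
move=> /psupportP[q [pq nq]] fp.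
have fq : feval F q = 0 by rewrite -(feval_same_point F_cont pq).
have /andP[qE ql] := ptP q.
have [int|[b bE qb]] := on_edges_cases (ptP q).
  by have := nz_interior qE nq int; move: fq; rewrite /feval => ->; rewrite eqxx.
have fb : Fv b = 0 by move: fq; rewrite /feval /Fv qb.
have nb : nz b.1 by move: nq; rewrite qb.
have [d [bd sd nd]] := zero_vertex bE fb nb.
have [a [pa ab]] : exists a, pt p = end_coord a /\ same_vertex B a b.
  case: pq => [->|[a [b' [ab -> qb']]]]; first by exists b; split=> //; exact: same_vertex_refl.
  exists a; split=> //; rewrite qb in qb'; rewrite (end_coord_inj bE qb') //.
by exists a, b, d.
Qed.

Let sg_cluster S e e' : S \in clusters P -> e \in S -> e' \in S -> sg e = sg e'.
Proof.
move=> SP; move: (SP); rewrite PE !finset.inE /sg => /orP[] /eqP -> eS e'S.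
  by rewrite eS e'S.
have notin1 x : x \in S2 -> (x \in S1) = false.
  by move=> x2; apply/negP => x1; move: S12; rewrite (cluster_uniq S1P S2P x1 x2) eqxx.
by rewrite !notin1.
Qed.

Let sg_opp e e' : sg e' = - sg e -> sg e <> sg e'.
Proof. by move=> ->; case: (sg_cases e) => ->; lra. Qed.

Let opposite_comp T e e' : ecomp C0 T -> e \in T -> sg e' = - sg e -> e' \notin T.
Proof.
move=> ecT eT se; have [TE _ _ _] := ecT.
have [S SP eS] := in_cluster (fintype.subsetP TE _ eT).
apply/negP => /(fintype.subsetP (comp_sub_cluster ecT eT SP eS)) e'S.
exact: sg_opp se (sg_cluster SP eS e'S).
Qed.

Let cut_setP (p : gpoint B) : cut_set P0 p <-> psupport P0 p /\ feval F p = 0.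
Proof.
split=> [[sp [v cv [a av pa]]]|[sp fp]]; split=> //.
  have vB : v \in verts B by case/andP: cv.
  have [b [d [bv dv nbd]]] := (cut_nontriviallyP cutC0 vB).1 cv.
  have ab : same_vertex B a b by exists v.
  rewrite /feval pa -/(Fv a) (F_cont ab); apply/eqP; apply: contrapT => /negP fb.
  by apply: nbd; apply/C0P; split; [exists v | right].
have [a [b [d [pa ab bd nb [nd sd fb]]]]] := zero_on_support sp fp.
have [v vB [av bv]] := ab; exists v; last by exists a.
apply/(cut_nontriviallyP cutC0 vB); exists b, d; split=> //; first exact/(vertE _ vB bv).
move=> /C0P[_ [bdE|]]; last by rewrite fb eqxx.
by apply: (sg_opp sd); rewrite bdE.
Qed.

Let pboundaryP (p : gpoint B) : pboundary P0 p <-> psupport P0 p /\ feval F p = 0.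
Proof.
split=> [[T /= TT] /boundary_edge_support[[q pq qT] [r pr rT]]|[sp fp]].
  have [ecT [e eT ne]] := (TsP T).1 TT; have [_ _ clT _] := ecT.
  split; first by apply/psupportP; exists q; split=> //; exact: comp_nz ecT eT ne _ qT.
  rewrite (feval_same_point F_cont pq); apply/eqP; apply: contrapT => /negP fq.
  have := same_point_trans (same_point_sym pq) pr.
  case=> [qr|[b [d [bd qb rd]]]]; first by rewrite -qr qT in rT.
  move: rT; rewrite rd /=; apply/negP; rewrite negbK; apply: (clT b).
    by apply/C0P; split=> //; right; move: fq; rewrite /feval qb.
  by rewrite qb in qT.
have [a [b [d [pa ab bd nb [nd sd fb]]]]] := zero_on_support sp fp.
have bE := same_vertex_endpoint bd; have dE := same_vertex_endpoint (same_vertex_sym bd).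
have bE' : b.1 \in edges E by rewrite -endpointsE.
have [T ecT bT] := ecomp_exists C0 bE'.
exists T; first by apply/TsP; split=> //; exists b.1.
apply/boundary_edge_support; split.
  exists (GPoint B (on_edges_end bE)) => //=.
  by rewrite pa; right; exists a, b.
exists (GPoint B (on_edges_end dE)) => /=.
  by rewrite pa; right; exists a, d; split=> //; exact: same_vertex_trans ab bd.
exact: opposite_comp ecT bT sd.
Qed.

(** Every end of an edge at which the eigenfunction vanishes is separated from
    the other ends, so that the components left are the nodal domains and single
    edges of zeros. A zero on the support lies on edges of both signs, hence of
    different nodal domains: this makes the partition rigid and its boundary the
    zero set. *)
Theorem nodal_generalised : generalised_nodal_here P.
Proof.
exists psi, C0; split.
- by move=> S SP; have [ef ->] := psi_eig SP.
- by apply/is_cutP => a b; exact: C0_C.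
- move=> S T SP /is_clusterP/(cluster_ecomp _ (SE SP) (clS0 SP))[ecT TS].
  have [van|nv] := pselect (vanishes_on (psi S) T); [by left | right].
  have [e eT ne] := (vanishP SP TS).1 nv.
  exact: cluster_nodal_closure ecT TS eT ne.
exists (w ^+ 2), F; split=> //; rewrite -/Ts -/P0; split.
- split=> //= T /TsP[ecT _]; exact/is_clusterP.
- split.
    apply/funext => p; apply/propext; rewrite cut_setP pboundaryP //.
  move=> T /TsP[ecT [e eT ne]]; have [TE _ clT minT] := ecT.
  have eE := fintype.subsetP TE _ eT.
  pose p0 : gpoint B := GPoint B (mid_on_edges eE).
  have l0 := len_gt0 eE.
  have Ap0 : feval F p0 != 0.
    by rewrite /feval /=; apply: nz_interior => //; lra.
  have NC : connected_component [set q : gpoint B | feval F q != 0] p0 =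
      [set q : gpoint B | feval F q != 0] `&` [set q | (pt q).1 \in T].
    apply: nodal_component => //.
    - by move=> e' x y e'E xl fx yl; apply: nz_interior => //; exists x.
    - by move=> a b ab fa aT; apply: clT aT; apply/C0P; split=> //; right.
    - by apply: min_nodal_closed => // a b /C0P[].
  suff -> : edge_support B T `\` boundary (edge_support B T) =
      connected_component [set q : gpoint B | feval F q != 0] p0.
    exact: component_connected.
  rewrite NC; apply/seteqP; split=> p.
    move=> [sT nbd].
    have all (r : gpoint B) : same_point B (pt p) (pt r) -> (pt r).1 \in T.
      move=> pr; apply: contraT => rT; exfalso; apply: nbd.
      apply/boundary_edge_support; split; last by exists r.
      by have [q qT pq] := sT; exists q.
    have pT : (pt p).1 \in T by apply: all; exact: same_point_refl.
    split=> //=; apply/negP => /eqP fp.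
    apply: nbd; have sp : psupport P0 p.
      apply/psupportP; exists p; split; first exact: same_point_refl.
      exact: comp_nz ecT eT ne _ pT.
    have [a [b [d [pa ab bd nb [nd sd fb]]]]] := zero_on_support sp fp.
    have bE := same_vertex_endpoint bd; have dE := same_vertex_endpoint (same_vertex_sym bd).
    have bT : b.1 \in T.
      by apply: (all (GPoint B (on_edges_end bE))); rewrite /= pa; right; exists a, b.
    have dT : d.1 \in T.
      apply: (all (GPoint B (on_edges_end dE))); rewrite /= pa; right; exists a, d.
      by split=> //; exact: same_vertex_trans ab bd.
    by have := opposite_comp ecT bT sd; rewrite dT.
  move=> [/= fp pT]; split; first by exists p => //; exact: same_point_refl.
  move=> /boundary_edge_support[_ [r pr rT]]; case: pr => [pr|[a [b [ab pa rb]]]].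
    by rewrite -pr pT in rT.
  move: rT; rewrite rb /=; apply/negP; rewrite negbK; apply: (clT a).
    by apply/C0P; split=> //; right; move: fp; rewrite /feval pa.
  by rewrite pa in pT.
- apply/seteqP; split=> p.
    move=> /psupportP[q [pq nq]]; exists q => //.
    have /andP[qE _] := ptP q; rewrite finset.inE qE; exact/asboolP.
  move=> [q]; rewrite finset.inE => /andP[qE /asboolP nq] pq.
  by apply/psupportP; exists q.
- by apply/funext => p; apply/propext; rewrite cut_setP.
Qed.

End nodal.

(** * Subdivision at the zeros *)

Section identity_subdivision.
Variables (R : realType) (E : edge_system R).

Definition id_subdivision : subdivision E E.
Proof.
refine (@Subdivision R E E id (fun=> 0) (fun=> false) _ _ _ _).
- by [].
- by move=> e eE; rewrite add0r lexx.
- by move=> [e x] /andP[/= eE xl]; exists e => //; rewrite add0r.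
- by move=> e1 e2 _ _ /= -> /eqP.
Defined.

Lemma sub_coord_id p : sub_coord id_subdivision p = p.
Proof. by case: p => e x; rewrite /sub_coord /= add0r. Qed.

Lemma subdivides_id (G : mgraph E) : subdivides id_subdivision G G.
Proof. by move=> a b aE bE; rewrite !sub_coord_id same_point_end. Qed.

End identity_subdivision.

Section points.
Variables (R : realType) (E : edge_system R) (G : mgraph E) (M : nat).
Variable (p : label E -> nat -> R).
Hypotheses (p0 : forall e, e \in edges E -> p e 0%N = 0)
  (pM : forall e, e \in edges E -> p e M = len e)
  (p_inc : forall e i, e \in edges E -> (i < M)%N -> p e i < p e i.+1).

Lemma fine_len_gt0 : {in [set x : label E * 'I_M | x.1 \in edges E]%SET,
  forall x : label E * 'I_M, 0 < p x.1 x.2.+1 - p x.1 x.2}.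
Proof. by move=> [e i]; rewrite finset.inE /= => eE; rewrite subr_gt0 p_inc. Qed.

Definition fine_edges : edge_system R := EdgeSystem fine_len_gt0.

Lemma p_le e i j : e \in edges E -> (i <= j)%N -> (j <= M)%N -> p e i <= p e j.
Proof.
move=> eE; elim: j => [|j IH]; first by rewrite leqn0 => /eqP ->.
rewrite leq_eqVlt => /orP[/eqP -> //|ij] jM.
by apply: le_trans (IH ij (ltnW jM)) _; apply/ltW/p_inc.
Qed.

Lemma p_cover e x j : e \in edges E -> (j <= M)%N -> 0 <= x <= p e j -> (0 < j)%N ->
  exists2 i, (i < j)%N & p e i <= x <= p e i.+1.
Proof.
move=> eE; elim: j => // j IH jM /andP[x0 xj] _.
have [le1|/ltW le1] := leP x (p e j); last by exists j => //; rewrite le1.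
case: j IH jM xj le1 => [|j] IH jM xj le1.
  by exists 0%N => //; rewrite xj p0 // x0.
by have [|||i ij H] := IH => //; [exact: ltnW | rewrite x0 | exists i => //; exact: ltnW].
Qed.

Definition fine_subdivision : subdivision E fine_edges.
Proof.
refine (@Subdivision R E fine_edges (fun x => x.1) (fun x => p x.1 x.2) (fun=> false) _ _ _ _).
- by move=> [e i]; rewrite finset.inE.
- move=> [e i]; rewrite finset.inE /= => eE; rewrite subrKC.
  have q1 : p e 0%N <= p e i by apply: p_le => //; exact: ltnW (ltn_ord i).
  have q2 : p e i.+1 <= p e M by apply: p_le => //; exact: ltn_ord.
  by rewrite p0 // in q1; rewrite pM // in q2.
- move=> [e x] /andP[/= eE /andP[x0 xl]].
  have M0 : (0 < M)%N.
    rewrite lt0n; apply/eqP => Mz; have := len_gt0 eE.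
    by rewrite -(pM eE) Mz p0 // ltxx.
  have [|i iM H] := @p_cover e x M eE (leqnn M) _ M0; first by rewrite x0 pM.
  exists (e, Ordinal iM); first by rewrite finset.inE.
  by rewrite /= subrKC.
- move=> [e1 i] [e2 j]; rewrite !finset.inE /= => eE _ ee; rewrite -{}ee !subrKC => ne.
  have ij : i != j by apply: contra ne => /eqP ->.
  have [lt|gt|eq] := ltngtP i j.
  + by left; apply: p_le => //; exact: ltnW (ltn_ord j).
  + by right; apply: p_le => //; exact: ltnW (ltn_ord i).
  + by move: ij; rewrite -val_eqE /= eq eqxx.
Defined.

Definition fine_rel : rel (label fine_edges * bool) :=
  fun a b => `[< same_point G (place fine_subdivision a) (place fine_subdivision b) >].

Lemma fine_rel_equiv : {in endpoints fine_edges & &, equivalence_rel fine_rel}.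
Proof.
move=> a b c _ _ _; split; first by apply/asboolP; exact: same_point_refl.
move=> /asboolP ab; apply/asboolP/asboolP => H.
  exact: same_point_trans (same_point_sym ab) H.
exact: same_point_trans ab H.
Qed.

Definition fine_graph : mgraph fine_edges := graph_of fine_rel_equiv.

Lemma subdivides_fine : subdivides fine_subdivision G fine_graph.
Proof.
move=> a b aE bE; split=> [/(same_vertex_graph_of _ aE bE)/asboolP//|H].
by apply/(same_vertex_graph_of _ aE bE)/asboolP.
Qed.

End points.

Lemma trig_two_zeros (R : realType) (w a b x y h : R) : 0 < w -> w * h < pi ->
  x < y -> y < x + h -> trig w a b x = 0 -> trig w a b y = 0 ->
  forall z, trig w a b z = 0.
Proof.
move=> w0 wh xy yh Fx Fy; apply: (@trig_eq0 _ w a b x (y - x)) => //.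
- by rewrite subr_gt0.
- by apply: lt_trans wh; rewrite ltr_pM2l // ltrBlDl.
- by rewrite subrKC.
Qed.

(** Inserting the points of a fine regular division and, in each of its
    intervals, the zero of the function if there is one, puts all the isolated
    zeros at vertices. *)
Lemma zero_subdivision (R : realType) (E : edge_system R) (G : mgraph E) (w : R)
    (f f' : edge_fun E) : 0 < w ->
  (forall e, e \in edges E -> ode (len e) (w ^+ 2) (f e) (f' e)) ->
  exists (E' : edge_system R) (s : subdivision E E') (H : mgraph E'),
    subdivides s G H /\
    forall e' x y, e' \in edges E' -> 0 < x < len e' -> 0 <= y <= len e' ->
      f (parent s e') (sub_coord s (e', x)).2 = 0 ->
      f (parent s e') (sub_coord s (e', y)).2 = 0.
Proof.
move=> w0 Hode; have [n sw] := short_exists E w.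
have zP (e : label E) (i : nat) : exists z, e \in edges E ->
    i%:R * mesh n e < z < i%:R * mesh n e + mesh n e /\
    ((exists2 y, i%:R * mesh n e < y < i%:R * mesh n e + mesh n e & f e y = 0) -> f e z = 0).
  have [eE|_] := boolP (e \in edges E); last by exists 0.
  have h0 := mesh_gt0 n eE.
  have [[y yi fy]|none] := pselect (exists2 y,
      i%:R * mesh n e < y < i%:R * mesh n e + mesh n e & f e y = 0).
    by exists y.
  by exists (i%:R * mesh n e + mesh n e / 2) => _; split=> //; lra.
pose z e i := projT1 (cid (zP e i)).
have zE e i : e \in edges E -> i%:R * mesh n e < z e i < i%:R * mesh n e + mesh n e /\
    ((exists2 y, i%:R * mesh n e < y < i%:R * mesh n e + mesh n e & f e y = 0) ->
     f e (z e i) = 0) := projT2 (cid (zP e i)).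
move: z zE => z zE.
pose p e k := if odd k then z e k./2 else k./2%:R * mesh n e.
pose M := n.+1.*2.
have p0 e : e \in edges E -> p e 0%N = 0 by move=> _; rewrite /p /= mul0r.
have pM e : e \in edges E -> p e M = len e.
  by move=> _; rewrite /p /M odd_double doubleK meshN.
have pS e k : p e k.+1 = if odd k then k./2%:R * mesh n e + mesh n e else z e k./2.
  rewrite /p /=; case: (boolP (odd k)) => ok /=.
    by rewrite uphalf_half ok add1n -natr1 mulrDl mul1r.
  by rewrite uphalf_half (negbTE ok).
have p_inc e i : e \in edges E -> (i < M)%N -> p e i < p e i.+1.
  move=> eE _; rewrite pS /p; have [/andP[z1 z2] _] := zE e i./2 eE.
  by case: (odd i).
exists (fine_edges p_inc), (fine_subdivision p0 pM p_inc), (fine_graph G p0 pM p_inc).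
split; first exact: subdivides_fine.
move=> [e k] x y; rewrite finset.inE /= => eE.
rewrite /sub_coord /= => /andP[x0 xl] /andP[y0 yl] fx.
have [kM] := (ltn_ord k); have pk := p_inc e k eE (ltn_ord k).
have in_edge t : 0 <= t <= p e k.+1 - p e k -> 0 <= p e k + t <= len e.
  move=> /andP[t0 tl].
  have q1 : p e 0%N <= p e k by apply: (p_le p_inc) => //; rewrite ltnW.
  have q2 : p e k.+1 <= p e M by apply: (p_le p_inc).
  by rewrite p0 // in q1; rewrite pM // in q2; lra.
have T := ode_trigP w0 (Hode e eE).
have xin : 0 <= p e k + x <= len e by apply: in_edge; rewrite !ltW.
have yin : 0 <= p e k + y <= len e by apply: in_edge; rewrite y0.
have h0 := mesh_gt0 n eE.
have [/andP[z1 z2] z3] := zE e k./2 eE.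
have zin : 0 <= z e k./2 <= len e.
  have i0 : 0 <= k./2%:R * mesh n e by rewrite mulr_ge0 // ltW.
  have : k./2.+1%:R * mesh n e <= len e.
    rewrite -(meshN n e) ler_wpM2r ?(ltW h0) // ler_nat ltn_half_double; exact: ltn_ord.
  have -> : k./2.+1%:R * mesh n e = k./2%:R * mesh n e + mesh n e.
    by rewrite -natr1 mulrDl mul1r.
  move=> i1; apply/andP; split; first exact: le_trans i0 (ltW z1).
  exact: le_trans (ltW z2) i1.
have xi : k./2%:R * mesh n e < p e k + x < k./2%:R * mesh n e + mesh n e.
  by move: xl x0; rewrite pS /p; case: (odd k) => *; lra.
have fz : f e (z e k./2) = 0 by apply: z3; exists (p e k + x).
have zx : z e k./2 != p e k + x.
  by move: xl x0; rewrite pS /p; case: (odd k) => xl x0; [rewrite lt_eqF //;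
    lra | rewrite gt_eqF //; lra].
rewrite (T _ yin).1; rewrite (T _ xin).1 in fx; rewrite (T _ zin).1 in fz.
have [lt|gt|eq] := ltgtP (z e k./2) (p e k + x); last by rewrite eq eqxx in zx.
  by apply: (trig_two_zeros w0 (sw e eE) lt _ fz fx); lra.
by apply: (trig_two_zeros w0 (sw e eE) gt _ fx fz); lra.
Qed.

(** * A partition attaining the bound *)

Section side_split.
Variables (R : realType) (E : edge_system R) (G : mgraph E) (X : {set label E}).

Let same_side : rel (label E * bool) := fun a b => (a.1 \in X) == (b.1 \in X).
Let ss_refl a : same_side a a. Proof. exact: eqxx. Qed.
Let ss_sym a b : same_vertex G a b -> same_side a b -> same_side b a.
Proof. by move=> _; rewrite /same_side eq_sym. Qed.
Let ss_trans a b c : same_vertex G a b -> same_vertex G b c ->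
  same_side a b -> same_side b c -> same_side a c.
Proof. by move=> _ _ /eqP; rewrite /same_side => ->. Qed.

Definition side_split : mgraph E := split_graph ss_refl ss_sym ss_trans.

Lemma side_splitP a b : same_vertex side_split a b <->
  same_vertex G a b /\ (a.1 \in X) = (b.1 \in X).
Proof. by rewrite same_vertex_split; split=> -[ab /eqP]. Qed.

Lemma side_split_closed : eclosed side_split X.
Proof. by move=> a b /side_splitP[_ <-]. Qed.

Lemma side_split_comp T e : ecomp side_split T -> e \in T ->
  T \subset if e \in X then X else (~: X)%SET.
Proof.
move=> [_ _ _ minT] eT; apply: minT.
  by case: ifP => _; [exact: side_split_closed | apply: eclosedC; exact: side_split_closed].
by exists e => //; case: ifP => // eX; rewrite finset.inE eX.
Qed.

End side_split.

Section bipartition.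
Variables (R : realType) (E : edge_system R) (G : mgraph E).
Hypothesis cG : econn G.
Variables (pos_edges : {set label E}) (e1 e2 : label E).
Hypotheses (e1E : e1 \in edges E) (e2E : e2 \in edges E)
  (e1pos : e1 \in pos_edges) (e2pos : e2 \notin pos_edges).

(** With U a connected set of positive edges, maximal for this property, and Y
    a component of the complement of U, both Y and its complement are
    connected: every component of the complement of U is attached to U. An edge
    outside Y meeting Y is in U. *)
Lemma connected_bipartition : exists Y : {set label E},
  [/\ ecomp (side_split G Y) Y, ecomp (side_split G Y) (edges E :\: Y)%SET,
      e2 \in Y, e1 \notin Y &
      forall a b, same_vertex G a b -> a.1 \in Y -> b.1 \notin Y ->
        a.1 \notin pos_edges /\ b.1 \in pos_edges].
Proof.
have [U ecU e1U] := ecomp_exists (side_split G pos_edges) e1E.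
have [UE _ clU minU] := ecU.
have Upos : U \subset pos_edges by have := side_split_comp ecU e1U; rewrite e1pos.
have e2U : e2 \notin U by apply: contra e2pos; exact: fintype.subsetP Upos _.
have [Y ecY e2Y] := ecomp_exists (side_split G U) e2E.
have [YE _ clY minY] := ecY.
have YU e : e \in Y -> e \notin U.
  have := side_split_comp ecY e2Y; rewrite (negbTE e2U) => /fintype.subsetP sub /sub.
  by rewrite finset.inE.
have UY e : e \in U -> e \notin Y by apply: contraL; exact: YU.
pose C := side_split G Y.
have clCY : eclosed C Y := @side_split_closed _ _ _ _.
exists Y; split=> //.
- split=> //; first by exists e2.
  move=> T clT [e eY eT].
  have cl : eclosed (side_split G U) (T :&: Y)%SET.
    move=> a b ab /finset.setIP[aT aY]; have bY := clY _ _ ab aY.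
    apply/finset.setIP; split=> //; apply: (clT a) => //.
    by have [sab _] := (side_splitP _ _ _ _).1 ab; apply/side_splitP; rewrite aY bY.
  have /fintype.subsetP sub : Y \subset (T :&: Y)%SET.
    by apply: minY => //; exists e => //; apply/finset.setIP.
  by apply/fintype.subsetP => e' /sub /finset.setIP[].
- have toU T e : eclosed C T -> e \in edges E -> e \notin Y -> e \in T ->
      exists2 e', e' \in U & e' \in T.
    move=> clT eE eY eT; case: (boolP (e \in U)) => eU; first by exists e.
    have [Y' ecY' eY'] := ecomp_exists (side_split G U) eE.
    have [Y'E _ clY' minY'] := ecY'.
    have Y'U x : x \in Y' -> x \notin U.
      have := side_split_comp ecY' eY'; rewrite (negbTE eU) => /fintype.subsetP sub /sub.
      by rewrite finset.inE.
    have Y'Y x : x \in Y' -> x \notin Y.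
      by move=> xY'; apply: contra eY => xY; rewrite (ecomp_eq ecY ecY' xY xY').
    have cl : eclosed (side_split G U) (T :&: Y')%SET.
      move=> a b ab /finset.setIP[aT aY']; have bY' := clY' _ _ ab aY'.
      apply/finset.setIP; split=> //; apply: (clT a) => //.
      have [sab _] := (side_splitP _ _ _ _).1 ab; apply/side_splitP.
      by rewrite (negbTE (Y'Y _ aY')) (negbTE (Y'Y _ bY')).
    have /fintype.subsetP sub : Y' \subset (T :&: Y')%SET.
      by apply: minY' => //; exists e => //; apply/finset.setIP.
    have [a [b [ab aY' bY']]] : exists a b, [/\ same_vertex G a b, a.1 \in Y' & b.1 \notin Y'].
      apply: contrapT => none; have [_ _ _ minG] := cG.
      have /minG H : eclosed G Y'.
        by move=> a b ab aY'; apply: contraT => bY'; exfalso; apply: none; exists a, b.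
      have /fintype.subsetP/(_ e2 e2E) e2Y' : edges E \subset Y' by apply: H; exists e.
      by have := Y'Y _ e2Y'; rewrite e2Y.
    have bU : b.1 \in U.
      apply: contraT => bU; exfalso; move/negP: bY'; apply; apply: (clY' a) => //.
      by apply/side_splitP; rewrite (negbTE bU) (negbTE (Y'U _ aY')).
    exists b.1 => //; have /finset.setIP[aT _] := sub _ aY'.
    apply: (clT a) => //; apply/side_splitP.
    by rewrite (negbTE (UY _ bU)) (negbTE (Y'Y _ aY')).
  split.
  + exact: finset.subsetDl.
  + by exists e1; rewrite finset.inE UY.
  + move=> a b ab; rewrite !finset.inE => /andP[aY aE].
    have bE := same_vertex_endpoint (same_vertex_sym ab).
    rewrite endpointsE in bE; rewrite bE andbT.
    by have [_ <-] := (side_splitP _ _ _ _).1 ab.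
  have U_T T : eclosed C T -> (exists2 e', e' \in U & e' \in T) -> U \subset T.
    move=> clT [e' e'U e'T].
    have cl : eclosed (side_split G pos_edges) (T :&: U)%SET.
      move=> a b ab /finset.setIP[aT aU]; have bU := clU _ _ ab aU.
      apply/finset.setIP; split=> //; apply: (clT a) => //.
      have [sab _] := (side_splitP _ _ _ _).1 ab; apply/side_splitP.
      by rewrite (negbTE (UY _ aU)) (negbTE (UY _ bU)).
    have /fintype.subsetP sub : U \subset (T :&: U)%SET.
      by apply: minU => //; exists e' => //; apply/finset.setIP.
    by apply/fintype.subsetP => e /sub /finset.setIP[].
  move=> T clT [e]; rewrite finset.inE => /andP[eY eE] eT.
  have /fintype.subsetP UT := U_T T clT (toU T e clT eE eY eT).
  apply/fintype.subsetP => e'; rewrite finset.inE => /andP[e'Y e'E].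
  apply: contraT => e'T.
  have e'Tc : e' \in (~: T)%SET by rewrite finset.inE.
  have [e'' e''U] := toU _ e' (eclosedC clT) e'E e'Y e'Tc.
  by rewrite finset.inE UT.
- exact: UY.
move=> a b ab aY bY.
have bU : b.1 \in U.
  apply: contraT => bU; exfalso; move/negP: bY; apply; apply: (clY a) => //.
  by apply/side_splitP; rewrite (negbTE bU) (negbTE (YU _ aY)).
have bpos := fintype.subsetP Upos _ bU; split=> //.
apply/negP => apos; have := YU _ aY; apply/negP; rewrite negbK.
apply: (clU b) => //; apply/side_splitP; rewrite apos bpos; split=> //.
exact: same_vertex_sym.
Qed.

End bipartition.

Lemma mul_lt0_minmax (R : realType) (a b : R) : a * b < 0 ->
  Num.min a b <= 0 <= Num.max a b.
Proof.
rewrite ge_min le_max; case: (lerP a 0) => a0; case: (lerP b 0) => b0 //= ab; nra.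
Qed.

Section signs.
Variables (R : realType) (E : edge_system R) (G : mgraph E) (w : R) (g : edge_fun E).
Hypotheses (cG : econn G) (w0 : 0 < w).
Hypothesis g_eig : eigenfunction G finset.set0 (w ^+ 2) g.
Hypothesis g_zero : forall e x y, e \in edges E -> 0 < x < len e -> 0 <= y <= len e ->
  g e x = 0 -> g e y = 0.

(** By the intermediate value theorem the sign of the middle of an edge is the
    sign of the function on the whole edge. *)
Lemma mid_sign e x : e \in edges E -> 0 <= x <= len e -> g e x != 0 ->
  0 < g e x * g e (len e / 2).
Proof.
move=> eE xl gx; have l0 := len_gt0 eE.
have [f' Hode _] := laplacian_ode g_eig.2.
have T := ode_trigP w0 (Hode e eE).
set F := trig w (g e 0) (f' e 0 / w) in T.
have ml : 0 <= len e / 2 <= len e by lra.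
have gm : g e (len e / 2) != 0.
  by apply: contra gx => /eqP gm; rewrite (g_zero eE _ xl gm) ?eqxx //; lra.
rewrite lt_def mulf_neq0 //= leNgt; apply/negP => neg.
have cF : continuous F.
  move=> t; apply: differentiable_continuous; apply/derivable1_diffP.
  by have [] := is_derive_trig w (g e 0) (f' e 0 / w) t.
pose u := Num.min x (len e / 2); pose v := Num.max x (len e / 2).
have uv : u <= v by rewrite /u /v ge_min le_max lexx.
have Fx : F x != 0 by rewrite -(T x xl).1.
have Fm : F (len e / 2) != 0 by rewrite -(T _ ml).1.
have [|z zuv Fz] := @IVT R F u v 0 uv (continuous_subspaceT cF).
  move: neg; rewrite (T x xl).1 (T _ ml).1 -/F /u /v.
  case: (leP x (len e / 2)) => _ neg; apply: mul_lt0_minmax => //.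
  by rewrite mulrC.
have zx : z != x by apply: contra Fx => /eqP <-; rewrite Fz.
have zm : z != len e / 2 by apply: contra Fm => /eqP <-; rewrite Fz.
have zint : 0 < z < len e.
  move: zuv; rewrite in_itv /= /u /v; move: zx zm.
  case: (leP x (len e / 2)) => h; rewrite !neq_lt => /orP[] h1 /orP[] h2 /andP[h3 h4]; lra.
have zl : 0 <= z <= len e by case/andP: zint => *; rewrite !ltW.
move/eqP: gx; apply; apply: (g_zero eE zint xl).
by rewrite (T z zl).1.
Qed.

Lemma mid_sign_exists (sg : R) : sg = 1 \/ sg = -1 ->
  exists2 e, e \in edges E & 0 < sg * g e (len e / 2).
Proof.
move=> sg1; apply: contrapT => none.
have sg0 : sg != 0 by case: sg1 => ->; rewrite ?oppr_eq0 oner_eq0.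
have nonpos e x : e \in edges E -> 0 <= x <= len e -> 0 <= - sg * g e x.
  move=> eE xl; have [->|gx] := eqVneq (g e x) 0; first by rewrite mulr0.
  have ms := mid_sign eE xl gx.
  have : ~ 0 < sg * g e (len e / 2) by move=> H; apply: none; exists e.
  move/negP; rewrite -leNgt => le0.
  by case: sg1 le0 => ->; nra.
have [n sw] := short_exists E w.
have b0 := eigenfunction_dmass w0 sw g_eig.
have [_ [e [i [eE iN gi]]]] := eigenfunction_kernel w0 sw g_eig.
pose k (e : label E) (i : nat) : R :=
  if (e \in edges E) && (i <= n.+1)%N then - sg * sample n g e i else 0.
have k0 e' j : 0 <= k e' j.
  by rewrite /k; case: ifP => // /andP[e'E jN]; apply: nonpos => //; exact: sample_pt.
have knz : dnz n k.
  by exists e, i; split=> //; rewrite /k eE iN mulf_neq0 // oppr_eq0.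
have := dmass_gt0 (ltW w0) sw k0 knz.
rewrite (@dmass_ext _ _ n w k (fun e i => - sg * sample n g e i + 0 * sample n g e i)).
  by rewrite dmass_lin b0 !mulr0 addr0 ltxx.
by move=> e' j e'E jN; rewrite /k e'E jN mul0r addr0.
Qed.

End signs.

Section optimal.
Variables (R : realType) (E0 E : edge_system R) (G0 : mgraph E0) (G : mgraph E).
Variables (w : R) (g : edge_fun E).
Hypotheses (cG : econn G) (w0 : 0 < w) (same : same_graph G0 G).
Hypothesis g_eig : eigenfunction G finset.set0 (w ^+ 2) g.
Hypothesis g_zero : forall e x y, e \in edges E -> 0 < x < len e -> 0 <= y <= len e ->
  g e x = 0 -> g e y = 0.

(** The restriction of the eigenfunction to either side is an eigenfunction of
    that cluster, as it vanishes where the sides meet. *)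
Lemma nodal_bipartition : exists P : gpartition E, exh_rigid G0 2 P /\ energy P <= w ^+ 2.
Proof.
have [e1 e1E] := mid_sign_exists w0 g_eig g_zero (or_introl erefl).
rewrite mul1r => g1.
have [e2 e2E] := mid_sign_exists w0 g_eig g_zero (or_intror erefl).
rewrite mulN1r oppr_gt0 => g2.
pose pos_edges : {set label E} := [set e | 0 < g e (len e / 2)]%SET.
have e1pos : e1 \in pos_edges by rewrite finset.inE.
have e2pos : e2 \notin pos_edges by rewrite finset.inE -leNgt ltW.
have [Y [ec2 ec1 e2Y e1Y meet]] := connected_bipartition cG e1E e2E e1pos e2pos.
set S1 := (edges E :\: Y)%SET in ec1.
pose C := side_split G Y.
have YE : Y \subset edges E by case: ec2.
have e1S : e1 \in S1 by rewrite finset.inE e1Y.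
pose P : gpartition E := GPartition G C [set S1; Y]%SET.
have cutP : is_cut G C by apply/is_cutP => a b /side_splitP[].
have S1Y : S1 != Y by apply/eqP => eqS; move: e1S; rewrite eqS (negbTE e1Y).
have g_cont a b : same_vertex G a b -> g a.1 (end_coord a).2 = g b.1 (end_coord b).2.
  by case=> v vG [av bv]; have [_ [f' [_ H2 _ _]]] := g_eig; exact: H2 vG av bv.
have meet0 a b : same_vertex G a b -> a.1 \in Y -> b.1 \notin Y -> g a.1 (end_coord a).2 = 0.
  move=> ab aY bY; have [apos bpos] := meet a b ab aY bY.
  apply/eqP; apply: contraT => ga; exfalso.
  have aE := same_vertex_endpoint ab; have bE := same_vertex_endpoint (same_vertex_sym ab).
  have /andP[aE' al] := on_edges_end aE; have /andP[bE' bl] := on_edges_end bE.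
  have ma := mid_sign w0 g_eig g_zero aE' al ga.
  have gb : g b.1 (end_coord b).2 != 0 by rewrite -(g_cont a b).
  have mb := mid_sign w0 g_eig g_zero bE' bl gb.
  move: bpos; rewrite finset.inE => bpos.
  move: mb; rewrite /= (pmulr_lgt0 _ bpos) -(g_cont a b) // => ga0.
  move: ma; rewrite /= (pmulr_rgt0 _ ga0) => ma.
  by move: apos; rewrite finset.inE ma.
have cut0 a : a \in endpoints E -> cut_end P a -> g a.1 (end_coord a).2 = 0.
  move=> aE [b ab nab]; case: (boolP (a.1 \in Y)) => aY.
    apply: (meet0 a b) => //; apply/negP => bY; apply: nab; apply/side_splitP.
    by rewrite aY bY.
  rewrite (g_cont a b) //; apply: (meet0 b a) => //; first exact: same_vertex_sym.
  apply: contraT => bY; exfalso; apply: nab; apply/side_splitP.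
  by rewrite (negbTE aY) (negbTE bY).
have clP S : S \in clusters P -> ecomp C S.
  by rewrite !finset.inE => /orP[] /eqP ->.
exists P; split.
  split.
  - split=> //; last by rewrite cards2 S1Y.
    by split=> // S SP; apply/is_clusterP; exact: clP.
  - move=> S /is_clusterP ecS; have [SE [e eS] _ _] := ecS.
    have eE := fintype.subsetP SE _ eS; rewrite !finset.inE.
    case: (boolP (e \in Y)) => eY; first by rewrite (ecomp_eq ecS ec2 eS eY) eqxx orbT.
    by rewrite (ecomp_eq ecS ec1 eS) ?eqxx // finset.inE eY.
  apply/funext => p; apply/propext; split.
    move=> [_ [v cv [a av pa]]]; have vG : v \in verts G by case/andP: cv.
    have [b [c [bv cv' nbc]]] := (cut_nontriviallyP cutP vG).1 cv.
    have bE := vert_endpoint vG bv; have cE := vert_endpoint vG cv'.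
    have pb : same_point G (pt p) (end_coord b) by rewrite pa; right; exists a, b; split=> //;
      exists v.
    have pc : same_point G (pt p) (end_coord c) by rewrite pa; right; exists a, c; split=> //;
      exists v.
    exists Y; first by rewrite /= !finset.inE eqxx orbT.
    have bc : same_vertex G b c by exists v.
    apply/boundary_edge_support; case: (boolP (b.1 \in Y)) => bY.
      split; first by exists (GPoint G (on_edges_end bE)).
      exists (GPoint G (on_edges_end cE)) => //=.
      by apply/negP => cY; apply: nbc; apply/side_splitP; rewrite bY cY.
    split; last by exists (GPoint G (on_edges_end bE)).
    exists (GPoint G (on_edges_end cE)) => //=.
    apply: contraT => cY; exfalso; apply: nbc; apply/side_splitP.
    by rewrite (negbTE bY) (negbTE cY).
  move=> [S SP /boundary_edge_support[[q pq qS] [r pr rS]]].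
  have qrY : (pt q).1 \in Y <> ((pt r).1 \in Y).
    have /andP[qE _] := ptP q; have /andP[rE _] := ptP r.
    move: SP qS rS; rewrite /= !finset.inE => /orP[] /eqP ->; rewrite ?finset.inE.
      by rewrite rE qE !andbT negbK => /negbTE -> ->.
    by move=> -> /negbTE ->.
  split.
    have /andP[pE _] := ptP p; case: (boolP ((pt p).1 \in Y)) => pY.
      exists Y; first by rewrite /= !finset.inE eqxx orbT.
      by exists p => //; exact: same_point_refl.
    exists S1; first by rewrite /= !finset.inE eqxx.
    by exists p; [rewrite finset.inE pY | exact: same_point_refl].
  have qr := same_point_trans (same_point_sym pq) pr.
  case: qr => [qr|[b [c [bc qb rc]]]]; first by exfalso; apply: qrY; rewrite qr.
  have nbc : ~ same_vertex C b c.
    by move=> /side_splitP[_ K]; apply: qrY; rewrite qb rc.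
  have [v vG [bv cv]] := bc; exists v.
    by apply/(cut_nontriviallyP cutP vG); exists b, c.
  have bE := vert_endpoint vG bv.
  case: pq => [pq|[a [b' [ab pa qb']]]]; first by exists b => //; rewrite pq.
  exists a => //; apply/(vertE _ vG bv)/same_vertex_sym.
  by rewrite qb in qb'; rewrite (end_coord_inj bE qb').
have [|S SP ->] := @energy_attained _ _ P; first by exists Y; rewrite !finset.inE eqxx orbT.
have ecS := clP S SP; have [SE _ clS _] := ecS.
apply: ge_inf.
  by exists 0 => m [f ef]; exact: eigenvalue_ge0 ef.
exists g; split.
  have [e [eS eE ge]] : exists e, [/\ e \in S, e \in edges E & g e (len e / 2) != 0].
    move: SP; rewrite !finset.inE => /orP[] /eqP ->.
      by exists e1; split=> //; rewrite gt_eqF.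
    by exists e2; split=> //; rewrite lt_eqF.
  have pE : @on_edges R (sub_edges S) (e, len e / 2).
    by apply: (@mid_on_edges R (sub_edges S)); rewrite /= finset.inE eE eS.
  by exists (GPoint (cluster_graph C S) pE).
have [_ [g' [H1 H2 _ H4]]] := g_eig.
exists g'; split.
- move=> e x /andP[/=]; rewrite finset.inE => /andP[eE _] xl; apply: H1.
  by rewrite /on_edges /= eE.
- move=> v a b /(cluster_vert clS) vC av bv; apply: g_cont.
  by apply: ((is_cutP G C).1 cutP); exists v.
- move=> v a vD av; have vC : v \in verts (cluster_graph C S).
    exact: fintype.subsetP (dirichlet_verts_sub P S) _ vD.
  apply: cut0; first exact: vert_endpoint (cluster_vert clS vC) av.
  exact: (@dirichlet_vertsP R E P cutP S v a SE clS vC av).1.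
move=> v vC vD; have [a av] := vert_neq0 vC.
apply: H4; last by rewrite finset.inE.
apply: (@uncut_vert R E P cutP v a (cluster_vert clS vC) av) => ca.
by move/negP: vD; apply; apply/(@dirichlet_vertsP R E P cutP S v a SE clS vC av).
Qed.

End optimal.

(** * Conclusion *)

Section assembly.
Variables (R : realType) (E0 : edge_system R) (G : mgraph E0).
Hypothesis cG : econn G.

Lemma same_graph_econn (E : edge_system R) (B : mgraph E) : same_graph G B -> econn B.
Proof.
move=> [E3 [K [s [t [sGK tBK]]]]].
exact: econn_coarse tBK (econn_fine sGK cG).
Qed.

Lemma same_graph_mu2 (E : edge_system R) (B : mgraph E) : same_graph G B -> mu G 2 <= mu B 2.
Proof.
move=> sGB; have cB := same_graph_econn sGB.
have [w [w0 -> _ minw]] := mu2_least_positive cG.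
have [wB [wB0 -> [f ef] _]] := mu2_least_positive cB.
have [E3 [K [s [t [sGK tBK]]]]] := sGB.
have [g eg] := eigenfunction_coarse sGK wB0 (eigenfunction_fine tBK ef).
by apply: minw eg; rewrite exprn_gt0.
Qed.

Lemma optimal_partition_exists : exists (E : edge_system R) (P : gpartition E),
  exh_rigid G 2 P /\ energy P <= mu G 2.
Proof.
have [w [w0 -> [f ef] _]] := mu2_least_positive cG.
have [f' Hode _] := laplacian_ode ef.2.
have [E [s [H [sGH zero]]]] := zero_subdivision G w0 Hode.
have same : same_graph G H.
  by exists E, H, s, (id_subdivision E); split=> //; exact: subdivides_id.
have [P HP] := nodal_bipartition (econn_fine sGH cG) w0 same (eigenfunction_fine sGH ef) zero.
by exists E, P.
Qed.

Lemma mu2_le_energy (E : edge_system R) (P : gpartition E) : exh_rigid G 2 P ->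
  mu G 2 <= energy P.
Proof.
move=> [[sGB [cutP clP] cardP] exP _].
have [le _] := two_partition_energy cutP (same_graph_econn sGB) exP clP cardP.
exact: le_trans (same_graph_mu2 sGB) le.
Qed.

Lemma optimal_energy_mu2 : optimal_energy G 2 = mu G 2.
Proof.
apply: min_inf; last by move=> _ [E [P [HP ->]]]; exact: mu2_le_energy.
have [E [P [HP le]]] := optimal_partition_exists.
by exists E, P; split=> //; apply/eqP; rewrite eq_le le mu2_le_energy.
Qed.

Lemma same_partition_finer_refl (E : edge_system R) (P : gpartition E) :
  is_partition P -> same_partition_finer P P.
Proof.
move=> [_ clP]; exists (id_subdivision E).
split; [exact: subdivides_id | exact: subdivides_id |].
have sub S : S \in clusters P -> subdivided_edges (id_subdivision E) S = S.
  move=> /clP[/fintype.subsetP SE _]; apply/finset.setP => e.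
  rewrite finset.inE /=; apply: andb_idl; exact: SE.
apply/finset.setP => S; apply/idP/imsetP => [SP|[T TP ->]]; last by rewrite sub.
by exists S => //; rewrite sub.
Qed.

End assembly.

Theorem proposition5p6 (R : realType) (E0 : edge_system R) (G : mgraph E0)
    (conn_G : connected_graph G) :
  mu G 2 = optimal_energy G 2 /\
  forall (E : edge_system R) (P : gpartition E),
    exh_rigid G 2 P -> energy P = optimal_energy G 2 -> generalised_nodal P.
Proof.
have cG := connected_econn conn_G; rewrite (optimal_energy_mu2 cG); split=> // E P HP EP.
have [[sGB partP cardP] exP _] := HP; have [cutP clP] := partP.
have cB := same_graph_econn cG sGB.
have [le eq] := two_partition_energy cutP cB exP clP cardP.
have [|S1 [S2 [psi [F [c [w]]]]]] := eq.
  by apply/eqP; rewrite eq_le le EP same_graph_mu2.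
move=> [[PE S12 c1 c2 w0] psi_eig psi_ge0 F_psi F_eig].
exists E, P; split; first exact: same_partition_finer_refl.
exact: (nodal_generalised cutP exP clP PE S12 c1 c2 w0 psi_eig psi_ge0 F_psi F_eig).
Qed.
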